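(* Let $\Gamma$ be a finite graph and let $\mathcal{G}=\{G_v : v\in V(\Gamma)\}$ be a collection of groups each of which lies in $\mathcal{X}$. Then the graph product $GP(\Gamma,\mathcal{G})$ lies in $\mathcal{X}$.
   Context: A graph means a simplicial 1-complex (no loops, no multiple edges). The graph product $GP(\Gamma,\mathcal{G})$ is the quotient of the free product of the groups $G_v$ by the normal closure of $\{[g,h] : g\in G_u, h\in G_v, \{u,v\}\in E(\Gamma)\}$. $\mathcal{X}$ is the class of finitely generated groups $G$ satisfying at least one of: (i) $G$ is not one-ended; (ii) $G$ is not word-hyperbolic; (iii) $G$ contains a subgroup isomorphic to the fundamental group of a closed hyperbolic surface. *)

(* Defs.v *)
From HB Require Import structures.
From mathcomp Require Import all_boot all_order all_algebra.
From mathcomp Require Import generic_quotient.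
From mathcomp Require Import boolp classical_sets functions cardinality.
From mathcomp Require Import reals topology normedtype exp.

Set Implicit Arguments.
Unset Strict Implicit.
Unset Printing Implicit Defensive.

Import Order.TTheory GRing.Theory Num.Theory.
Import numFieldNormedType.Exports.

Local Open Scope quotient_scope.
Local Open Scope classical_set_scope.
Local Open Scope group_scope.

(* Groups are objects of [groupType] (mathcomp.boot.monoid), which may be
   infinite. *)

Section Subgroups.
Variable G : groupType.

Definition subgroup (H : set G) : Prop :=
  [/\ H 1, (forall x y, H x -> H y -> H (x * y)) & (forall x, H x -> H x^-1)].

Definition normal_subgroup (N : set G) : Prop :=
  subgroup N /\ (forall x y, N x -> N (x ^ y)).

Definition normal_closure (A : set G) : set G :=
  [set x | forall N, normal_subgroup N -> A `<=` N -> N x].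

Lemma normal_closure_normal (A : set G) : normal_subgroup (normal_closure A).
Proof.
split; first split.
- by move=> N [[]].
- move=> x y Ax Ay N nN AN; case: (nN) => [[_ M _] _].
  by apply: M; [exact: Ax|exact: Ay].
- by move=> x Ax N nN AN; case: (nN) => [[_ _ V] _]; apply: V; exact: Ax.
- by move=> x y Ax N nN AN; case: (nN) => [_ J]; apply: J; exact: Ax.
Qed.

Definition generates (S : seq G) : Prop :=
  forall H : set G, subgroup H -> [set` S] `<=` H -> H = setT.

Definition finitely_generated : Prop := exists S, generates S.

End Subgroups.

Section QuotientGroup.
Variables (G : groupType) (N : set G) (nN : normal_subgroup N).

Definition coset_rel of normal_subgroup N : rel G :=
  fun x y => `[< N (x^-1 * y) >].
Local Notation e := (coset_rel nN).

Fact coset_rel_refl : reflexive e.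
Proof. by move=> x; apply/asboolP; rewrite mulVg; case: nN => [[]]. Qed.

Fact coset_rel_sym : symmetric e.
Proof.
have h x y : e x y -> e y x.
  move=> /asboolP xy; apply/asboolP; case: nN => [[_ _ V] _].
  by have := V _ xy; rewrite invgM invgK.
by move=> x y; apply/idP/idP; exact: h.
Qed.

Fact coset_rel_trans : transitive e.
Proof.
move=> y x z /asboolP xy /asboolP yz; apply/asboolP; case: nN => [[_ M _] _].
by have := M _ _ xy yz; rewrite -mulgA mulVKg.
Qed.

Canonical coset_equiv :=
  EquivRel e coset_rel_refl coset_rel_sym coset_rel_trans.

Definition quotient_group := {eq_quot coset_equiv}.
HB.instance Definition _ := Choice.on quotient_group.
HB.instance Definition _ := EqQuotient.on quotient_group.

Definition quotient_proj (x : G) : quotient_group := \pi x.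
Local Notation proj := quotient_proj.

Lemma quotient_projP x y : proj x = proj y <-> N (x^-1 * y).
Proof.
split=> [/eqP|h]; first by rewrite /proj piE => /asboolP.
by apply/eqP; rewrite /proj piE; apply/asboolP.
Qed.

Lemma quotient_reprP x : N ((repr (proj x))^-1 * x).
Proof. by apply/quotient_projP; rewrite /proj reprK. Qed.

Definition quotient_mul (a b : quotient_group) := proj (repr a * repr b).
Definition quotient_inv (a : quotient_group) := proj (repr a)^-1.

Lemma quotient_mulE x y : quotient_mul (proj x) (proj y) = proj (x * y).
Proof.
apply/quotient_projP; case: nN => [[_ M _] J].
have := M _ _ (J _ (repr (proj y)) (quotient_reprP x)) (quotient_reprP y).
by rewrite /conjg invgM -!mulgA mulVKg.
Qed.

Lemma quotient_invE x : quotient_inv (proj x) = proj x^-1.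
Proof.
apply/quotient_projP; case: nN => [[_ _ V] J].
have := J _ x^-1 (V _ (quotient_reprP x)).
by rewrite /conjg invgM !invgK -!mulgA mulVKg.
Qed.

Lemma quotient_proj_ind (P : quotient_group -> Prop) :
  (forall x, P (proj x)) -> forall a, P a.
Proof. by move=> h a; rewrite -[a]reprK; exact: h. Qed.

Fact quotient_mulA : associative quotient_mul.
Proof.
elim/quotient_proj_ind => x; elim/quotient_proj_ind => y.
by elim/quotient_proj_ind => z; rewrite !quotient_mulE mulgA.
Qed.

Fact quotient_mul1g : left_id (proj 1) quotient_mul.
Proof. by elim/quotient_proj_ind => x; rewrite quotient_mulE mul1g. Qed.

Fact quotient_mulg1 : right_id (proj 1) quotient_mul.
Proof. by elim/quotient_proj_ind => x; rewrite quotient_mulE mulg1. Qed.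

Fact quotient_mulVg : left_inverse (proj 1) quotient_inv quotient_mul.
Proof.
by elim/quotient_proj_ind => x; rewrite quotient_invE quotient_mulE mulVg.
Qed.

Fact quotient_mulgV : right_inverse (proj 1) quotient_inv quotient_mul.
Proof.
by elim/quotient_proj_ind => x; rewrite quotient_invE quotient_mulE mulgV.
Qed.

HB.instance Definition _ := isGroup.Build quotient_group
  quotient_mulA quotient_mul1g quotient_mulg1 quotient_mulVg quotient_mulgV.

End QuotientGroup.

Section FreeProduct.
Variables (V : choiceType) (G : V -> groupType).

Definition letter := {v : V & G v}.
HB.instance Definition _ := Choice.on letter.

Definition mk_letter (v : V) (g : G v) : letter := existT _ v g.

Inductive fp_eq : seq letter -> seq letter -> Prop :=
| fp_refl s : fp_eq s s
| fp_sym s t : fp_eq s t -> fp_eq t s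
| fp_trans s t u : fp_eq s t -> fp_eq t u -> fp_eq s u
| fp_one s t v : fp_eq (s ++ mk_letter (1 : G v) :: t) (s ++ t)
| fp_mul s t v (g h : G v) :
    fp_eq (s ++ mk_letter g :: mk_letter h :: t) (s ++ mk_letter (g * h) :: t).

Definition fp_rel : rel (seq letter) := fun s t => `[< fp_eq s t >].

Fact fp_rel_refl : reflexive fp_rel.
Proof. by move=> s; apply/asboolP; exact: fp_refl. Qed.

Fact fp_rel_sym : symmetric fp_rel.
Proof.
by move=> s t; apply/idP/idP => /asboolP h; apply/asboolP; exact: fp_sym.
Qed.

Fact fp_rel_trans : transitive fp_rel.
Proof.
move=> t s u /asboolP st /asboolP tu; apply/asboolP; exact: fp_trans st tu.
Qed.

Canonical fp_equiv := EquivRel fp_rel fp_rel_refl fp_rel_sym fp_rel_trans.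

Definition free_product := {eq_quot fp_equiv}.
HB.instance Definition _ := Choice.on free_product.
HB.instance Definition _ := EqQuotient.on free_product.

Definition fp_class (s : seq letter) : free_product := \pi s.

Lemma fp_classP s t : fp_class s = fp_class t <-> fp_eq s t.
Proof.
split=> [/eqP|h]; first by rewrite /fp_class piE => /asboolP.
by apply/eqP; rewrite /fp_class piE; apply/asboolP.
Qed.

Lemma fp_reprP s : fp_eq (repr (fp_class s)) s.
Proof. by apply/fp_classP; rewrite /fp_class reprK. Qed.

Lemma fp_eq_catl u s t : fp_eq s t -> fp_eq (u ++ s) (u ++ t).
Proof.
elim=> {s t} [s|s t _ IH|s t w _ IH1 _ IH2|s t v|s t v g h].
- exact: fp_refl.
- exact: fp_sym.
- exact: fp_trans IH1 IH2.
- by rewrite !catA; exact: fp_one.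
- by rewrite !catA; exact: fp_mul.
Qed.

Lemma fp_eq_catr u s t : fp_eq s t -> fp_eq (s ++ u) (t ++ u).
Proof.
elim=> {s t} [s|s t _ IH|s t w _ IH1 _ IH2|s t v|s t v g h].
- exact: fp_refl.
- exact: fp_sym.
- exact: fp_trans IH1 IH2.
- by rewrite -!catA; exact: fp_one.
- by rewrite -!catA; exact: fp_mul.
Qed.

Definition letter_inv (l : letter) : letter := mk_letter (tagged l)^-1.
Definition word_inv (s : seq letter) : seq letter := rev (map letter_inv s).

Lemma word_inv_cat s t : word_inv (s ++ t) = word_inv t ++ word_inv s.
Proof. by rewrite /word_inv map_cat rev_cat. Qed.

Lemma word_invK : involutive word_inv.
Proof.
move=> s; rewrite /word_inv map_rev revK -map_comp -[RHS]map_id.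
by apply: eq_map => -[v g]; rewrite /= /letter_inv /mk_letter /= invgK.
Qed.

Lemma fp_eq_inv s t : fp_eq s t -> fp_eq (word_inv s) (word_inv t).
Proof.
elim=> {s t} [s|s t _ IH|s t w _ IH1 _ IH2|s t v|s t v g h].
- exact: fp_refl.
- exact: fp_sym.
- exact: fp_trans IH1 IH2.
- rewrite !word_inv_cat -cat1s word_inv_cat -catA.
  by rewrite /word_inv /= /letter_inv /= invg1; exact: fp_one.
- rewrite !word_inv_cat -[mk_letter g :: _]cat1s -[mk_letter h :: _]cat1s.
  rewrite -[mk_letter (g * h) :: _]cat1s !word_inv_cat -!catA.
  by rewrite {2 3 5}/word_inv /= /letter_inv /= invgM; exact: fp_mul.
Qed.

Lemma fp_eq_mulV s : fp_eq (s ++ word_inv s) [::].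
Proof.
elim/last_ind: s => [|s [v g] IH]; first exact: fp_refl.
rewrite -cats1 word_inv_cat -catA /= {1}/word_inv /= /letter_inv /=.
apply: fp_trans (fp_mul _ _ _ _) _; rewrite mulgV.
exact: fp_trans (fp_one _ _ _) IH.
Qed.

Definition fp_prod (a b : free_product) := fp_class (repr a ++ repr b).
Definition fp_inv (a : free_product) := fp_class (word_inv (repr a)).

Lemma fp_prodE s t : fp_prod (fp_class s) (fp_class t) = fp_class (s ++ t).
Proof.
apply/fp_classP; apply: fp_trans (fp_eq_catl _ (fp_reprP t)) _.
exact: fp_eq_catr (fp_reprP s).
Qed.

Lemma fp_invE s : fp_inv (fp_class s) = fp_class (word_inv s).
Proof. by apply/fp_classP/fp_eq_inv; exact: fp_reprP. Qed.

Lemma fp_class_ind (P : free_product -> Prop) :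
  (forall s, P (fp_class s)) -> forall a, P a.
Proof. by move=> h a; rewrite -[a]reprK; exact: h. Qed.

Fact fp_prodA : associative fp_prod.
Proof.
elim/fp_class_ind => s; elim/fp_class_ind => t; elim/fp_class_ind => u.
by rewrite !fp_prodE catA.
Qed.

Fact fp_prod1g : left_id (fp_class [::]) fp_prod.
Proof. by elim/fp_class_ind => s; rewrite fp_prodE. Qed.

Fact fp_prodg1 : right_id (fp_class [::]) fp_prod.
Proof. by elim/fp_class_ind => s; rewrite fp_prodE cats0. Qed.

Fact fp_prodgV : right_inverse (fp_class [::]) fp_inv fp_prod.
Proof.
elim/fp_class_ind => s; rewrite fp_invE fp_prodE.
by apply/fp_classP; exact: fp_eq_mulV.
Qed.

Fact fp_prodVg : left_inverse (fp_class [::]) fp_inv fp_prod.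
Proof.
elim/fp_class_ind => s; rewrite fp_invE fp_prodE; apply/fp_classP.
by rewrite -{2}[s]word_invK; exact: fp_eq_mulV.
Qed.

HB.instance Definition _ := isGroup.Build free_product
  fp_prodA fp_prod1g fp_prodg1 fp_prodVg fp_prodgV.

Definition fp_in (v : V) (g : G v) : free_product := fp_class [:: mk_letter g].

End FreeProduct.

Section GraphProduct.
Variables (V : choiceType) (E : rel V) (G : V -> groupType).

Definition edge_commutators : set (free_product G) :=
  [set x | exists u v (g : G u) (h : G v),
             E u v /\ x = [~ fp_in g, fp_in h]].

Definition graph_product : groupType :=
  quotient_group (normal_closure_normal edge_commutators).

End GraphProduct.

Section CayleyGraph.
Variable G : groupType.
Implicit Types (S K : seq G) (x y z w : G).

Definition cayley S : rel G :=
  fun x y => (x^-1 * y \in S) || (y^-1 * x \in S).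

Definition component S K x : set G :=
  [set y | exists p, [/\ path (cayley S) x p, last x p = y &
                         all (fun z => z \notin K) (x :: p)]].

(* The number of ends of the Cayley graph is the supremum, over finite sets K
   of vertices, of the number of infinite components of the complement of K. *)
Definition ends_ge S (n : nat) : Prop :=
  exists (K : seq G) (f : 'I_n -> G),
    (forall i, infinite_set (component S K (f i))) /\
    (forall i j, i != j -> ~ component S K (f i) (f j)).

Definition one_ended : Prop :=
  exists S, [/\ generates S, ends_ge S 1 & ~ ends_ge S 2].

(* Number of edges of a shortest path of the Cayley graph; the default value 0
   is not used when S generates G. *)
Definition word_dist S x y : nat :=
  xget 0%N [set n | (exists2 p, path (cayley S) x p /\ last x p = y & size p = n)
            /\ forall p, path (cayley S) x p -> last x p = y -> (n <= size p)%N].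

Local Open Scope ring_scope.

Definition gromov_product S w x y : rat :=
  ((word_dist S x w)%:R + (word_dist S y w)%:R - (word_dist S x y)%:R) / 2.

(* Gromov's inequality on the vertices of the Cayley graph, for some finite
   generating set. *)
Definition word_hyperbolic : Prop :=
  exists S, generates S /\ exists delta : rat, forall w x y z : G,
    Num.min (gromov_product S w x y) (gromov_product S w y z) - delta
      <= gromov_product S w x z.

End CayleyGraph.

Section Surfaces.
Variable R : realType.
Local Open Scope ring_scope.

Definition arcosh (t : R) : R := ln (t + Num.sqrt (t ^+ 2 - 1)).

(* Upper half-plane model. *)
Definition hyp_plane : set (R * R) := [set z | 0 < z.2].

Definition hyp_dist (z w : R * R) : R :=
  arcosh (1 + ((z.1 - w.1) ^+ 2 + (z.2 - w.2) ^+ 2) / (2 * z.2 * w.2)).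

Definition hyp_ball (z : R * R) (r : R) : set (R * R) :=
  [set w | hyp_plane w /\ hyp_dist z w < r].

(* A nonempty compact connected metric space locally isometric to the
   hyperbolic plane; orientability is not required. *)
Definition closed_hyperbolic_surface (X : metricType R) : Prop :=
  [/\ [set: X] !=set0, compact [set: X], connected [set: X] &
      forall p : X, exists2 r : R, 0 < r & exists f : X -> R * R,
        [/\ hyp_plane (f p),
            f @` ball p r = hyp_ball (f p) r &
            forall q q', ball p r q -> ball p r q' ->
              mdist q q' = hyp_dist (f q) (f q')]].

End Surfaces.

Section FundamentalGroup.
Variables (R : realType) (X : topologicalType) (p : X).
Local Open Scope ring_scope.

Let I : set R := [set` `[0, 1]].

(* Only the values on [0, 1] of a function R -> X are relevant. *)
Definition loop : set (R -> X) :=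
  [set a | [/\ {within I, continuous a}, a 0 = p & a 1 = p]].

Definition loop_concat (a b : R -> X) : R -> X :=
  fun t => if t <= 2^-1 then a (2 * t) else b (2 * t - 1).

Definition loop_homotopic (a b : R -> X) : Prop :=
  exists H : R * R -> X,
    [/\ {within I `*` I, continuous H},
        (forall t, I t -> H (t, 0) = a t /\ H (t, 1) = b t) &
        (forall s, I s -> H (0, s) = p /\ H (1, s) = p)].

(* P is isomorphic to pi_1(X, p): the map c identifies P with the set of
   homotopy classes of loops at p, the product being concatenation. *)
Definition is_fundamental_group (P : groupType) : Prop :=
  exists c : (R -> X) -> P,
    [/\ (forall g, exists2 a, loop a & c a = g),
        (forall a b, loop a -> loop b -> (c a = c b <-> loop_homotopic a b)) &
        (forall a b, loop a -> loop b ->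
           c (loop_concat a b) = (c a * c b)%g)].

End FundamentalGroup.

Definition contains_hyperbolic_surface_group (R : realType) (G : groupType) :=
  exists (X : metricType R) (p : X) (P : groupType) (f : P -> G),
    [/\ closed_hyperbolic_surface X, is_fundamental_group R p P,
        injective f & {morph f : x y / x * y}].

Definition class_X (R : realType) (G : groupType) : Prop :=
  finitely_generated G /\
  [\/ ~ one_ended G, ~ word_hyperbolic G |
      contains_hyperbolic_surface_group R G].

(* Main.v *)
(** Suppose that the graph product is one-ended and hyperbolic; only the vertices
    with a nontrivial group matter.

    If they form a clique, at most one vertex group is infinite, because a
    hyperbolic group contains no two commuting infinite retracts.  One of them,
    G v, is infinite since the product is; the retraction onto it has a finite
    kernel, so G v is one-ended and hyperbolic, and contains a surface group.

    Otherwise let K be a minimal separator of the graph.  If K is a clique, its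
    vertex groups are finite, as an infinite one would commute with the free product
    of the groups of two neighbours on opposite sides; so the product splits over
    the finite subgroup generated by K and has at least two ends.  If K contains two
    nonadjacent vertices, shortest paths between them through two components of the
    complement of K form an induced cycle of length n >= 4.  Length 4 contradicts
    hyperbolicity.  For n >= 5 the reflections in the sides of a regular right-angled
    n-gon act on the hyperbolic plane; their subgroup of index 2^n acting freely is
    a surface group, and it embeds in the product by replacing each reflection
    alternately by a fixed element g and by its inverse. *)

Require Import Defs.
From HB Require Import structures.
From mathcomp Require Import all_boot all_order all_algebra.
From mathcomp Require Import generic_quotient zify ring lra.
From mathcomp Require Import boolp classical_sets functions cardinality.
From mathcomp Require Import reals topology normedtype exp sequences realfun.
From mathcomp Require Import trigo.

Set Implicit Arguments.
Unset Strict Implicit.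
Unset Printing Implicit Defensive.

Import Order.TTheory GRing.Theory Num.Theory.
Import numFieldNormedType.Exports.

Local Open Scope classical_set_scope.

(** * Orbit spaces of free isometric actions *)

Local Open Scope quotient_scope.
Local Open Scope ring_scope.

(** No normal form theorem for graph products is used. To tell elements apart, the letters act on a
    set of states, the defining relations are checked on the states, and the element is read off
    from the state it reaches. The retractions, the dihedral subgroups, the count of crossings of a
    separator, the embedding of the even Coxeter subgroup and the tiling all arise in this way. The
    vertex groups are arbitrary, so a chosen nontrivial g may have any order, and sending a
    reflection to g is in general no homomorphism of the Coxeter group. Alternating g with its
    inverse gives a map that is multiplicative on the elements with an even number of occurrences of
    each reflection; these elements also form the subgroup that acts freely. [one_ended] and
    [word_hyperbolic] ask for some generating set, so their negations are proved for every one. The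
    bound n >= 5 ensures that the cosine of 2 pi / n is positive, from which the regular
    right-angled n-gon is built. *)

Section WithinMetric.
Variables (R : realType) (U : pseudoMetricType R) (Y : metricType R).
Implicit Types (K : set U) (f : U -> Y).

Lemma within_continuousP K f : {within K, continuous f} <->
  forall x, K x -> forall e, 0 < e -> exists2 d, 0 < d &
    forall x', K x' -> ball x d x' -> mdist (f x) (f x') < e.
Proof.
split=> [/subspace_continuousP h x Kx e e0|h].
  have : nbhs (f x) (ball (f x) e) by exact: nbhsx_ballx.
  move=> /(h x Kx); rewrite /= -nbhs_ballE => -[d d0 hd].
  exists d => // x' Kx' /hd /(_ Kx') /=; by rewrite ballEmdist.
apply/subspace_continuousP => x Kx B; rewrite -nbhs_ballE => -[e /= e0 eB].
have [d d0 hd] := h x Kx e e0.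
rewrite /= -nbhs_ballE; exists d => // x' xx' Kx'; apply: eB.
by rewrite ballEmdist; exact: hd.
Qed.

Lemma within_uniform K f : compact K -> {within K, continuous f} ->
  forall e, 0 < e -> exists2 d, 0 < d &
    forall x x', K x -> K x' -> ball x d x' -> mdist (f x) (f x') < e.
Proof.
move=> /compact_near_coveringP/near_covering_withinP cK /within_continuousP h e e0.
have := cK R (0^'+ : set_system R)
  (fun d x => forall x', K x' -> ball x d x' -> mdist (f x) (f x') < e) _ _.
case.
- move=> x Kx; have e2 : 0 < e / 2 by lra.
  have [d d0 hd] := h x Kx _ e2.
  exists (ball x (d / 2), [set r | 0 < r < d / 2]) => /=.
    split; first by apply: nbhsx_ballx; lra.
    apply: filterS2 (nbhs_right_gt 0) (nbhs_right_lt (z := d / 2) _); last by lra.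
    by move=> r r0 rd; rewrite /= r0.
  move=> [x' r] /= [xx' /andP[r0 rd]] Kx' x'' Kx'' x'x''.
  apply: le_lt_trans (metric_triangle _ (f x) _) _; rewrite [e]splitr.
  apply: ltrD.
    rewrite metric_sym; apply: hd => //; apply: le_ball xx'; lra.
  apply: hd => //; have -> : d = d / 2 + d / 2 by lra.
  by apply: ball_triangle xx' _; apply: le_ball x'x''; lra.
- move=> d /= d0 hd; exists (d / 2); first by lra.
  have h2 : ball (0 : R) d (d / 2) by rewrite /ball /= sub0r normrN gtr0_norm; lra.
  have h3 : 0 < d / 2 by lra.
  move=> x x' Kx Kx' xx'; exact: (hd (d / 2) h2 h3 x Kx x' Kx' xx').
Qed.

End WithinMetric.

(** [fa_sep] makes the orbits uniformly discrete, which gives freeness and charts of one size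
    everywhere. The factor 4 is for [close_lift], where two points of a fibre are joined by four
    steps shorter than the radius. *)
Record free_action (R : realType) (Y : metricType R) (P : groupType) := FreeAction {
  fa_act : P -> Y -> Y;
  fa_act1 : forall y, fa_act 1%g y = y;
  fa_actM : forall g h y, fa_act (g * h)%g y = fa_act g (fa_act h y);
  fa_isom : forall g x y, mdist (fa_act g x) (fa_act g y) = mdist x y;
  fa_radius : R;
  fa_radius_gt0 : 0 < fa_radius;
  fa_sep : forall g y, mdist y (fa_act g y) < 4 * fa_radius -> g = 1%g }.

Section OrbitSpace.
Variables (R : realType) (Y : metricType R) (P : groupType) (A : free_action Y P).
Local Notation act := (fa_act A).
Local Notation eps := (fa_radius A).

Definition orbit_rel (_ : free_action Y P) : rel Y :=
  fun x y => `[< exists g, y = act g x >].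
Local Notation e := (orbit_rel A).

Fact orbit_rel_refl : reflexive e.
Proof. by move=> x; apply/asboolP; exists 1%g; rewrite fa_act1. Qed.

Fact orbit_rel_sym : symmetric e.
Proof.
have h x y : e x y -> e y x.
  move=> /asboolP[g ->]; apply/asboolP; exists g^-1%g.
  by rewrite -fa_actM mulVg fa_act1.
by move=> x y; apply/idP/idP; exact: h.
Qed.

Fact orbit_rel_trans : transitive e.
Proof.
move=> y x z /asboolP[g ->] /asboolP[h ->]; apply/asboolP.
by exists (h * g)%g; rewrite fa_actM.
Qed.

Canonical orbit_equiv := EquivRel e orbit_rel_refl orbit_rel_sym orbit_rel_trans.

Definition orbit_space := {eq_quot orbit_equiv}.
HB.instance Definition _ := Choice.on orbit_space.
HB.instance Definition _ := EqQuotient.on orbit_space.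

Definition orbit_proj (y : Y) : orbit_space := \pi y.
Local Notation proj := orbit_proj.

Lemma orbit_projP x y : proj x = proj y <-> exists g, y = act g x.
Proof.
split=> [/eqP|h]; first by rewrite /proj piE => /asboolP.
by apply/eqP; rewrite /proj piE; apply/asboolP.
Qed.

Lemma orbit_proj_act g y : proj (act g y) = proj y.
Proof. by apply/esym/orbit_projP; exists g. Qed.

Lemma orbit_proj_surj q : exists y, proj y = q.
Proof. by exists (repr q); exact: reprK. Qed.

Lemma orbit_sep x y : proj x = proj y -> mdist x y < 4 * eps -> x = y.
Proof. by move=> /orbit_projP[g ->] /fa_sep ->; rewrite fa_act1. Qed.

Lemma fa_free g h y : act g y = act h y -> g = h.
Proof.
move=> gh; have : act (h^-1 * g)%g y = y by rewrite fa_actM gh -fa_actM mulVg fa_act1.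
move=> hgy; have /(congr1 ( *%g h)) : (h^-1 * g)%g = 1%g.
  by apply: (@fa_sep _ _ _ A _ y); rewrite hgy mdistxx; have := fa_radius_gt0 A; lra.
by rewrite mulVKg mulg1.
Qed.

(* Truncating at eps lets the distance be realized by a pair of representatives,
   which is unique up to the action. *)
Definition orbit_dist (q q' : orbit_space) : R :=
  xget eps [set r | exists x y, [/\ proj x = q, proj y = q', mdist x y = r & r < eps]].

Lemma orbit_dist_proj x y : mdist x y < eps -> orbit_dist (proj x) (proj y) = mdist x y.
Proof.
move=> xy; have e0 := fa_radius_gt0 A.
rewrite /orbit_dist; case: xgetP => [r _ [x' [y' [xx' yy' <- lt]]]|no]; last first.
  by case: (no (mdist x y)); exists x, y.
(* Both pairs of representatives differ by one group element: [act g y'] and [act h y'] are less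
   than [2 * eps] apart in one orbit, hence equal. *)
have [g gx] := (orbit_projP x' x).1 xx'; have [h hy] := (orbit_projP y' y).1 yy'.
suff gh : g = h by rewrite gx hy gh fa_isom.
subst x y; apply: (@fa_free _ _ y'); apply: orbit_sep; first by rewrite !orbit_proj_act.
apply: le_lt_trans (metric_triangle _ (act g x') _) _.
rewrite fa_isom [mdist y' _]metric_sym; lra.
Qed.

Lemma orbit_distP q q' :
  (exists x y, [/\ proj x = q, proj y = q', mdist x y < eps &
                  orbit_dist q q' = mdist x y]) \/ orbit_dist q q' = eps.
Proof.
rewrite /orbit_dist; case: xgetP => [r _ [x [y [<- <- xy lt]]]|no]; last by right.
by left; exists x, y; split; rewrite // xy.
Qed.

Lemma orbit_dist_lift x q : orbit_dist (proj x) q < eps ->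
  exists2 y, proj y = q & mdist x y = orbit_dist (proj x) q.
Proof.
move=> lt; case: (orbit_distP (proj x) q) => [[x' [y [xx' <- xy ->]]]|]; last by lra.
have [g ->] := (orbit_projP x' x).1 xx'.
by exists (act g y); rewrite ?orbit_proj_act ?fa_isom.
Qed.

Lemma orbit_dist_le_radius q q' : 0 <= orbit_dist q q' <= eps.
Proof.
have e0 := fa_radius_gt0 A.
case: (orbit_distP q q') => [[x [y [_ _ xy ->]]]|->]; last by apply/andP; split; lra.
by rewrite mdist_ge0 ltW.
Qed.

Fact orbit_distxx q : orbit_dist q q = 0.
Proof.
have [x <-] := orbit_proj_surj q.
by rewrite orbit_dist_proj mdistxx // fa_radius_gt0.
Qed.

Fact orbit_dist_eq0 q q' : orbit_dist q q' = 0 -> q = q'.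
Proof.
have e0 := fa_radius_gt0 A.
case: (orbit_distP q q') => [[x [y [<- <- xy ->]]] /mdist_positivity ->|->] //.
by move=> h; exfalso; lra.
Qed.

Fact orbit_dist_sym q q' : orbit_dist q q' = orbit_dist q' q.
Proof.
case: (orbit_distP q q') => [[x [y [<- <- xy ->]]]|e1].
  by rewrite metric_sym orbit_dist_proj // metric_sym.
case: (orbit_distP q' q) => [[x [y [<- <- xy ->]]]|->] //.
by rewrite metric_sym orbit_dist_proj // metric_sym.
Qed.

Fact orbit_dist_triangle q' q q'' :
  orbit_dist q q'' <= orbit_dist q q' + orbit_dist q' q''.
Proof.
have /andP[_ h0] := orbit_dist_le_radius q q''.
have /andP[h1 _] := orbit_dist_le_radius q q'.
have /andP[h2 _] := orbit_dist_le_radius q' q''.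
have [[x [y [xq yq' xy e1]]]|e1] := orbit_distP q q'; last by lra.
have [lt|ge] := ltP (orbit_dist q' q'') eps; last by lra.
rewrite -yq' in lt e1 *; have [z <- yz] := orbit_dist_lift lt.
rewrite -xq in e1 *; rewrite e1 -yz.
have [xz|xz] := ltP (mdist x z) eps.
  by rewrite orbit_dist_proj //; exact: metric_triangle.
have := metric_triangle x y z.
have /andP[_ h3] := orbit_dist_le_radius (proj x) (proj z).
by move: xz h3; lra.
Qed.

HB.instance Definition _ := isMetric.Build R orbit_space
  orbit_distxx orbit_dist_eq0 orbit_dist_sym orbit_dist_triangle.

Lemma mdist_orbit q q' : mdist q q' = orbit_dist q q'. Proof. by []. Qed.

Lemma orbit_proj_lipschitz x y : mdist (proj x) (proj y) <= mdist x y.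
Proof.
rewrite mdist_orbit; have [xy|xy] := ltP (mdist x y) eps; first by rewrite orbit_dist_proj.
by have /andP[_] := orbit_dist_le_radius (proj x) (proj y); lra.
Qed.

Lemma orbit_proj_continuous : continuous proj.
Proof.
move=> y B; rewrite -nbhs_ballE => -[r /= r0 rB].
rewrite -nbhs_ballE; exists r => // z; rewrite ballEmdist /= => yz; apply: rB.
rewrite ballEmdist /=; exact: le_lt_trans (orbit_proj_lipschitz _ _) yz.
Qed.

End OrbitSpace.

(** * Path lifting and the fundamental group of the orbit space *)

Section Lifting.
Variables (R : realType) (Y : metricType R) (P : groupType) (A : free_action Y P).
Local Notation act := (fa_act A).
Local Notation eps := (fa_radius A).
Local Notation proj := (orbit_proj A).
Local Notation X := (orbit_space A).
Let I : set R := [set` `[0, 1]].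

Definition is_lift (a : R -> X) (l : R -> Y) : Prop :=
  {within I, continuous l} /\ forall t, I t -> proj (l t) = a t.

(** The distance between two lifts is continuous and starts at 0. Points of a fibre closer than
    [4 * eps] coincide, so the distance cannot take the value [2 * eps] and the lifts never
    separate. *)
Lemma lift_unique a l l' : is_lift a l -> is_lift a l' -> l 0 = l' 0 ->
  forall t, I t -> l t = l' t.
Proof.
move=> [lc la] [l'c l'a] l0 t It; apply: contrapT => ne.
have e0 := fa_radius_gt0 A.
have t0 : 0 <= t by move: It; rewrite /I /= in_itv /= => /andP[].
have t1 : t <= 1 by move: It; rewrite /I /= in_itv /= => /andP[].
have far s : I s -> mdist (l s) (l' s) < 4 * eps -> l s = l' s.
  by move=> Is; apply: (orbit_sep (A := A)); rewrite la ?l'a.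
have sub : [set` `[0, t]] `<=` I.
  move=> s; rewrite /I /= !in_itv /= => /andP[-> st]; exact: le_trans t1.
have cont : {within [set` `[0, t]], continuous (fun s => mdist (l s) (l' s) : R^o)}.
  apply/within_continuousP => s /sub Is r r0; have r2 : 0 < r / 2 by lra.
  have [d d0 hd] := (within_continuousP _ _).1 lc s Is _ r2.
  have [d' d'0 hd'] := (within_continuousP _ _).1 l'c s Is _ r2.
  exists (Num.min d d'); first by rewrite lt_min d0.
  move=> s' /sub Is' ss'.
  have h1 : mdist (l s) (l s') < r / 2.
    by apply: hd Is' _; apply: le_ball ss'; rewrite ge_min lexx.
  have h2 : mdist (l' s) (l' s') < r / 2.
    by apply: hd' Is' _; apply: le_ball ss'; rewrite ge_min lexx orbT.
  change (`|mdist (l s') (l' s') - mdist (l s) (l' s)| < r).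
  have := metric_triangle (l s) (l s') (l' s); have := metric_triangle (l s') (l' s') (l' s).
  have := metric_triangle (l s') (l s) (l' s'); have := metric_triangle (l s) (l' s) (l' s').
  rewrite [mdist (l s') (l s)]metric_sym [mdist (l' s') (l' s)]metric_sym.
  by rewrite ltr_norml => *; apply/andP; split; lra.
have [c c0t fc] : exists2 c, c \in `[0, t] & mdist (l c) (l' c) = 2 * eps.
  apply: (IVT (f := fun s => mdist (l s) (l' s))) => //.
  rewrite l0 mdistxx ge_min le_max; apply/andP; split; first by apply/orP; left; lra.
  apply/orP; right; rewrite leNgt; apply/negP => lt.
  by apply: ne; apply: far => //; lra.
have Ic : I c by apply: sub.
have lc' : l c = l' c by apply: far => //; rewrite fc; lra.
by move: fc; rewrite lc' mdistxx; lra.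
Qed.

(** The fibre over [b t] has exactly one point within [eps] of [l t]; the new lift consists of these
    points. *)
Lemma close_lift a b l : is_lift a l -> {within I, continuous b} ->
  (forall t, I t -> mdist (a t) (b t) < eps) ->
  exists2 l', is_lift b l' & forall t, I t -> mdist (l t) (l' t) < eps.
Proof.
move=> [lc la] bc close; have e0 := fa_radius_gt0 A.
have ex t : exists y, I t -> proj y = b t /\ mdist (l t) y < eps.
  have [It|] := pselect (I t); last by exists (l 0).
  have lt := close t It; rewrite -la // mdist_orbit in lt.
  have [y yb ly] := orbit_dist_lift lt.
  by exists y; rewrite ly.
pose l' t := sval (cid (ex t)).
have l'P t : I t -> proj (l' t) = b t /\ mdist (l t) (l' t) < eps.
  exact: (svalP (cid (ex t))).
exists l'; last by move=> t /l'P[].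
split; last by move=> t /l'P[].
apply/within_continuousP => t It r r0.
pose r' := Num.min r eps.
have r'0 : 0 < r' by rewrite lt_min r0.
have r'e : r' <= eps by rewrite ge_min lexx orbT.
have r'r : r' <= r by rewrite ge_min lexx.
have [d d0 hd] := (within_continuousP _ _).1 lc t It _ r'0.
have [d' d'0 hd'] := (within_continuousP _ _).1 bc t It _ r'0.
exists (Num.min d d'); first by rewrite lt_min d0.
move=> s Is ts.
have h1 : mdist (l t) (l s) < r'.
  by apply: hd Is _; apply: le_ball ts; rewrite ge_min lexx.
have h2 : mdist (b t) (b s) < r'.
  by apply: hd' Is _; apply: le_ball ts; rewrite ge_min lexx orbT.
have [bt lt] := l'P t It; have [bs ls] := l'P s Is.
have h3 : orbit_dist (proj (l' t)) (b s) < eps.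
  by rewrite bt -mdist_orbit; apply: lt_le_trans r'e.
have [z zs tz] := orbit_dist_lift h3.
rewrite bt -mdist_orbit in tz.
suff -> : l' s = z by rewrite tz; apply: lt_le_trans r'r.
apply: (orbit_sep (A := A)); first by rewrite bs zs.
have := metric_triangle (l' s) (l s) z; have := metric_triangle (l s) (l t) z.
have := metric_triangle (l t) (l' t) z.
rewrite [mdist (l' s) (l s)]metric_sym [mdist (l s) (l t)]metric_sym; lra.
Qed.

(** The square is cut into [N.+1] strips across which [H] moves by less than [eps], and [close_lift]
    passes from one slice to the next. An end that stays fixed lifts to a fixed point, since fibres
    are discrete. Only the lift of the last slice is kept, which is what monodromy needs. *)
Lemma homotopy_lift (H : R * R -> X) l : {within I `*` I, continuous H} ->
  is_lift (fun t => H (t, 0)) l ->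
  exists l', [/\ is_lift (fun t => H (t, 1)) l',
    (forall s, I s -> H (0, s) = H (0, 0)) -> l' 0 = l 0 &
    (forall s, I s -> H (1, s) = H (1, 0)) -> l' 1 = l 1].
Proof.
move=> Hc hl; have e0 := fa_radius_gt0 A.
have I0 : I 0 by rewrite /I /= in_itv /= lexx ler01.
have I1 : I 1 by rewrite /I /= in_itv /= ler01 lexx.
have cI : compact I by exact: segment_compact.
have [d d0 hd] := within_uniform (compact_setX cI cI) Hc e0.
have [N hN] : exists N : nat, N.+1%:R^-1 < d.
  exists (Num.Def.archi_bound d^-1).
  rewrite invf_plt ?posrE //; have d'0 : 0 <= d^-1 by rewrite invr_ge0 ltW.
  by apply: lt_trans (archi_boundP d'0) _; rewrite ltr_nat.
have Ik k : (k <= N.+1)%N -> I (k%:R / N.+1%:R).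
  move=> kN; rewrite /I /= in_itv /=; apply/andP; split.
    by apply: divr_ge0; rewrite ler0n.
  by rewrite ler_pdivrMr ?ltr0n // mul1r ler_nat.
have sec s : I s -> {within I, continuous (fun t => H (t, s))}.
  move=> Is; apply/within_continuousP => t It r r0.
  have [d1 d10 hd1] := (within_continuousP _ _).1 Hc (t, s) (conj It Is) r r0.
  exists d1 => // t' It' tt'; apply: hd1; first by split.
  by split=> //=; exact: ballxx.
suff key k : (k <= N.+1)%N -> exists l', [/\ is_lift (fun t => H (t, k%:R / N.+1%:R)) l',
    (forall s, I s -> H (0, s) = H (0, 0)) -> l' 0 = l 0 &
    (forall s, I s -> H (1, s) = H (1, 0)) -> l' 1 = l 1].
  by have := key N.+1 (leqnn _); rewrite divff // pnatr_eq0.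
elim: k => [_|k IH kN].
  by exists l; split=> //; rewrite mul0r.
have [l' [ll' l'0 l'1]] := IH (ltnW kN).
have [|t It|l'' ll'' close] := close_lift ll' (b := fun t => H (t, k.+1%:R / N.+1%:R)).
- exact: sec (Ik _ kN).
- apply: hd => //; [split=> //; exact: Ik (ltnW kN)|split=> //; exact: Ik|].
  split=> /=; first exact: ballxx.
  rewrite /ball /= -mulrBl -natr1 opprD addNKr; rewrite mulN1r normrN.
  by rewrite gtr0_norm // invr_gt0 ltr0n.
have glue t : I t -> (forall s, I s -> H (t, s) = H (t, 0)) -> l'' t = l' t.
  move=> It Ht; apply: (orbit_sep (A := A)).
    rewrite ll''.2 // ll'.2 // Ht; last exact: Ik.
    by rewrite Ht //; exact: Ik (ltnW kN).
  by have := close t It; rewrite metric_sym; lra.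
exists l''; split=> // h; first by rewrite glue // l'0.
by rewrite glue // l'1.
Qed.

(** Contracting the path to its origin by [a (t * s)] reduces the claim to [homotopy_lift], starting
    from the constant lift at [y]. *)
Lemma path_lift a y : {within I, continuous a} -> proj y = a 0 ->
  exists2 l, is_lift a l & l 0 = y.
Proof.
move=> ac ya.
have I0 : I 0 by rewrite /I /= in_itv /= lexx ler01.
have cI : compact I by exact: segment_compact.
have II t s : I t -> I s -> I (t * s).
  rewrite /I /= !in_itv /= => /andP[t0 t1] /andP[s0 s1].
  by rewrite mulr_ge0 //= mulr_ile1.
have [||l [ll l0 _]] := @homotopy_lift (fun z => a (z.1 * z.2)) (fun=> y).
- apply/within_continuousP => -[t s] [/= It Is] r r0.
  have [d d0 hd] := (within_continuousP _ _).1 ac (t * s) (II _ _ It Is) r r0.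
  exists (d / 2) => [|[t' s'] [/= It' Is'] [/= tt' ss']]; first by lra.
  apply: hd; first exact: II.
  move: tt' ss'; rewrite /ball /=.
  move: It Is It' Is'; rewrite /I /= !in_itv /=.
  move=> /andP[? ?] /andP[? ?] /andP[? ?] /andP[? ?] ht hs.
  have -> : t * s - t' * s' = (t - t') * s + t' * (s - s') by ring.
  apply: le_lt_trans (ler_normD _ _) _; rewrite !normrM.
  have h1 : `|t - t'| * `|s| <= `|t - t'|.
    by apply: ler_piMr => //; rewrite ger0_norm.
  have h2 : `|t'| * `|s - s'| <= `|s - s'|.
    by apply: ler_piMl => //; rewrite ger0_norm.
  lra.
- split=> [|t It /=]; first by apply: continuous_subspaceT; exact: cst_continuous.
  by rewrite mulr0.
exists l; last by apply: l0 => s Is /=; rewrite !mul0r.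
by split=> [|t It]; [exact: ll.1|rewrite ll.2 //= mulr1].
Qed.

Section FundamentalGroup.
Variable y0 : Y.
(* A continuous choice of paths, contracting Y. *)
Variable m : Y -> Y -> R -> Y.
Hypothesis m0 : forall x y, m x y 0 = x.
Hypothesis m1 : forall x y, m x y 1 = y.
Hypothesis mxx : forall x t, m x x t = x.
Hypothesis mC : continuous (fun z : Y * Y * R => m z.1.1 z.1.2 z.2).
Local Notation p := (proj y0).

Let I0 : I 0. Proof. by rewrite /I /= in_itv /= lexx ler01. Qed.
Let I1 : I 1. Proof. by rewrite /I /= in_itv /= ler01 lexx. Qed.

Let within_m (U : pseudoMetricType R) (K : set U) (f g : U -> Y) (h : U -> R) :
  {within K, continuous f} -> {within K, continuous g} ->
  {within K, continuous h} -> {within K, continuous (fun u => m (f u) (g u) (h u))}.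
Proof.
move=> /subspace_continuousP fc /subspace_continuousP gc /subspace_continuousP hc.
apply/subspace_continuousP => u Ku.
have h1 : (f u', g u', h u') @[u' --> within K (nbhs u)] --> (f u, g u, h u).
  exact: (cvg_pair (cvg_pair (fc u Ku) (gc u Ku)) (hc u Ku)).
exact: (cvg_comp _ _ h1 (@mC (f u, g u, h u))).
Qed.

Let proj_within (U : pseudoMetricType R) (K : set U) (f : U -> Y) :
  {within K, continuous f} -> {within K, continuous (proj \o f)}.
Proof.
move=> /within_continuousP fc; apply/within_continuousP => u Ku r r0.
have [d d0 hd] := fc u Ku r r0; exists d => // u' Ku' /(hd _ Ku').
exact/le_lt_trans/orbit_proj_lipschitz.
Qed.

Let is_monodromy (a : R -> X) (g : P) : Prop :=
  exists l, [/\ is_lift a l, l 0 = y0 & l 1 = act g y0].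

Definition monodromy (a : R -> X) : P := xget 1%g [set g | is_monodromy a g].

Let monodromy_unique a g : is_monodromy a g -> monodromy a = g.
Proof.
move=> hg; have [l [la l0 l1]] := hg; rewrite /monodromy.
case: xgetP => [h _ [l' [l'a l'0 l'1]]|/(_ g hg) //].
apply: (@fa_free _ _ _ A _ _ y0); rewrite -l1 -l'1.
by apply: (lift_unique l'a la) => //; rewrite l0.
Qed.

Let monodromyP a : @loop R X p a -> is_monodromy a (monodromy a).
Proof.
move=> [ac a0 a1]; have [l la l0] := path_lift ac (esym a0).
have [g gl] : exists g, l 1 = act g y0.
  by apply/(orbit_projP A); rewrite la.2 ?a1.
suff h : is_monodromy a g by rewrite (monodromy_unique h).
by exists l.
Qed.

(** A loop is sent to the [g] for which its lift from [y0] ends at [act g y0]. The map [m] gives a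
    path to each [act g y0], hence surjectivity, and joins two lifts with the same ends, hence
    injectivity. A concatenation lifts to the lift of [a] followed by the translate, by the
    monodromy of [a], of the lift of [b]. *)
Lemma orbit_space_fundamental_group : is_fundamental_group R p P.
Proof.
exists monodromy; split=> [g|a b la lb|a b la lb].
- pose l := m y0 (act g y0).
  have lc : {within I, continuous l}.
    apply: (within_m (f := fun=> y0) (g := fun=> act g y0) (h := id)).
    + by apply: continuous_subspaceT; exact: cst_continuous.
    + by apply: continuous_subspaceT; exact: cst_continuous.
    + by apply: continuous_subspaceT => t; exact: cvg_id.
  exists (proj \o l); last first.
    by apply: monodromy_unique; exists l; split; rewrite /l ?m0 ?m1.
  by split; [exact: proj_within|rewrite /= /l m0|rewrite /= /l m1 orbit_proj_act].
- have [l [ll l0 l1]] := monodromyP la; have [k [kk k0 k1]] := monodromyP lb.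
  split=> [ab|[H [Hc Hab Hp]]].
    exists (fun z => proj (m (l z.1) (k z.1) z.2)); split.
    + apply: proj_within; apply: within_m.
      * apply/within_continuousP => -[t s] [/= It Is] r r0.
        have [d d0 hd] := (within_continuousP _ _).1 ll.1 t It r r0.
        by exists d => // -[t' s'] [/= It' _] [/= tt' _]; exact: hd.
      * apply/within_continuousP => -[t s] [/= It Is] r r0.
        have [d d0 hd] := (within_continuousP _ _).1 kk.1 t It r r0.
        by exists d => // -[t' s'] [/= It' _] [/= tt' _]; exact: hd.
      * by apply: continuous_subspaceT => z; exact: cvg_snd.
    + by move=> t It /=; rewrite m0 m1 ll.2 ?kk.2.
    + move=> s Is /=; rewrite l0 k0 l1 k1 ab !mxx; split=> //.
      exact: orbit_proj_act.
  have [|l' [l'l l'0 l'1]] := homotopy_lift Hc (l := l).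
    by split=> [|t It]; [exact: ll.1|rewrite ll.2 // (Hab t It).1].
  apply/esym/monodromy_unique; exists l'; split.
  + by split=> [|t It]; [exact: l'l.1|rewrite l'l.2 //= (Hab t It).2].
  + by rewrite l'0 // => s Is; rewrite (Hp s Is).1 (Hp 0 I0).1.
  + by rewrite l'1 // => s Is; rewrite (Hp s Is).2 (Hp 0 I0).2.
- have [l [ll l0 l1]] := monodromyP la; have [k [kk k0 k1]] := monodromyP lb.
  apply: monodromy_unique.
  set g := monodromy a in l1 *; set h := monodromy b in k1 *.
  exists (loop_concat l (fun t => act g (k t))); split.
  + split=> [|t It]; last first.
      rewrite /loop_concat; move: It; rewrite /I /= in_itv /= => /andP[t0 t1].
      by case: (leP t 2^-1) => ht; rewrite ?orbit_proj_act ?ll.2 ?kk.2 // /I /= in_itv /=;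
        apply/andP; split; lra.
    apply/within_continuousP => t It r r0.
    have r2 : 0 < r / 2 by lra.
    have /andP[t0 t1] : 0 <= t <= 1 by move: It; rewrite /I /= in_itv.
    have half t' : 0 <= t' <= 2^-1 -> exists2 d, 0 < d & forall s, 0 <= s <= 2^-1 ->
        `|t' - s| < d -> mdist (l (2 * t')) (l (2 * s)) < r / 2.
      move=> ht'; have Iu : I (2 * t') by rewrite /I /= in_itv /=; lra.
      have [d d0 hd] := (within_continuousP _ _).1 ll.1 _ Iu _ r2.
      exists (d / 2) => [|s hs ts]; first by lra.
      apply: hd; first by rewrite /I /= in_itv /=; lra.
      by rewrite /ball /= -mulrBr normrM ger0_norm //; lra.
    have half' t' : 2^-1 <= t' <= 1 -> exists2 d, 0 < d & forall s, 2^-1 <= s <= 1 ->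
        `|t' - s| < d -> mdist (act g (k (2 * t' - 1))) (act g (k (2 * s - 1))) < r / 2.
      move=> ht'; have Iu : I (2 * t' - 1) by rewrite /I /= in_itv /=; lra.
      have [d d0 hd] := (within_continuousP _ _).1 kk.1 _ Iu _ r2.
      exists (d / 2) => [|s hs ts]; first by lra.
      rewrite fa_isom; apply: hd; first by rewrite /I /= in_itv /=; lra.
      rewrite /ball /=; have -> : 2 * t' - 1 - (2 * s - 1) = 2 * (t' - s) by ring.
      by rewrite normrM ger0_norm //; lra.
    have mid : l (2 * 2^-1) = act g (k (2 * 2^-1 - 1)).
      by rewrite divff ?pnatr_eq0 // subrr l1 k0.
    rewrite /loop_concat.
    have [lt|gt|eq] := ltgtP t 2^-1.
    * have [d d0 hd] := half t ltac:(lra).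
      exists (Num.min d (2^-1 - t)); first by rewrite lt_min d0; lra.
      move=> s; rewrite /I /= in_itv /= => /andP[s0 s1].
      rewrite /ball /= lt_min => /andP[h1]; rewrite ltr_norml => /andP[h2 h3].
      have hs : s <= 2^-1 by lra.
      by rewrite hs; apply: lt_trans (hd s _ h1) _; lra.
    * have [d d0 hd] := half' t ltac:(lra).
      exists (Num.min d (t - 2^-1)); first by rewrite lt_min d0; lra.
      move=> s; rewrite /I /= in_itv /= => /andP[s0 s1].
      rewrite /ball /= lt_min => /andP[h1]; rewrite ltr_norml => /andP[h2 h3].
      have hs : 2^-1 < s by lra.
      by rewrite leNgt hs /=; apply: lt_trans (hd s _ h1) _; lra.
    * have [d d0 hd] := half t ltac:(lra); have [d' d'0 hd'] := half' t ltac:(lra).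
      exists (Num.min d d'); first by rewrite lt_min d0.
      move=> s; rewrite /I /= in_itv /= => /andP[s0 s1].
      rewrite /ball /= lt_min => /andP[h1 h2].
      case: (leP s 2^-1) => hs; first by apply: lt_trans (hd s _ h1) _; lra.
      by rewrite {1}eq mid -eq; apply: lt_trans (hd' s _ h2) _; lra.
  + by rewrite /loop_concat mulr0 ifT ?l0 // invr_ge0.
  + rewrite /loop_concat ifF; last by apply/negbTE; rewrite -ltNge; lra.
    have -> : (2 * 1 - 1 = 1 :> R) by ring.
    by rewrite k1 fa_actM.
Qed.

End FundamentalGroup.
End Lifting.

(** * The hyperbolic plane *)

Section Arcosh.
Variable R : realType.
Implicit Types t r a b : R.

Definition earcosh t : R := t + Num.sqrt (t ^+ 2 - 1).

Lemma earcosh_sq t : 1 <= t -> Num.sqrt (t ^+ 2 - 1) ^+ 2 = t ^+ 2 - 1.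
Proof. by move=> t1; rewrite sqr_sqrtr //; nra. Qed.

Lemma earcosh_ge1 t : 1 <= t -> 1 <= earcosh t.
Proof. by move=> t1; have := sqrtr_ge0 (t ^+ 2 - 1); rewrite /earcosh; lra. Qed.

Lemma earcosh_mono a b : 1 <= a -> a <= b -> earcosh a <= earcosh b.
Proof. by move=> a1 ab; rewrite lerD // ler_wsqrtr //; nra. Qed.

(** With [a = cosh x] and [b = cosh y] this reads [exp (x + y) = exp x * exp y]: the argument on the
    left is [cosh (x + y)]. *)
Lemma earcoshM a b : 1 <= a -> 1 <= b ->
  earcosh (a * b + Num.sqrt (a ^+ 2 - 1) * Num.sqrt (b ^+ 2 - 1)) =
  earcosh a * earcosh b.
Proof.
move=> a1 b1; have := earcosh_sq a1; have := earcosh_sq b1.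
have := sqrtr_ge0 (a ^+ 2 - 1); have := sqrtr_ge0 (b ^+ 2 - 1).
rewrite /earcosh; set p := Num.sqrt (a ^+ 2 - 1); set q := Num.sqrt (b ^+ 2 - 1).
move=> q0 p0 hq hp.
have -> : (a * b + p * q) ^+ 2 - 1 = (a * q + b * p) ^+ 2.
  have -> : (a * q + b * p) ^+ 2 =
      (a * b + p * q) ^+ 2 - (a ^+ 2 - p ^+ 2) * (b ^+ 2 - q ^+ 2) by ring.
  by rewrite hp hq; ring.
rewrite sqrtr_sqr ger0_norm; first by ring.
by nra.
Qed.

Lemma arcoshE t : arcosh t = ln (earcosh t). Proof. by []. Qed.

Lemma arcosh1 : arcosh (1 : R) = 0.
Proof. by rewrite arcoshE /earcosh expr1n subrr sqrtr0 addr0 ln1. Qed.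

Lemma arcosh_le a b : 1 <= a -> a <= b -> arcosh a <= arcosh b.
Proof.
move=> a1 ab; rewrite !arcoshE ler_ln ?posrE.
- exact: earcosh_mono.
- by apply: lt_le_trans (earcosh_ge1 a1); exact: ltr01.
- by apply: lt_le_trans (earcosh_ge1 (le_trans a1 ab)); exact: ltr01.
Qed.

Lemma arcosh_gt0 t : 1 < t -> 0 < arcosh t.
Proof.
move=> t1; rewrite arcoshE ln_gt0 // /earcosh.
by have := sqrtr_ge0 (t ^+ 2 - 1); lra.
Qed.

Lemma arcosh_lt_near1 r : 0 < r -> exists2 k, 1 < k &
  forall t, 1 <= t -> t < k -> arcosh t < r.
Proof.
move=> r0; set e := expR r.
have e1 : 1 < e by rewrite /e expR_gt1.
have e0 : 0 < e by lra.
have ei : 0 < e^-1 by rewrite invr_gt0.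
have ee : e * e^-1 = 1 by rewrite divff // gt_eqF.
(* The threshold is [cosh r]. *)
exists ((e + e^-1) / 2) => [|t t1 tk]; first by nra.
rewrite arcoshE -[r]expRK ltr_ln ?posrE ?expR_gt0 //; last first.
  by apply: lt_le_trans (earcosh_ge1 t1); exact: ltr01.
rewrite /earcosh -/e.
have := earcosh_sq t1; have := sqrtr_ge0 (t ^+ 2 - 1).
set s := Num.sqrt _ => s0 hs.
have ei1 : e^-1 < 1 by nra.
have sk : s < (e - e^-1) / 2.
  rewrite ltNge; apply/negP => ks.
  have : ((e - e^-1) / 2) ^+ 2 <= s ^+ 2 by nra.
  have : t ^+ 2 < ((e + e^-1) / 2) ^+ 2 by nra.
  have : ((e + e^-1) / 2) ^+ 2 = ((e - e^-1) / 2) ^+ 2 + e * e^-1 by field; rewrite gt_eqF.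
  by rewrite ee hs; lra.
lra.
Qed.

End Arcosh.

Section HyperbolicPlane.
Variable R : realType.

Definition hplane := {z : R * R | 0 < z.2}.
HB.instance Definition _ := Choice.on hplane.
Implicit Types z : hplane.

Definition hx z : R := (val z).1.
Definition hy z : R := (val z).2.

Lemma hy_gt0 z : 0 < hy z. Proof. exact: (valP z). Qed.

Lemma hplane_eq z z' : hx z = hx z' -> hy z = hy z' -> z = z'.
Proof.
move=> ex ey; apply: val_inj; rewrite [LHS]surjective_pairing [RHS]surjective_pairing.
by congr pair.
Qed.

Definition mkh (x y : R) : hplane := insubd (exist _ (0, 1) ltr01 : hplane) (x, y).

Lemma hx_mk x y : 0 < y -> hx (mkh x y) = x.
Proof. by move=> y0; rewrite /hx /mkh insubdK. Qed.

Lemma hy_mk x y : 0 < y -> hy (mkh x y) = y.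
Proof. by move=> y0; rewrite /hy /mkh insubdK. Qed.

(* Null coordinates on the hyperboloid ww - us = -1, u > 0. *)
Definition hu z : R := (hy z)^-1.
Definition hs z : R := (hx z ^+ 2 + hy z ^+ 2) / hy z.
Definition hw z : R := hx z / hy z.

Lemma hu_gt0 z : 0 < hu z. Proof. by rewrite invr_gt0 hy_gt0. Qed.

Lemma hquad z : hu z * hs z = 1 + hw z ^+ 2.
Proof. by have := hy_gt0 z; rewrite /hu /hs /hw => y0; field; rewrite gt_eqF. Qed.

Lemma hs_gt0 z : 0 < hs z.
Proof. by have := hquad z; have := hu_gt0 z; nra. Qed.

Definition hcosh z z' : R :=
  1 + ((hx z - hx z') ^+ 2 + (hy z - hy z') ^+ 2) / (2 * hy z * hy z').

(** The right-hand side is minus the Lorentz product of the two points of the hyperboloid. *)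
Lemma hcoshE z z' :
  hcosh z z' = (hu z * hs z' + hs z * hu z') / 2 - hw z * hw z'.
Proof.
have := hy_gt0 z; have := hy_gt0 z'; rewrite /hcosh /hu /hs /hw => y0 y'0.
by field; rewrite !gt_eqF.
Qed.

Lemma hcosh_ge1 z z' : 1 <= hcosh z z'.
Proof.
rewrite /hcosh lerDl; have := hy_gt0 z; have := hy_gt0 z' => y0 y'0.
apply: divr_ge0; first by rewrite addr_ge0 ?sqr_ge0.
by rewrite !mulr_ge0 // ltW.
Qed.

Definition hdist z z' : R := hyp_dist (val z) (val z').

Lemma hdistE z z' : hdist z z' = arcosh (hcosh z z'). Proof. by []. Qed.

Lemma hcosh_sym z z' : hcosh z z' = hcosh z' z.
Proof. by rewrite !hcoshE; ring. Qed.

(** The determinant inequality behind [hdist_triangle]: the difference of the two sides is the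
    square of half the determinant of the null coordinates of the three points. *)
Lemma hcosh_gram z1 z2 z3 :
  (hcosh z1 z3 - hcosh z1 z2 * hcosh z2 z3) ^+ 2 <=
  (hcosh z1 z2 ^+ 2 - 1) * (hcosh z2 z3 ^+ 2 - 1).
Proof.
rewrite -subr_ge0.
pose d := (hu z1 * (hs z2 * hw z3 - hs z3 * hw z2)
  - hs z1 * (hu z2 * hw z3 - hu z3 * hw z2)
  + hw z1 * (hu z2 * hs z3 - hu z3 * hs z2)) / 2.
suff -> : (hcosh z1 z2 ^+ 2 - 1) * (hcosh z2 z3 ^+ 2 - 1) -
   (hcosh z1 z3 - hcosh z1 z2 * hcosh z2 z3) ^+ 2 = d ^+ 2 by exact: sqr_ge0.
rewrite /d /hcosh /hu /hs /hw.
have := hy_gt0 z1; have := hy_gt0 z2; have := hy_gt0 z3 => y3 y2 y1.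
by field; rewrite !gt_eqF.
Qed.

Lemma hdist_triangle z2 z1 z3 : hdist z1 z3 <= hdist z1 z2 + hdist z2 z3.
Proof.
have a1 := hcosh_ge1 z1 z2; have b1 := hcosh_ge1 z2 z3.
have ea := earcosh_ge1 a1; have eb := earcosh_ge1 b1.
rewrite !hdistE !(arcoshE (hcosh _ _)) -lnM ?posrE; [|lra|lra].
rewrite -earcoshM // -arcoshE; apply: arcosh_le; first exact: hcosh_ge1.
rewrite -lerBlDl -sqrtrM; last by nra.
apply: le_trans (ler_norm _) _; rewrite -sqrtr_sqr ler_wsqrtr //.
exact: hcosh_gram.
Qed.

Lemma hcosh_eq1 z z' : hcosh z z' = 1 -> z = z'.
Proof.
have := hy_gt0 z; have := hy_gt0 z' => y0 y'0.
rewrite /hcosh => /eqP; rewrite -subr_eq0 addrAC subrr add0r mulf_eq0 invr_eq0.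
rewrite [X in _ || X]gt_eqF ?orbF; last by nra.
rewrite paddr_eq0 ?sqr_ge0 // !sqrf_eq0 !subr_eq0 => /andP[/eqP ex /eqP ey].
exact: hplane_eq.
Qed.

Fact hdistxx z : hdist z z = 0.
Proof. by rewrite hdistE /hcosh !subrr expr0n addr0 mul0r addr0 arcosh1. Qed.

Fact hdist_eq0 z z' : hdist z z' = 0 -> z = z'.
Proof.
move=> h; apply: hcosh_eq1; apply/eqP; rewrite eq_le hcosh_ge1 andbT leNgt.
by apply/negP => /arcosh_gt0; rewrite -hdistE h ltxx.
Qed.

Fact hdist_sym z z' : hdist z z' = hdist z' z.
Proof. by rewrite !hdistE hcosh_sym. Qed.

HB.instance Definition _ := isMetric.Build R hplane
  hdistxx hdist_eq0 hdist_sym hdist_triangle.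

Lemma mdist_hplane z z' : mdist z z' = hdist z z'. Proof. by []. Qed.

Lemma hcosh_lt_dist k : 1 < k -> exists2 r : R, 0 < r &
  forall z z', mdist z z' < r -> hcosh z z' < k.
Proof.
move=> k1; exists (arcosh k); first exact: arcosh_gt0.
move=> z z'; rewrite mdist_hplane hdistE => lt; rewrite ltNge; apply/negP => ge.
by have := arcosh_le (ltW k1) ge; rewrite leNgt lt.
Qed.

Lemma cvg_hplane (T : Type) (F : set_system T) (FF : Filter F) (f : T -> hplane) z :
  hx (f t) @[t --> F] --> hx z -> hy (f t) @[t --> F] --> hy z ->
  f t @[t --> F] --> z.
Proof.
move=> cx cy B; rewrite -nbhs_ballE => -[r /= r0 rB].
have [k k1 hk] := arcosh_lt_near1 r0.
have yz := hy_gt0 z.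
have c : hcosh z (f t) @[t --> F] --> hcosh z z.
  rewrite /hcosh !expr2; under eq_fun do rewrite !expr2.
  apply: cvgD; first exact: cvg_cst.
  apply: cvgM.
    by apply: cvgD; apply: cvgM; apply: cvgB => //; exact: cvg_cst.
  apply: cvgV; first by rewrite gt_eqF //; nra.
  by apply: cvgM => //; exact: cvg_cst.
have zz : hcosh z z < k by rewrite /hcosh !subrr expr0n addr0 mul0r addr0.
have : \forall t \near F, hcosh z (f t) < k by exact: (cvgr_lt _ c).
apply: filterS => t ht; apply: rB; rewrite ballEmdist /= mdist_hplane hdistE.
by apply: hk => //; exact: hcosh_ge1.
Qed.

Lemma hplane_coord_close z e : 0 < e -> exists2 r : R, 0 < r & forall z', mdist z z' < r ->
  `|hx z - hx z'| < e /\ `|hy z - hy z'| < e.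
Proof.
move=> e0; have y0 := hy_gt0 z.
(* The first bound keeps [hy z'] below [3 * hy z]; the squared Euclidean distance is then at most
   [d * (6 * hy z ^+ 2)], which the second bound controls by [e ^+ 2]. *)
pose d := Num.min 2^-1 (e ^+ 2 / (6 * hy z ^+ 2)).
have y2 : 0 < 6 * hy z ^+ 2 by nra.
have d0 : 0 < d by rewrite lt_min invr_gt0 ltr0n /=; apply: divr_gt0 => //; nra.
have d1 : d <= 2^-1 by rewrite ge_min lexx.
have d2 : d * (6 * hy z ^+ 2) <= e ^+ 2.
  by rewrite -ler_pdivlMr // ge_min lexx orbT.
have [r r0 hr] := @hcosh_lt_dist (1 + d) ltac:(lra).
exists r => // z' /hr; rewrite /hcosh ltrD2l.
have y'0 := hy_gt0 z'; rewrite ltr_pdivrMr; last by nra.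
move: (hx z - hx z') => a; move: (hy z) (hy z') y0 y'0 y2 d2 => y y' y0 y'0 y2 d2 lt.
have y'3 : y' < 3 * y.
  rewrite ltNge; apply/negP => ge.
  have : d * (2 * y * y') <= y * y' by nra.
  have := sqr_ge0 a; nra.
have lt' : a ^+ 2 + (y - y') ^+ 2 < e ^+ 2.
  apply: lt_le_trans lt _; apply: le_trans d2.
  by apply: ler_wpM2l; [exact: ltW|nra].
have sq c : c ^+ 2 < e ^+ 2 -> `|c| < e.
  by rewrite -[c ^+ 2]real_normK ?num_real // ltr_sqr ?nnegrE // ltW.
by split; apply: sq; have := sqr_ge0 a; have := sqr_ge0 (y - y'); lra.
Qed.

Lemma hx_continuous : continuous hx.
Proof.
move=> z B; rewrite -nbhs_ballE => -[e /= e0 eB].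
have [r r0 hr] := hplane_coord_close z e0.
rewrite -nbhs_ballE; exists r => // z'; rewrite ballEmdist /= => /hr[h1 h2].
exact: eB.
Qed.

Lemma hy_continuous : continuous hy.
Proof.
move=> z B; rewrite -nbhs_ballE => -[e /= e0 eB].
have [r r0 hr] := hplane_coord_close z e0.
rewrite -nbhs_ballE; exists r => // z'; rewrite ballEmdist /= => /hr[h1 h2].
exact: eB.
Qed.

(** Affine in the abscissa and in the logarithm of the height, so the height stays positive. It need
    not be a geodesic, only continuous in all arguments and constant when the ends agree. *)
Definition hpath z z' t : hplane :=
  mkh ((1 - t) * hx z + t * hx z') (expR ((1 - t) * ln (hy z) + t * ln (hy z'))).

Lemma hpath0 z z' : hpath z z' 0 = z.
Proof.
by apply: hplane_eq; rewrite ?hx_mk ?hy_mk ?expR_gt0 // subr0 !mul1r !mul0r addr0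
  ?lnK ?posrE ?hy_gt0.
Qed.

Lemma hpath1 z z' : hpath z z' 1 = z'.
Proof.
by apply: hplane_eq; rewrite ?hx_mk ?hy_mk ?expR_gt0 // subrr !mul1r !mul0r add0r
  ?lnK ?posrE ?hy_gt0.
Qed.

Lemma hpathxx z t : hpath z z t = z.
Proof.
by apply: hplane_eq; rewrite ?hx_mk ?hy_mk ?expR_gt0 // -mulrDl subrK mul1r
  ?lnK ?posrE ?hy_gt0.
Qed.

Lemma hpath_continuous : continuous (fun z : hplane * hplane * R => hpath z.1.1 z.1.2 z.2).
Proof.
move=> [[z z'] t]; have y0 := hy_gt0 z; have y'0 := hy_gt0 z'.
have c1 : q.1.1 @[q --> (z, z', t)] --> z by apply: cvg_comp cvg_fst _; exact: cvg_fst.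
have c2 : q.1.2 @[q --> (z, z', t)] --> z' by apply: cvg_comp cvg_fst _; exact: cvg_snd.
have c3 : q.2 @[q --> (z, z', t)] --> t by exact: cvg_snd.
have ct : (1 - q.2) @[q --> (z, z', t)] --> 1 - t.
  by apply: cvgB => //; exact: cvg_cst.
apply: cvg_hplane => /=.
  rewrite hx_mk ?expR_gt0 //; under eq_fun do rewrite hx_mk ?expR_gt0 //.
  by apply: cvgD; apply: cvgM => //; [apply: cvg_comp c1 _|apply: cvg_comp c2 _];
    exact: hx_continuous.
rewrite hy_mk ?expR_gt0 //; under eq_fun do rewrite hy_mk ?expR_gt0 //.
apply: continuous_cvg; first exact: continuous_expR.
apply: cvgD; apply: cvgM => //.
  apply: continuous_cvg; first exact: continuous_ln.
  by apply: cvg_comp c1 _; exact: hy_continuous.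
apply: continuous_cvg; first exact: continuous_ln.
by apply: cvg_comp c2 _; exact: hy_continuous.
Qed.

Lemma hplane_connected : connected [set: hplane].
Proof.
pose o := mkh 0 1; pose I : set R := [set` `[0, 1]].
have -> : [set: hplane] = \bigcup_(z in [set: hplane]) (hpath o z @` I).
  apply/seteqP; split=> // z _; exists z => //; exists 1; last exact: hpath1.
  by rewrite /I /= in_itv /= ler01 lexx.
apply: bigcup_connected.
  exists o => z _; exists 0; last exact: hpath0.
  by rewrite /I /= in_itv /= ler01 lexx.
move=> z _; apply: connected_continuous_connected; first exact: segment_connected.
apply: continuous_subspaceT => t.
have h : ((o, z), t') @[t' --> t] --> ((o, z), t).
  exact: (cvg_pair (cvg_cst (o, z)) (@cvg_id _ (nbhs t))).
exact: (cvg_comp _ _ h (@hpath_continuous (o, z, t))).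
Qed.

Lemma hbox_compact (M c : R) : 0 < c ->
  compact ((fun z : R * R => mkh z.1 z.2) @` ([set` `[- M, M]] `*` [set` `[c, M]])).
Proof.
move=> c0; apply: continuous_compact; last first.
  by apply: compact_setX; exact: segment_compact.
apply/subspace_continuousP => -[x y] [/= _]; rewrite in_itv /= => /andP[cy _].
have y0 : 0 < y by lra.
have near_pos : \forall z \near within ([set` `[- M, M]] `*` [set` `[c, M]]) (nbhs (x, y)),
    0 < z.2.
  apply: filterS (withinT _ _) => -[x' y'] [_] /=; rewrite in_itv /= => /andP[cy' _].
  by apply: lt_le_trans cy'.
apply: cvg_hplane.
  rewrite hx_mk //; apply: (cvg_trans (G := z.1 @[z --> within _ (nbhs (x, y))])).
    by apply: near_eq_cvg; apply: filterS near_pos => z z0; rewrite hx_mk.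
  by apply: cvg_within_filter; exact: cvg_fst.
rewrite hy_mk //; apply: (cvg_trans (G := z.2 @[z --> within _ (nbhs (x, y))])).
  by apply: near_eq_cvg; apply: filterS near_pos => z z0; rewrite hy_mk.
by apply: cvg_within_filter; exact: cvg_snd.
Qed.

End HyperbolicPlane.

(** * Reflections in walls *)

Local Close Scope quotient_scope.

Section Reflections.
Variable R : realType.
Implicit Types z : hplane R.

Lemma hplane_eq_uw z z' : hu z = hu z' -> hw z = hw z' -> z = z'.
Proof.
rewrite /hu /hw => /invr_inj ey; rewrite ey => ew; apply: hplane_eq => //.
have y0 := hy_gt0 z'.
by rewrite -[LHS](divfK (x := hy z')) ?gt_eqF // ew divfK // gt_eqF.
Qed.

(** Null coordinates of a vector of Minkowski space. When [wform e e = 1] the vector is the unit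
    normal of the geodesic [hform z e = 0], and [hform z e] is the hyperbolic sine of the signed
    distance from [z] to it. *)
Record wall := Wall { wu : R; ws : R; ww : R }.
Implicit Types e f : wall.

Definition wform e f : R := ww e * ww f - (wu e * ws f + ws e * wu f) / 2.
Definition hform z e : R := hw z * ww e - (hu z * ws e + hs z * wu e) / 2.

(** The Lorentz reflection [z - 2 * hform z e * e], carried back to the half-plane by [y = 1 / u]
    and [x = w / u]. *)
Definition hrefl e z : hplane R :=
  let u := hu z - 2 * hform z e * wu e in
  mkh ((hw z - 2 * hform z e * ww e) / u) u^-1.

Section OneReflection.
Variable e : wall.
Hypothesis e1 : wform e e = 1.

Let refl_quad z :
  (hu z - 2 * hform z e * wu e) * (hs z - 2 * hform z e * ws e) =
  1 + (hw z - 2 * hform z e * ww e) ^+ 2.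
Proof.
have hq := hquad z; set h := hform z e.
have -> : (hu z - 2 * h * wu e) * (hs z - 2 * h * ws e) =
  hu z * hs z + 4 * h * (hform z e - hw z * ww e) + 4 * h ^+ 2 * (ww e ^+ 2 - wform e e).
  by rewrite /hform /wform; field.
by rewrite hq e1 -/h; ring.
Qed.

(** The image must stay on the sheet [u > 0]. Minus its Lorentz product with [z] is
    [1 + 2 * hform z e ^+ 2], which is positive, whereas for points on opposite sheets that number
    is negative. *)
Let refl_u_gt0 z : 0 < hu z - 2 * hform z e * wu e.
Proof.
have := refl_quad z; have hq := hquad z; have u0 := hu_gt0 z; have s0 := hs_gt0 z.
have : (hu z * (hs z - 2 * hform z e * ws e) + hs z * (hu z - 2 * hform z e * wu e)) / 2
    - hw z * (hw z - 2 * hform z e * ww e) = 1 + 2 * hform z e ^+ 2.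
  have -> : (hu z * (hs z - 2 * hform z e * ws e) +
      hs z * (hu z - 2 * hform z e * wu e)) / 2
      - hw z * (hw z - 2 * hform z e * ww e) =
      hu z * hs z - hw z ^+ 2 + 2 * hform z e * hform z e.
    by rewrite {4}/hform; field.
  by rewrite hq; ring.
move: hq u0 s0; move: (hu z) (hs z) (hw z) (hform z e) => u s w h hq u0 s0.
move: (u - _) (s - _) (w - _) => u' s' w' hB hq'.
rewrite ltNge; apply/negP => u'0.
have u'n : u' < 0 by rewrite lt_neqAle u'0 andbT; apply/eqP => u'E; move: hq';
  rewrite u'E mul0r; have := sqr_ge0 w'; lra.
have s'n : s' < 0.
  by rewrite -(nmulr_rgt0 s' u'n) hq'; have := sqr_ge0 w'; lra.
have a0 : u * s' < 0 by rewrite pmulr_rlt0.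
have b0 : s * u' < 0 by rewrite pmulr_rlt0.
have lt : w * w' < (u * s' + s * u') / 2 by have := sqr_ge0 h; lra.
have ab : (u * s') * (s * u') = (1 + w ^+ 2) * (1 + w' ^+ 2) by rewrite -hq -hq'; ring.
have sq : ((u * s' + s * u') / 2) ^+ 2 < (w * w') ^+ 2.
  rewrite -[ltLHS]sqrrN -[ltRHS]sqrrN ltr_sqr ?nnegrE; lra.
have : ((u * s' + s * u') / 2) ^+ 2 =
    (u * s') * (s * u') + ((u * s' - s * u') / 2) ^+ 2 by field.
rewrite ab => sq2; have := sqr_ge0 ((u * s' - s * u') / 2).
have := sqr_ge0 w; have := sqr_ge0 w'; rewrite exprMn in sq; lra.
Qed.

Lemma hu_refl z : hu (hrefl e z) = hu z - 2 * hform z e * wu e.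
Proof. by rewrite {1}/hu hy_mk ?invrK // invr_gt0. Qed.

Lemma hw_refl z : hw (hrefl e z) = hw z - 2 * hform z e * ww e.
Proof.
by rewrite {1}/hw hx_mk ?hy_mk ?invr_gt0 // invrK divfK // gt_eqF.
Qed.

Lemma hs_refl z : hs (hrefl e z) = hs z - 2 * hform z e * ws e.
Proof.
have := hquad (hrefl e z); rewrite hu_refl hw_refl -refl_quad.
by apply: mulfI; rewrite gt_eqF.
Qed.

Lemma hform_refl z f : hform (hrefl e z) f = hform z f - 2 * hform z e * wform e f.
Proof. by rewrite {1}/hform hu_refl hw_refl hs_refl {4}/hform /wform; field. Qed.

Lemma hform_refl_id z : hform (hrefl e z) e = - hform z e.
Proof. by rewrite hform_refl e1; ring. Qed.

Lemma hreflK z : hrefl e (hrefl e z) = z.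
Proof.
by apply: hplane_eq_uw; rewrite ?hu_refl ?hw_refl hform_refl_id ?hu_refl ?hw_refl; ring.
Qed.

Lemma hrefl_fix z : hform z e = 0 -> hrefl e z = z.
Proof.
by move=> h0; apply: hplane_eq_uw; rewrite ?hu_refl ?hw_refl h0; ring.
Qed.

Lemma hcosh_refl z z' : hcosh (hrefl e z) (hrefl e z') = hcosh z z'.
Proof.
rewrite !hcoshE !hu_refl !hs_refl !hw_refl.
have hE z1 : hform z1 e = hw z1 * ww e - (hu z1 * ws e + hs z1 * wu e) / 2 by [].
have := hE z; have := hE z'; move: (hform z e) (hform z' e) => h h' e2 e3.
transitivity ((hu z * hs z' + hs z * hu z') / 2 - hw z * hw z'
  + 2 * h' * (hw z * ww e - (hu z * ws e + hs z * wu e) / 2)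
  + 2 * h * (hw z' * ww e - (hu z' * ws e + hs z' * wu e) / 2)
  - 4 * h * h' * wform e e).
  by rewrite /wform; field.
by rewrite e1 -e2 -e3; ring.
Qed.

Lemma mdist_refl z z' : mdist (hrefl e z) (hrefl e z') = mdist z z'.
Proof. by rewrite !mdist_hplane !hdistE hcosh_refl. Qed.

End OneReflection.

Lemma hrefl_commute e f z : wform e e = 1 -> wform f f = 1 -> wform e f = 0 ->
  hrefl e (hrefl f z) = hrefl f (hrefl e z).
Proof.
move=> e1 f1 ef; have fe : wform f e = 0 by rewrite -ef /wform; field.
by apply: hplane_eq_uw; rewrite ?hu_refl ?hw_refl // !hform_refl // ef fe
  ?hu_refl ?hw_refl //; ring.
Qed.

(* The Gram determinant of z, e, f is minus a square. *)
Lemma hform_gram_walls z e f : wform e e = 1 -> wform f f = 1 ->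
  wform e f ^+ 2 - 1 <=
  hform z e ^+ 2 + hform z f ^+ 2 - 2 * wform e f * hform z e * hform z f.
Proof.
move=> e1 f1; rewrite -subr_ge0; have hq := hquad z.
pose d := (hu z * (ws e * ww f - ws f * ww e) - hs z * (wu e * ww f - wu f * ww e)
  + hw z * (wu e * ws f - wu f * ws e)) / 2.
pose nz := hw z ^+ 2 - hu z * hs z.
suff -> : hform z e ^+ 2 + hform z f ^+ 2 - 2 * wform e f * hform z e * hform z f -
   (wform e f ^+ 2 - 1) = d ^+ 2 by exact: sqr_ge0.
have nz1 : nz = - 1 by rewrite /nz hq; ring.
transitivity (wform f f * hform z e ^+ 2 + wform e e * hform z f ^+ 2
  - 2 * wform e f * hform z e * hform z f + nz * (wform e f ^+ 2 - wform e e * wform f f)).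
  by rewrite e1 f1 nz1; ring.
by rewrite /nz /d /hform /wform; field.
Qed.

Lemma hform_gram_points z z' e : wform e e = 1 ->
  hform z e ^+ 2 + hform z' e ^+ 2 - 2 * hcosh z z' * hform z e * hform z' e <=
  hcosh z z' ^+ 2 - 1.
Proof.
move=> e1; rewrite -subr_ge0; have hq := hquad z; have hq' := hquad z'.
pose d := (hu z * (hs z' * ww e - ws e * hw z') - hs z * (hu z' * ww e - wu e * hw z')
  + hw z * (hu z' * ws e - wu e * hs z')) / 2.
pose nz := hw z ^+ 2 - hu z * hs z; pose nz' := hw z' ^+ 2 - hu z' * hs z'.
suff -> : hcosh z z' ^+ 2 - 1 -
  (hform z e ^+ 2 + hform z' e ^+ 2 - 2 * hcosh z z' * hform z e * hform z' e) =
  d ^+ 2 by exact: sqr_ge0.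
have nz1 : nz = - 1 by rewrite /nz hq; ring.
have nz'1 : nz' = - 1 by rewrite /nz' hq'; ring.
transitivity (wform e e * hcosh z z' ^+ 2 - nz * nz' * wform e e
  + (nz' * hform z e ^+ 2 + nz * hform z' e ^+ 2)
  + 2 * hcosh z z' * hform z e * hform z' e).
  by rewrite e1 nz1 nz'1; ring.
by rewrite /nz /nz' /d hcoshE /hform /wform; field.
Qed.

(** To pass from one side of the wall to a value above [d] on the other, a point must move by a
    distance whose hyperbolic sine exceeds [d], and the bound on [hcosh] excludes this. *)
Lemma hform_lipschitz z z' e d : wform e e = 1 -> 0 < d ->
  hcosh z z' ^+ 2 <= 1 + d ^+ 2 -> hform z e <= 0 -> hform z' e <= d.
Proof.
move=> e1 d0 hd p0; have [q0|q0] := leP (hform z' e) 0; first by lra.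
have := hform_gram_points z z' e1; have := hcosh_ge1 z z'.
move: hd p0 q0; move: (hcosh z z') (hform z e) (hform z' e) => B p q hd p0 q0 B1 hG.
have pq : 0 <= - (2 * B * p * q).
  by rewrite -mulNr; apply: mulr_ge0; [rewrite -mulrN; apply: mulr_ge0; lra|lra].
rewrite -ler_sqr ?nnegrE; [|lra|lra].
by have := sqr_ge0 p; lra.
Qed.

(** The sum [e + f] has norm [2 + 2 * wform e f <= 0] and points to the future, and [z] is timelike
    on the future sheet; the product of two such vectors is negative. *)
Lemma hform_opposite z e f : wform e e = 1 -> wform f f = 1 -> wform e f <= - 1 ->
  0 < wu e + ws e -> 0 < wu f + ws f -> hform z e + hform z f < 0.
Proof.
move=> e1 f1 ef e0 f0.
pose ku := wu e + wu f; pose ks := ws e + ws f; pose kw := ww e + ww f.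
have kk : kw ^+ 2 - ku * ks <= 0.
  have -> : kw ^+ 2 - ku * ks = wform e e + wform f f + 2 * wform e f.
    by rewrite /kw /ku /ks /wform; field.
  by rewrite e1 f1; lra.
have k0 : 0 < ku + ks by rewrite /ku /ks; lra.
have -> : hform z e + hform z f = hw z * kw - (hu z * ks + hs z * ku) / 2.
  by rewrite /hform /kw /ku /ks; field.
have := hquad z; have := hu_gt0 z; have := hs_gt0 z.
move: (hu z) (hs z) (hw z) kk k0 => u s w; move: ku ks kw => ku ks kw kk k0 s0 u0 hq.
have kw2 := sqr_ge0 kw.
have ku0 : 0 <= ku by rewrite leNgt; apply/negP => n; nra.
have ks0 : 0 <= ks by rewrite leNgt; apply/negP => n; nra.
have a0 : 0 <= u * ks by rewrite mulr_ge0 // ltW.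
have b0 : 0 <= s * ku by rewrite mulr_ge0 // ltW.
have ab : (u * ks) * (s * ku) = (1 + w ^+ 2) * (ku * ks) by rewrite -hq; ring.
have ab' : (1 + w ^+ 2) * kw ^+ 2 <= (u * ks) * (s * ku).
  by rewrite ab; apply: ler_wpM2l; [have := sqr_ge0 w; lra|lra].
have abpos : 0 < u * ks + s * ku.
  have [kup|ku0'] := ltP 0 ku; first by have := mulr_gt0 s0 kup; lra.
  have ksp : 0 < ks by lra.
  by have := mulr_gt0 u0 ksp; lra.
rewrite subr_lt0 ltNge; apply/negP => le.
have sq : ((u * ks + s * ku) / 2) ^+ 2 <= (w * kw) ^+ 2.
  by rewrite ler_sqr ?nnegrE //; lra.
have sq2 : ((u * ks + s * ku) / 2) ^+ 2 =
    (u * ks) * (s * ku) + ((u * ks - s * ku) / 2) ^+ 2 by field.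
have sq3 := sqr_ge0 ((u * ks - s * ku) / 2).
have kw0 : kw ^+ 2 = 0 by rewrite exprMn in sq; lra.
by move/eqP: kw0; rewrite sqrf_eq0 => /eqP kw0; rewrite kw0 mulr0 in le; lra.
Qed.

(** The half-planes beyond the two walls are disjoint, and [- wform e f] is the hyperbolic cosine of
    the distance between the walls, whose hyperbolic sine is thus at least [m]. *)
Lemma hform_opposite_gap z e f m : wform e e = 1 -> wform f f = 1 ->
  0 <= m -> wform e f <= - 1 -> 1 + m ^+ 2 <= wform e f ^+ 2 ->
  0 < wu e + ws e -> 0 < wu f + ws f -> 0 <= hform z e -> hform z f <= - m.
Proof.
move=> e1 f1 m0 ef efm e0 f0 p0.
have := hform_opposite z e1 f1 ef e0 f0; have := hform_gram_walls z e1 f1.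
move: ef efm p0; move: (wform e f) (hform z e) (hform z f) => g p q ef efm p0 hG pq.
rewrite -[leLHS]opprK lerN2 -ler_sqr ?nnegrE //; last by lra.
have h1 : 0 <= p * (- q - p) by apply: mulr_ge0; lra.
have h2 : 0 <= (- 1 - g) * (p * - q) by apply: mulr_ge0; [lra|apply: mulr_ge0; lra].
have h3 := sqr_ge0 p; have : (- q) ^+ 2 = q ^+ 2 by rewrite sqrrN.
nra.
Qed.

End Reflections.

(** * Graph products and their actions *)

Local Close Scope ring_scope.
Local Open Scope group_scope.

Section GraphProductTheory.
Variables (V : choiceType) (E : rel V) (G : V -> groupType).
Local Notation GP := (graph_product E G).

Definition gp_in (v : V) (g : G v) : GP := quotient_proj _ (fp_in g).

Definition gp_word (s : seq (letter G)) : GP := quotient_proj _ (fp_class s).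

Lemma gp_word_cat s t : gp_word (s ++ t) = gp_word s * gp_word t.
Proof. by rewrite [RHS]quotient_mulE -[fp_class s * _]/(fp_prod _ _) fp_prodE. Qed.

Lemma gp_wordP x : exists s, x = gp_word s.
Proof.
elim/quotient_proj_ind: x => x; elim/fp_class_ind: x => s.
by exists s.
Qed.

Lemma gp_inM v : {morph @gp_in v : g h / g * h}.
Proof.
move=> g h; rewrite [RHS]quotient_mulE; congr quotient_proj.
rewrite -[fp_in g * _]/(fp_prod _ _) fp_prodE; apply/esym/fp_classP => /=.
exact: (fp_mul [::] [::]).
Qed.

Lemma gp_in1 v : gp_in (1 : G v) = 1.
Proof. by apply: (mulgI (gp_in (1 : G v))); rewrite -gp_inM !mulg1. Qed.

Lemma gp_inV v : {morph @gp_in v : g / g^-1}.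
Proof.
by move=> g; apply: (mulgI (gp_in g)); rewrite -gp_inM !mulgV gp_in1.
Qed.

Lemma gp_in_commute u v (g : G u) (h : G v) : E u v ->
  gp_in g * gp_in h = gp_in h * gp_in g.
Proof.
move=> uv; rewrite [LHS]quotient_mulE [RHS]quotient_mulE.
apply/esym/quotient_projP => N nN; apply.
exists u, v, g, h; split => //.
by rewrite commgEl conjgE invgM !mulgA.
Qed.

Lemma gp_ind (P : GP -> Prop) :
  P 1 -> (forall x v (g : G v), P x -> P (x * gp_in g)) -> forall x, P x.
Proof.
move=> P1 PM x; have [s ->] := gp_wordP x; elim/last_ind: s => [|s [v g] IH].
  exact: P1.
by rewrite -cats1 gp_word_cat; apply: PM.
Qed.

Section Action.
Variables (Z : Type) (a : forall v, Z -> G v -> Z).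
Hypothesis a1 : forall v z, a z (1 : G v) = z.
Hypothesis aM : forall v z (g h : G v), a z (g * h) = a (a z g) h.
Hypothesis aC : forall u v z (g : G u) (h : G v), E u v ->
  a (a z g) h = a (a z h) g.

Definition word_act z (s : seq (letter G)) : Z :=
  foldl (fun z l => a z (tagged l)) z s.

Lemma word_act_cat z s t : word_act z (s ++ t) = word_act (word_act z s) t.
Proof. exact: foldl_cat. Qed.

Lemma word_act_fp_eq s t : fp_eq s t -> forall z, word_act z s = word_act z t.
Proof.
elim=> {s t} [s|s t _ IH|s t w _ IH1 _ IH2|s t v|s t v g h] z //.
- by rewrite IH1 IH2.
- by rewrite !word_act_cat /= a1.
- by rewrite !word_act_cat /= aM.
Qed.

Definition gp_act (z : Z) (x : GP) : Z := word_act z (repr (repr x)).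

Let fp_act z (x : free_product G) := word_act z (repr x).

Let fp_actE z s : fp_act z (fp_class s) = word_act z s.
Proof. by apply: word_act_fp_eq; exact: fp_reprP. Qed.

Let fp_actM z x y : fp_act z (x * y) = fp_act (fp_act z x) y.
Proof.
elim/fp_class_ind: x => s; elim/fp_class_ind: y => t.
by rewrite -[_ * _]/(fp_prod _ _) fp_prodE !fp_actE word_act_cat.
Qed.

Let fp_act1 z : fp_act z 1 = z. Proof. exact: fp_actE. Qed.

(** [gp_act] reads a chosen word of [x]. Any other word gives the same result, because the elements
    of the free product that act trivially form a normal subgroup containing the edge
    commutators. *)
Lemma gp_act_word z s : gp_act z (gp_word s) = word_act z s.
Proof.
have kerN : normal_subgroup [set x | forall z, fp_act z x = z].
  split; first split=> //=.
  - by move=> x y hx hy w; rewrite fp_actM hx.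
  - by move=> x hx w; rewrite -{1}[w]hx -fp_actM mulgV.
  - move=> x y hx w /=; rewrite /conjg !fp_actM hx -fp_actM mulVg.
    exact: fp_act1.
have kerE : edge_commutators (G := G) E `<=` [set x | forall z, fp_act z x = z].
  move=> _ [u [v [g [h [uv ->]]]]] w /=.
  have invE k (l : G k) : (fp_in l)^-1 = fp_in l^-1.
    by rewrite -[LHS]/(fp_inv _) fp_invE.
  rewrite commgEl conjgE !fp_actM !invE !fp_actE /=.
  by rewrite (aC _ g^-1 h^-1 uv) -[a (a _ g^-1) g]aM mulVg a1 -aM mulVg a1.
have := quotient_reprP (normal_closure_normal (edge_commutators (G := G) E)) (fp_class s).
move=> /(_ _ kerN kerE) h; rewrite /gp_act -/(gp_word s) -/(fp_act z _).
rewrite -[in RHS](fp_actE z) -[fp_class s in RHS](mulVKg (repr (gp_word s))).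
by rewrite fp_actM h.
Qed.

Lemma gp_act1 z : gp_act z 1 = z.
Proof. exact: (gp_act_word z [::]). Qed.

Lemma gp_actM z x y : gp_act z (x * y) = gp_act (gp_act z x) y.
Proof.
have [s ->] := gp_wordP x; have [t ->] := gp_wordP y.
by rewrite -gp_word_cat !gp_act_word word_act_cat.
Qed.

Lemma gp_act_in z v (g : G v) : gp_act z (gp_in g) = a z g.
Proof. exact: (gp_act_word z [:: mk_letter g]). Qed.

End Action.

Section Hom.
Variables (T : groupType) (f : forall v, G v -> T).
Hypothesis fM : forall v, {morph @f v : g h / g * h}.
Hypothesis fC : forall u v (g : G u) (h : G v), E u v ->
  f g * f h = f h * f g.

Let f1 v : f (1 : G v) = 1.
Proof. by apply: (mulgI (f (1 : G v))); rewrite -fM !mulg1. Qed.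

(** The universal property, as the case of letters acting on [T] by right multiplication. *)
Definition gp_hom (x : GP) : T := gp_act (fun v t (g : G v) => t * f g) 1 x.

Let a1 v t : t * f (1 : G v) = t. Proof. by rewrite f1 mulg1. Qed.
Let aM v t (g h : G v) : t * f (g * h) = t * f g * f h.
Proof. by rewrite fM mulgA. Qed.
Let aC u v t (g : G u) (h : G v) : E u v -> t * f g * f h = t * f h * f g.
Proof. by move=> uv; rewrite -!mulgA fC. Qed.

Lemma gp_hom_in v (g : G v) : gp_hom (gp_in g) = f g.
Proof. by rewrite /gp_hom gp_act_in // mul1g. Qed.

Lemma gp_homM : {morph gp_hom : x y / x * y}.
Proof.
move=> x; elim/gp_ind => [|y v g IH].
  by rewrite mulg1 [gp_hom 1]gp_act1 // mulg1.
have step z g' : gp_hom (z * gp_in (g' : G v)) = gp_hom z * f g'.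
  by rewrite /gp_hom gp_actM // gp_act_in.
by rewrite mulgA !step IH mulgA.
Qed.

End Hom.

End GraphProductTheory.

Section Morphisms.
Variables (A B : groupType) (f : A -> B).
Hypothesis fM : {morph f : x y / x * y}.

Lemma morph_grp1 : f 1 = 1.
Proof. by apply: (mulgI (f 1)); rewrite -fM !mulg1. Qed.

Lemma morph_grpV x : f x^-1 = (f x)^-1.
Proof. by apply: (mulgI (f x)); rewrite -fM !mulgV morph_grp1. Qed.
End Morphisms.

Lemma generates_ind (A : groupType) (S : seq A) (P : A -> Prop) : generates S ->
  P 1 -> (forall x s, P x -> s \in S -> P (x * s) /\ P (x * s^-1)) ->
  forall x, P x.
Proof.
move=> genS P1 PM x.
(* [P] need not define a subgroup, but the elements whose right translations, together with those of
   their inverses, preserve [P] form one. *)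
pose H := [set y | forall x, (P x -> P (x * y)) /\ (P x -> P (x * y^-1))].
have subH : subgroup H.
  split=> [z|y z Hy Hz w|y Hy z].
  - by rewrite invg1 mulg1.
  - split=> Pw; first by rewrite mulgA; apply: (Hz _).1; apply: (Hy _).1.
    by rewrite invgM mulgA; apply: (Hy _).2; apply: (Hz _).2.
  - by rewrite invgK; have [? ?] := Hy z.
have /(_ _ subH) HT := genS.
have : H x by rewrite HT // => s sS w; split=> Pw; have [? ?] := PM w s Pw sS.
by move=> /(_ 1)[/(_ P1)]; rewrite mul1g.
Qed.

Lemma morph_generates (A B : groupType) (f : A -> B) (S : seq A) :
  {morph f : x y / x * y} -> (forall y, exists x, f x = y) ->
  generates S -> generates (map f S).
Proof.
move=> fM fs genS H [H1 HM HV] SH; apply/seteqP; split=> // y _.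
have [x <-] := fs y; move: x; apply: (generates_ind genS) => [|x s IH sS].
  by rewrite (morph_grp1 fM).
have Hs : H (f s) by apply: SH; apply/mapP; exists s.
by rewrite !fM (morph_grpV fM); split; apply: HM => //; exact: HV.
Qed.

Lemma gp_finitely_generated (V : finType) (E : rel V) (G : V -> groupType) :
  (forall v, finitely_generated (G v)) -> finitely_generated (graph_product E G).
Proof.
move=> fg; have [S genS] : exists S : forall v, seq (G v), forall v, generates (S v).
  exists (fun v => sval (cid (fg v))) => v; exact: svalP (cid (fg v)).
exists (flatten [seq [seq gp_in E g | g <- S v] | v <- enum V]).
move=> H [H1 HM HV] SH; apply/seteqP; split=> // x _.
elim/gp_ind: x => [//|x v g Hx]; apply: (HM _ _) => //.
move: g; apply: (generates_ind (genS v)) => [|g s IH sS]; first by rewrite gp_in1.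
have Hs : H (gp_in E s).
  apply: SH; apply/flattenP; exists [seq gp_in E g | g <- S v].
    by apply/mapP; exists v; rewrite // mem_enum.
  by apply/mapP; exists s.
by rewrite !gp_inM gp_inV; split; apply: (HM) => //; exact: HV.
Qed.

(** * Ends of groups *)

Section Cayley.
Variables (A : groupType) (S : seq A).
Implicit Types (K : seq A) (x y z : A).

Lemma cayley_sym : symmetric (cayley S).
Proof. by move=> x y; rewrite /cayley orbC. Qed.

Lemma component_refl K x : x \notin K -> component S K x x.
Proof. by move=> xK; exists [::]; split; rewrite //= xK. Qed.

Lemma component_trans K x y z :
  component S K x y -> component S K y z -> component S K x z.
Proof.
move=> [p [xp <- pK]] [q [yq <- qK]]; exists (p ++ q); split.
- by rewrite cat_path xp.
- by rewrite last_cat.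
- by move: pK qK => /= /andP[-> pK] /andP[_ qK]; rewrite all_cat pK.
Qed.

Lemma component_step K x y :
  cayley S x y -> x \notin K -> y \notin K -> component S K x y.
Proof. by move=> xy xK yK; exists [:: y]; split; rewrite //= ?xy ?xK ?yK. Qed.

Lemma component_notin K x y : component S K x y -> x \notin K /\ y \notin K.
Proof.
move=> [p [_ <- /allP pK]]; split; apply: pK; first exact: mem_head.
exact: mem_last.
Qed.

Lemma component_ind K x (P : A -> Prop) : P x ->
  (forall y z, P y -> cayley S y z -> y \notin K -> z \notin K -> P z) ->
  forall y, component S K x y -> P y.
Proof.
move=> Px PS y [p [xp <- pK]]; elim: p x Px xp pK => [//|z p IH] x Px /=.
move=> /andP[xz zp] /and3P[xK zK pK].
by apply: IH => //=; rewrite ?zK //; apply: PS xz xK zK.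
Qed.

Lemma component_sym K x y : component S K x y -> component S K y x.
Proof.
move=> xy; have [xK yK] := component_notin xy.
elim/component_ind: xy {yK} => [|z w zx zw zK wK]; first exact: component_refl.
by apply: component_trans zx; apply: component_step; rewrite // cayley_sym.
Qed.

Hypothesis genS : generates S.

Lemma cayley_path x y : exists2 p, path (cayley S) x p & last x p = y.
Proof.
rewrite -[y](mulVKg x); move: (x^-1 * y).
apply: (generates_ind genS) => [|{}y s [p xp py] sS].
  by exists [::]; rewrite //= mulg1.
split; [exists (rcons p (x * (y * s)))|exists (rcons p (x * (y * s^-1)))];
  rewrite ?last_rcons // rcons_path xp py /= /cayley.
  by rewrite [x * (y * _)]mulgA mulKg sS.
by rewrite [x * (y * _)]mulgA [(_ * s^-1)^-1]invgM invgK mulgVK sS orbT.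
Qed.

(** By connectedness every component meeting [D] contains a neighbour of [K], unless [K] is empty.
    There are finitely many such neighbours, so if all these components were finite, [D] would be
    finite. *)
Lemma infinite_component K (D : set A) : infinite_set D ->
  (forall x, D x -> x \notin K) -> exists2 x, D x & infinite_set (component S K x).
Proof.
move=> infD DK; apply: contrapT => no.
have fin x : D x -> finite_set (component S K x).
  by move=> Dx; apply: contrapT => inf; apply: no; exists x.
case: K DK no fin => [|k K'] DK no fin.
  have [x Dx] : D !=set0 by apply: infinite_setN0.
  apply: infD; apply: sub_finite_set (fin x Dx) => y _.
  by have [p xp py] := cayley_path x y; exists p; split=> //; apply/allP.
set K := k :: K' in DK no fin.
pose N := [set y | exists x, [/\ D x, component S K x y &
                    exists2 z, z \in K & cayley S z y]].
have finN : finite_set N.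
  apply: (@sub_finite_set _ _ [set` [seq z * s | z <- K, s <- S ++ [seq s^-1 | s <- S]]]).
    move=> y [x [_ _ [z zK /orP[|] zy]]]; apply/allpairsP.
      by exists (z, z^-1 * y); split; rewrite //= ?mulVKg // mem_cat zy.
    exists (z, z^-1 * y); split; rewrite //= ?mulVKg // mem_cat; apply/orP; right.
    by apply/mapP; exists (y^-1 * z); rewrite // invgM invgK.
  exact: finite_seq.
apply: infD; apply: (@sub_finite_set _ _ (\bigcup_(y in N) component S K y)).
  move=> x Dx; suff [y xy [z zK zy]] : exists2 y, component S K x y &
      exists2 z, z \in K & cayley S z y.
    by exists y; [exists x; split=> //; exists z|exact: component_sym].
  have [p] := cayley_path x k; move: (DK x Dx) => {Dx}.
  elim: p x => [|y p IH] x /= xK.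
    by move=> _ xk; move: xK; rewrite xk mem_head.
  move=> /andP[xy yp] pk; have [yK|yK] := boolP (y \in K).
    by exists x; [exact: component_refl|exists y; rewrite // cayley_sym].
  have [w yw hw] := IH y yK yp pk; exists w => //.
  by apply: component_trans yw; apply: component_step.
apply: bigcup_finite => // y [x [Dx xy _]]; apply: sub_finite_set (fin x Dx).
by move=> z; exact: component_trans.
Qed.

(** Take for [K] the finitely many vertices at which some generator changes membership in [Q]. A
    component off [K] lies within [Q] or within its complement, and each of the two contains an
    infinite one. *)
Lemma almost_invariant_ends (Q : set A) :
  infinite_set Q -> infinite_set (~` Q) ->
  (forall s, finite_set [set g | ~ (Q g <-> Q (g * s))]) -> ends_ge S 2.
Proof.
move=> infQ infCQ fin.
have /finite_seqP[K KE] :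
    finite_set (\bigcup_(s in [set` S]) [set g | ~ (Q g <-> Q (g * s))]).
  by apply: bigcup_finite => //; exact: finite_seq.
have inv x y : component S K x y -> (Q x <-> Q y).
  elim/component_ind => // {}y z xy yz yK zK; rewrite {}xy.
  have step g s : g \notin K -> s \in S -> (Q g <-> Q (g * s)).
    move=> gK sS; apply: contrapT => ne; move/negP: gK; apply.
    by have : [set` K] g by rewrite -KE; exists s.
  move: yz => /orP[|] yz; first by rewrite (step _ _ yK yz) mulVKg.
  by apply: iff_sym; rewrite (step _ _ zK yz) mulVKg.
have infD D : infinite_set D -> exists2 x, D x & infinite_set (component S K x).
  move=> iD; have [||x [Dx _] ix] := @infinite_component K (D `\` [set` K]).
  - by apply: infinite_setD => //; exact: finite_seq.
  - by move=> x [_ xK]; apply/negP.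
  - by exists x.
have [x Qx ix] := infD _ infQ; have [y Qy iy] := infD _ infCQ.
exists K, (fun i : 'I_2 => if i == 0 :> nat then x else y); split.
  by move=> [[|[|//]] i] /=.
move=> [[|[|//]] i] [[|[|//]] j] //= _ /inv h; apply: Qy; apply/h; exact: Qx.
Qed.

End Cayley.

Lemma finite_not_one_ended (A : groupType) :
  finite_set [set: A] -> ~ one_ended A.
Proof.
move=> fin [S [_ [K [f [inf _]]] _]]; apply: (inf ord0).
exact: sub_finite_set fin.
Qed.

(** * Ends and quotients by finite kernels *)

Section FiniteKernel.
Variables (A B : groupType) (f : A -> B).
Hypothesis fM : {morph f : x y / x * y}.
Hypothesis f_surj : forall y, exists x, f x = y.
Hypothesis fin_ker : finite_set [set x | f x = 1].

Lemma finite_fibre y : finite_set [set x | f x = y].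
Proof.
have [z <-] := f_surj y.
apply: sub_finite_set (finite_image (fun x => z * x) fin_ker) => x /= fx.
exists (z^-1 * x); last by rewrite mulVKg.
by rewrite /= fM (morph_grpV fM) fx mulVg.
Qed.

Lemma finite_fibres (D : set B) : finite_set D -> finite_set (f @^-1` D).
Proof.
move=> finD; apply: (@sub_finite_set _ _ (\bigcup_(y in D) [set x | f x = y])).
  by move=> x Dx; exists (f x).
by apply: bigcup_finite => // y _; exact: finite_fibre.
Qed.

Lemma infinite_fibres (D : set B) : infinite_set D -> infinite_set (f @^-1` D).
Proof.
move=> infD fin; apply: infD; apply: sub_finite_set (finite_image f fin) => y Dy.
by have [x fx] := f_surj y; exists x; rewrite //= fx.
Qed.

Lemma cayley_map S x y : cayley S x y -> cayley (map f S) (f x) (f y).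
Proof.
by rewrite /cayley -!(morph_grpV fM) -!fM => /orP[|] /(map_f f) ->; rewrite ?orbT.
Qed.

(** Removing [K] from [B] corresponds to removing its finite preimage from [A]. An infinite
    component in [B] has an infinite preimage, which meets an infinite component in [A], and
    components map into components. *)
Lemma finite_kernel_one_ended : one_ended A -> one_ended B.
Proof.
move=> [S [genS ends1 ends2]]; exists (map f S).
have genfS := morph_generates fM f_surj genS.
split=> //.
  exists [::], (fun=> 1); split; last by move=> i j; rewrite !ord1.
  move=> _; have infB : infinite_set [set: B].
    move=> /finite_fibres; case: ends1 => K [g [inf _]] finA.
    by apply: (inf ord0); apply: sub_finite_set finA.
  have [//|x _ infx] := @infinite_component _ _ genfS [::] _ infB.
  move=> fin; apply: infx; apply: sub_finite_set fin => y _.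
  by have [p xp py] := cayley_path genfS 1 y; exists p; split=> //; apply/allP.
move=> [K [g [inf dis]]]; apply: ends2.
have /finite_seqP[K' K'E] : finite_set (f @^-1` [set` K]).
  by apply: finite_fibres; exact: finite_seq.
have memK' x : (x \in K') = (f x \in K).
  have e : (f x \in K : Prop) = (x \in K') := congr1 (fun D : set A => D x) K'E.
  by apply/idP/idP => h; [rewrite e|rewrite -e].
have comp x y : component S K' x y -> component (map f S) K (f x) (f y).
  move=> xy; have [xK _] := component_notin xy.
  elim/component_ind: xy => [|{}y z xy yz yK zK].
    by apply: component_refl; rewrite -memK'.
  apply: component_trans xy _; apply: component_step; rewrite -?memK' //.
  exact: cayley_map.
have lift i : exists2 x, component (map f S) K (g i) (f x) &
    infinite_set (component S K' x).
  apply: (@infinite_component _ _ genS K' (f @^-1` (component (map f S) K (g i)))).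
    exact: infinite_fibres (inf i).
  by move=> x /= /component_notin[_]; rewrite memK'.
exists K', (fun i => s2val (cid2 (lift i))); split.
  by move=> i; case: (cid2 (lift i)).
move=> i j ij; case: (cid2 (lift i)) => x ix _ /=; case: (cid2 (lift j)) => y jy _ /=.
move=> /comp xy; apply: (dis i j ij); apply: component_trans ix _.
by apply: component_trans xy _; exact: component_sym.
Qed.

End FiniteKernel.

(** * Retractions, clique subgroups and flip actions *)

Section Subproducts.
Variables (V : choiceType) (E : rel V) (G : V -> groupType).
Hypothesis symE : symmetric E.
Hypothesis irrE : irreflexive E.
Local Notation GP := (graph_product E G).

Section Retraction.
Variable D : pred V.

Let f v (g : G v) : GP := if D v then gp_in E g else 1.

Let fM v : {morph @f v : g h / g * h}.
Proof. by move=> g h; rewrite /f; case: ifP; rewrite ?mulg1 // gp_inM. Qed.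

Let fC u v (g : G u) (h : G v) : E u v -> f g * f h = f h * f g.
Proof.
by rewrite /f; case: ifP; case: ifP => *; rewrite ?mulg1 ?mul1g // gp_in_commute.
Qed.

Definition gp_retract : GP -> GP := gp_hom f.

Lemma gp_retractM : {morph gp_retract : x y / x * y}.
Proof. exact: gp_homM fM fC. Qed.

Lemma gp_retract_in v (g : G v) :
  gp_retract (gp_in E g) = if D v then gp_in E g else 1.
Proof. exact: gp_hom_in fM fC _ _. Qed.

Lemma gp_retract1 : gp_retract 1 = 1.
Proof. exact: morph_grp1 gp_retractM. Qed.
End Retraction.

Lemma gp_retractI D D' x :
  gp_retract D (gp_retract D' x) = gp_retract [predI D & D'] x.
Proof.
elim/gp_ind: x => [|x v g IH]; first by rewrite !gp_retract1.
rewrite !gp_retractM IH !gp_retract_in /=; congr (_ * _).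
rewrite -!topredE /=; case: (D' v); rewrite ?andbF ?andbT; first exact: gp_retract_in.
exact: gp_retract1.
Qed.

Lemma gp_retract_pred0 (D : pred V) x : (forall v, D v = false) -> gp_retract D x = 1.
Proof.
move=> D0; elim/gp_ind: x => [|x v g IH]; first exact: gp_retract1.
by rewrite gp_retractM IH gp_retract_in D0 mulg1.
Qed.

Lemma gp_retract_id D x : gp_retract D (gp_retract D x) = gp_retract D x.
Proof.
rewrite gp_retractI; congr gp_retract.
by apply/funext => v /=; rewrite andbb.
Qed.

Lemma gp_retract_commute (D D' : pred V) x y : (forall u v, D u -> D' v -> E u v) ->
  gp_retract D x * gp_retract D' y = gp_retract D' y * gp_retract D x.
Proof.
move=> DD'; elim/gp_ind: x => [|x u g IH]; first by rewrite gp_retract1 mulg1 mul1g.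
rewrite gp_retractM -mulgA gp_retract_in; case: ifP => Du; last by rewrite mul1g mulg1.
suff -> : gp_in E g * gp_retract D' y = gp_retract D' y * gp_in E g.
  by rewrite !mulgA IH.
elim/gp_ind: y {IH} => [|y v h IH]; first by rewrite gp_retract1 mulg1 mul1g.
rewrite gp_retractM mulgA IH -!mulgA gp_retract_in; congr (_ * _).
by case: ifP => D'v; rewrite ?mulg1 ?mul1g // gp_in_commute // DD'.
Qed.

(** Products with one factor per entry, in the order of [L]. When [L] is a clique,
    [clique_subgroupM] shows that they are stable under multiplication by its letters. *)
Fixpoint clique_subgroup (L : seq V) : set GP :=
  if L is v :: L' then
    [set x | exists (g : G v) y, clique_subgroup L' y /\ x = gp_in E g * y]
  else [set 1].

Lemma clique_subgroup1 L : clique_subgroup L 1.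
Proof. by elim: L => //= v L IH; exists 1, 1; rewrite gp_in1 mulg1. Qed.

Lemma clique_subgroup_finite L :
  (forall v, v \in L -> finite_set [set: G v]) -> finite_set (clique_subgroup L).
Proof.
elim: L => [_|v L IH fin] /=; first exact: finite_set1.
have finv : finite_set [set: G v] by apply: fin; exact: mem_head.
have finL : finite_set (clique_subgroup L).
  by apply: IH => w wL; apply: fin; rewrite inE wL orbT.
apply: sub_finite_set (finite_image2 (fun g y => gp_in E g * y) finv finL).
by move=> _ [g [y [Ly ->]]]; exists g => //; exists y.
Qed.

Lemma clique_subgroupM L v x (g : G v) :
  {in L &, forall u w, u != w -> E u w} -> v \in L ->
  clique_subgroup L x -> clique_subgroup L (x * gp_in E g).
Proof.
elim: L x => [//|u L IH] x cl vL [h [y [Ly ->]]].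
have clL : {in L &, forall u w, u != w -> E u w}.
  by move=> w w' wL wL'; apply: cl; rewrite inE ?wL ?wL' orbT.
rewrite -mulgA; have [vL'|vL'] := boolP (v \in L).
  by exists h, (y * gp_in E g); split=> //; apply: IH.
move: vL; rewrite inE (negbTE vL') orbF => /eqP vu; subst u.
suff -> : y * gp_in E g = gp_in E g * y.
  by exists (h * g), y; split=> //; rewrite gp_inM mulgA.
have : {in L, forall w, E v w}.
  move=> w wL; apply: cl; rewrite ?mem_head // ?inE ?wL ?orbT //.
  by apply: contraNneq vL' => ->.
elim: {IH cl clL vL'} L y Ly => [|w L IH] y /=.
  by move=> -> _; rewrite mulg1 mul1g.
move=> [k [z [Lz ->]]] vL; rewrite -mulgA IH //; last first.
  by move=> w' w'L; apply: vL; rewrite inE w'L orbT.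
by rewrite !mulgA gp_in_commute // symE vL ?mem_head.
Qed.

Section Flip.
Variables (Z : Type) (tau : V -> Z -> Z).
Hypothesis tauK : forall v, involutive (tau v).
Hypothesis tauC : forall u v z, E u v -> tau u (tau v z) = tau v (tau u z).

(** The state holds the image in the product of all vertex groups and a point of [Z]. The involution
    of [v] is applied when the coordinate at [v] passes between trivial and nontrivial, so that an
    arbitrary group [G v] can drive reflections. *)
Definition flip v (sz : (forall v, G v) * Z) (g : G v) : (forall v, G v) * Z :=
  (dfwith sz.1 (sz.1 v * g),
   if (sz.1 v == 1) != (sz.1 v * g == 1) then tau v sz.2 else sz.2).

Lemma flip1 v sz : flip sz (1 : G v) = sz.
Proof.
case: sz => s z; rewrite /flip /= mulg1 eqxx /=; congr pair.
by apply/functional_extensionality_dep => w; case: dfwithP.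
Qed.

Lemma flipM v sz (g h : G v) : flip sz (g * h) = flip (flip sz g) h.
Proof.
case: sz => s z; rewrite /flip /= !dfwith_in mulgA; congr pair.
  apply/functional_extensionality_dep => w; case: (eqVneq v w) => [vw|vw].
    by case: w / vw; rewrite !dfwith_in.
  by rewrite !dfwith_out.
by case: (s v == 1); case: (_ == 1); case: (_ == 1); rewrite /= ?tauK.
Qed.

Lemma flipC u v sz (g : G u) (h : G v) : E u v ->
  flip (flip sz g) h = flip (flip sz h) g.
Proof.
move=> uv; case: sz => s z.
have neq : u != v by apply/eqP => e; rewrite e irrE in uv.
have neq' : v != u by rewrite eq_sym.
rewrite /flip /= !(dfwith_out _ _ neq) !(dfwith_out _ _ neq'); congr pair.
  apply/functional_extensionality_dep => w; case: (eqVneq v w) => [vw|vw].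
    by case: w / vw; rewrite dfwith_in (dfwith_out _ _ neq) dfwith_in.
  rewrite (dfwith_out _ _ vw); case: (eqVneq u w) => [uw|uw].
    by case: w / uw vw => _; rewrite !dfwith_in.
  by rewrite !(dfwith_out _ _ uw) (dfwith_out _ _ vw).
by case: ifP; case: ifP => // _ _; rewrite tauC // symE.
Qed.

Definition gp_flip (z : Z) (x : GP) := gp_act flip (fun=> 1, z) x.

End Flip.

End Subproducts.

Section Dihedral.
Variables (V : choiceType) (E : rel V) (G : V -> groupType).
Hypothesis symE : symmetric E.
Hypothesis irrE : irreflexive E.
Local Notation GP := (graph_product E G).
Variables (u w : V) (a : G u) (b : G w).
Hypothesis uw : u != w.
Hypothesis Euw : ~~ E u w.
Hypothesis a1 : a != 1.
Hypothesis b1 : b != 1.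

(* The letters over u and w reflect int in 0 and in 2, and generate an infinite
   dihedral group. *)
Definition dihedral_tau (v : V) (n : int) : int :=
  if v == u then (- n)%R else if v == w then (4 - n)%R else n.
Local Notation tau := dihedral_tau.

Let tauK v : involutive (tau v).
Proof. by move=> n; rewrite /tau; case: (v == u); [|case: (v == w)]; lia. Qed.

Let tauC v v' n : E v v' -> tau v (tau v' n) = tau v' (tau v n).
Proof.
rewrite /tau => vv'; case: (eqVneq v u) => vu; case: (eqVneq v' u) => v'u //.
- case: (eqVneq v' w) => v'w //; by rewrite vu v'w (negbTE Euw) in vv'.
- by case: (eqVneq v w) => vw //; rewrite vw v'u symE (negbTE Euw) in vv'.
- by case: (eqVneq v w) => vw; case: (eqVneq v' w).
Qed.

Definition dihedral_act (n : int) (x : GP) : int := (gp_flip tau n x).2.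

Let st (x : G u) (y : G w) : forall v, G v :=
  dfwith (dfwith (fun=> 1 : G _) x) y.

Let st11 : st 1 1 = fun=> 1.
Proof.
apply/functional_extensionality_dep => v; rewrite /st.
case: (eqVneq w v) => [wv|wv]; first by case: v / wv; rewrite dfwith_in.
rewrite dfwith_out //; case: (eqVneq u v) => [uv|uv].
  by case: v / uv {wv}; rewrite dfwith_in.
by rewrite dfwith_out.
Qed.

Let st_u x y n (g : G u) :
  flip tau (st x y, n) g = (st (x * g) y, if (x == 1) != (x * g == 1) then (- n)%R else n).
Proof.
have wu : w != u by rewrite eq_sym.
rewrite /flip /= /st !(dfwith_out _ _ wu) !dfwith_in /tau eqxx; congr pair.
apply/functional_extensionality_dep => v.
case: (eqVneq u v) => [uv|uv].
  by case: v / uv; rewrite dfwith_in (dfwith_out _ _ wu) dfwith_in.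
rewrite (dfwith_out _ _ uv); case: (eqVneq w v) => [wv|wv].
  by case: v / wv uv => _; rewrite !dfwith_in.
by rewrite !(dfwith_out _ _ wv) !(dfwith_out _ _ uv).
Qed.

Let st_w x y n (g : G w) :
  flip tau (st x y, n) g = (st x (y * g), if (y == 1) != (y * g == 1) then (4 - n)%R else n).
Proof.
rewrite /flip /= /st !dfwith_in /tau eqxx [w == u]eq_sym (negbTE uw); congr pair.
apply/functional_extensionality_dep => v; case: (eqVneq w v) => [wv|wv].
  by case: v / wv; rewrite !dfwith_in.
by rewrite !(dfwith_out _ _ wv).
Qed.

Let act_in sz v (g : G v) (x : GP) :
  gp_act (flip tau) sz (x * gp_in E g) = flip tau (gp_act (flip tau) sz x) g.
Proof.
by rewrite gp_actM ?gp_act_in //;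
   [exact: flip1|exact: flipM|exact: flipC|exact: flip1|exact: flipM|exact: flipC].
Qed.

Let act1 sz : gp_act (flip tau) sz (1 : GP) = sz.
Proof. by apply: gp_act1; [exact: flip1|exact: flipM|exact: flipC]. Qed.

(** Powers of the commutator of [a] and [b]: whatever the orders of [a] and [b], each of its four
    letters flips once, so a commutator brings the coordinates back to 1 and moves the integer by
    8. *)
Fixpoint dihedral_word (k : nat) : GP :=
  if k is k'.+1 then
    dihedral_word k' * gp_in E a * gp_in E b * gp_in E a^-1 * gp_in E b^-1
  else 1.

Fixpoint dihedral_word' (k : nat) : GP :=
  if k is k'.+1 then
    dihedral_word' k' * gp_in E b * gp_in E a * gp_in E b^-1 * gp_in E a^-1
  else 1.

Let st_a y n : flip tau (st 1 y, n) a = (st a y, (- n)%R).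
Proof. by rewrite st_u mul1g eqxx; case: (@eqP _ a) => // e; case/eqP: a1. Qed.

Let st_aV y n : flip tau (st a y, n) a^-1 = (st 1 y, (- n)%R).
Proof. by rewrite st_u mulgV eqxx; case: (@eqP _ a) => // e; case/eqP: a1. Qed.

Let st_b x n : flip tau (st x 1, n) b = (st x b, (4 - n)%R).
Proof. by rewrite st_w mul1g eqxx; case: (@eqP _ b) => // e; case/eqP: b1. Qed.

Let st_bV x n : flip tau (st x b, n) b^-1 = (st x 1, (4 - n)%R).
Proof. by rewrite st_w mulgV eqxx; case: (@eqP _ b) => // e; case/eqP: b1. Qed.

Let wordE k n : gp_act (flip tau) (fun=> 1, n) (dihedral_word k) =
  (fun=> 1, (n + 8 * k%:Z)%R).
Proof.
rewrite -st11; elim: k => [|k IH] /=; first by rewrite act1 mulr0 addr0.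
rewrite !act_in IH st_a st_b st_aV st_bV.
by congr pair; lia.
Qed.

Let word'E k n : gp_act (flip tau) (fun=> 1, n) (dihedral_word' k) =
  (fun=> 1, (n - 8 * k%:Z)%R).
Proof.
rewrite -st11; elim: k => [|k IH] /=; first by rewrite act1 mulr0 subr0.
rewrite !act_in IH st_b st_a st_bV st_aV.
by congr pair; lia.
Qed.

Lemma dihedral_word_inj : injective dihedral_word.
Proof.
by move=> k l kl; have := wordE k 0; rewrite kl wordE => -[]; lia.
Qed.

Lemma dihedral_word'_inj : injective dihedral_word'.
Proof.
by move=> k l kl; have := word'E k 0; rewrite kl word'E => -[]; lia.
Qed.

Lemma dihedral_act_word k : dihedral_act 1 (dihedral_word k) = (1 + 8 * k%:Z)%R.
Proof. by rewrite /dihedral_act /gp_flip wordE. Qed.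

Lemma dihedral_act_word_a k :
  dihedral_act 1 (dihedral_word k * gp_in E a) = (- (1 + 8 * k%:Z))%R.
Proof.
by rewrite /dihedral_act /gp_flip act_in wordE -st11 st_a.
Qed.

Lemma dihedral_act_word_ab k :
  dihedral_act 1 (dihedral_word k * gp_in E a * gp_in E b) = (5 + 8 * k%:Z)%R.
Proof.
rewrite /dihedral_act /gp_flip !act_in wordE -st11 st_a st_b /=.
by lia.
Qed.

Lemma dihedral_act_word_aba k :
  dihedral_act 1 (dihedral_word k * gp_in E a * gp_in E b * gp_in E a^-1) =
  (- (5 + 8 * k%:Z))%R.
Proof.
rewrite /dihedral_act /gp_flip !act_in wordE -st11 st_a st_b st_aV /=.
by lia.
Qed.

Lemma dihedral_act_word'_b k :
  dihedral_act 1 (dihedral_word' k * gp_in E b) = (3 + 8 * k%:Z)%R.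
Proof.
rewrite /dihedral_act /gp_flip act_in word'E -st11 st_b /=; lia.
Qed.

Lemma dihedral_act_word'_ba k :
  dihedral_act 1 (dihedral_word' k * gp_in E b * gp_in E a) = (- (3 + 8 * k%:Z))%R.
Proof.
rewrite /dihedral_act /gp_flip !act_in word'E -st11 st_b st_a /=.
by lia.
Qed.

Lemma dihedral_act_word'_bab k :
  dihedral_act 1 (dihedral_word' k * gp_in E b * gp_in E a * gp_in E b^-1) =
  (7 + 8 * k%:Z)%R.
Proof.
rewrite /dihedral_act /gp_flip !act_in word'E -st11 st_b st_a st_bV /=.
by lia.
Qed.

Lemma dihedral_act_word' k : dihedral_act 1 (dihedral_word' k) = (1 - 8 * k%:Z)%R.
Proof. by rewrite /dihedral_act /gp_flip word'E. Qed.

(** The criterion for lying outside the subgroup of a separator: its letters, lying over neither [u]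
    nor [w], leave the integer alone, so an element that moves 1 is outside. *)
Lemma dihedral_act_clique L x : u \notin L -> w \notin L ->
  clique_subgroup L x -> dihedral_act 1 x = 1%R.
Proof.
move=> uL wL Lx; rewrite /dihedral_act /gp_flip.
pose a0 v (n : int) (g : G v) := n.
have h z : (z.2 = 1)%R -> (gp_act (flip tau) z x).2 = 1%R.
  elim: L x uL wL Lx z => [|v L IH] x /=; first by move=> _ _ ->; move=> z; rewrite act1.
  rewrite !inE !negb_or => /andP[uv uL] /andP[wv wL] [g [y [Ly ->]]] z z1.
  rewrite gp_actM; [|exact: flip1|exact: flipM|exact: flipC].
  apply: IH => //; rewrite -[gp_in E g]mul1g act_in act1 /flip /=.
  by rewrite /tau [v == u]eq_sym (negbTE uv) [v == w]eq_sym (negbTE wv) if_same.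
exact: h.
Qed.

Lemma dihedral_retract (D : pred V) k : D u -> D w ->
  gp_retract D (dihedral_word k) = dihedral_word k.
Proof.
move=> Du Dw; elim: k => [|k IH] /=; first exact: gp_retract1.
by rewrite !gp_retractM !gp_retract_in Du Dw IH.
Qed.

End Dihedral.

Lemma infinite_range (T : Type) (f : nat -> T) (D : set T) :
  injective f -> (forall k, D (f k)) -> infinite_set D.
Proof.
move=> finj Df fin; apply: infinite_nat.
apply: sub_finite_set (finite_preimage (f := f) _ fin); first by move=> k _; exact: Df.
by move=> x y _ _; exact: finj.
Qed.

(** * Splittings over finite cliques *)

Section Splitting.
Variables (V : choiceType) (E : rel V) (G : V -> groupType).
Hypothesis symE : symmetric E.
Hypothesis irrE : irreflexive E.
Local Notation GP := (graph_product E G).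
Variables (V1 : pred V) (K : seq V) (u w : V) (a : G u) (b : G w).
Hypothesis V1K : forall v, V1 v -> v \notin K.
Hypothesis V1E : forall v v', V1 v -> E v v' ->
  [\/ V1 v', v' \in K | forall g : G v', g = 1].
Hypothesis KE : {in K &, forall v v', v != v' -> E v v'}.
Hypothesis Kfin : forall v, v \in K -> finite_set [set: G v].
Hypothesis V1u : V1 u.
Hypothesis V1w : ~~ V1 w.
Hypothesis Kw : w \notin K.
Hypothesis a1 : a != 1.
Hypothesis b1 : b != 1.

Let C : set GP := clique_subgroup K.
Let inC (x : GP) : bool := `[< C x >].

Let inCM x v (g : G v) : v \in K -> inC (x * gp_in E g) = inC x.
Proof.
move=> vK; apply/asboolP/asboolP => [Cx|]; last exact: clique_subgroupM.
by rewrite -[x](mulgK (gp_in E g)) -gp_inV; apply: clique_subgroupM.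
Qed.

(* The boolean counts, modulo 2, how often multiplying by the successive
   letters lying over V1 enters or leaves the finite subgroup C. *)
Definition crossing_act v (xq : GP * bool) (g : G v) : GP * bool :=
  (xq.1 * gp_in E g,
   if V1 v then xq.2 (+) (inC xq.1 (+) inC (xq.1 * gp_in E g)) else xq.2).

Let act1 v xq : crossing_act xq (1 : G v) = xq.
Proof.
case: xq => x q; rewrite /crossing_act /= gp_in1 mulg1.
by case: ifP => _ //; case: (inC x); case: q.
Qed.

Let actM v xq (g h : G v) :
  crossing_act xq (g * h) = crossing_act (crossing_act xq g) h.
Proof.
case: xq => x q; rewrite /crossing_act /= gp_inM mulgA; case: ifP => _ //.
by congr pair; case: q; do 3!case: (inC _).
Qed.

(** For two vertices of [V1] the intermediate terms cancel, and both orders count the same ends. An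
    edge leaving [V1] ends at a trivial group or in [K], and right multiplication by letters over
    [K] preserves membership in [C]. *)
Let actC v v' xq (g : G v) (h : G v') : E v v' ->
  crossing_act (crossing_act xq g) h = crossing_act (crossing_act xq h) g.
Proof.
move=> vv'; have gh : gp_in E g * gp_in E h = gp_in E h * gp_in E g.
  exact: gp_in_commute.
case: xq => x q; rewrite /crossing_act /= -!mulgA gh; congr pair.
have [V1v|V1v] := boolP (V1 v); have [V1v'|V1v'] := boolP (V1 v') => //.
- by case: q; do 4!case: (inC _).
- case: (V1E V1v vv') => [|v'K|h1]; first by rewrite (negbTE V1v').
    by rewrite -gh !mulgA !(inCM _ _ v'K).
  by rewrite (h1 h) gp_in1 !mul1g mulg1.
- rewrite symE in vv'; case: (V1E V1v' vv') => [|vK|g1]; first by rewrite (negbTE V1v).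
    by rewrite !mulgA !(inCM _ _ vK).
  by rewrite (g1 g) gp_in1 !mulg1.
Qed.

Let st (x : GP) := gp_act crossing_act (1, false) x.
Let q (x : GP) := (st x).2.

Let st_in x v (g : G v) : st (x * gp_in E g) = crossing_act (st x) g.
Proof. by rewrite /st gp_actM // gp_act_in. Qed.

Let st_fst x : (st x).1 = x.
Proof.
elim/gp_ind: x => [|x v g IH]; first by rewrite /st gp_act1.
by rewrite st_in /= IH.
Qed.

Let q1 : q 1 = false. Proof. by rewrite /q /st gp_act1. Qed.

Let q_in x v (g : G v) : q (x * gp_in E g) =
  if V1 v then q x (+) (inC x (+) inC (x * gp_in E g)) else q x.
Proof. by rewrite /q st_in /= st_fst. Qed.

(** Multiplying on the right by a letter changes [q] only if the element before or after lies in the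
    finite set [C]. *)
Let almost_invariant s : finite_set [set g | ~ (q g <-> q (g * s))].
Proof.
elim/gp_ind: s => [|s v g IH].
  by apply: sub_finite_set (finite_set0 _) => x /=; rewrite mulg1; apply.
have finC : finite_set C by exact: clique_subgroup_finite.
pose f x := x * s^-1; pose f' x := x * (gp_in E g)^-1.
apply: (@sub_finite_set _ _ ([set x | ~ (q x <-> q (x * s))] `|`
    f @` (C `|` f' @` C))); last first.
  by rewrite finite_setU; split=> //; apply: finite_image;
     rewrite finite_setU; split=> //; apply: finite_image.
move=> x /= qx; have [qs|qs] := pselect (q x <-> q (x * s)); last by left.
right; exists (x * s); last by rewrite /f mulgK.
apply: contrapT => nC; apply: qx; rewrite qs mulgA q_in; case: ifP => // _.
have -> : inC (x * s) = false by apply/asboolP => Cx; apply: nC; left.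
have -> : inC (x * s * gp_in E g) = false.
  apply/asboolP => Cx; apply: nC; right; exists (x * s * gp_in E g) => //.
  by rewrite /f' mulgK.
by rewrite !addbF.
Qed.

Let uw : u != w. Proof. by apply: contraNneq V1w => <-. Qed.

Let Euw : ~~ E u w.
Proof.
apply/negP => Euw; case: (V1E V1u Euw) => [|wK|h].
- by rewrite (negbTE V1w).
- by have := Kw; rewrite wK.
- by have := b1; rewrite (h b) eqxx.
Qed.

Let notC x : dihedral_act u w 1 x <> 1%R -> inC x = false.
Proof.
move=> nx; apply/asboolP => /(dihedral_act_clique symE irrE uw Euw a1 b1 (V1K V1u) Kw).
exact: nx.
Qed.

(** The prefixes of the word leave [C] at the letter [a], which is counted, and never return, since
    they move the integer 1. In [q_word'] they leave at [b], which lies outside [V1] and is not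
    counted. *)
Let q_word k : q (dihedral_word E a b k.+1).
Proof.
have h j : q (dihedral_word E a b j * gp_in E a).
  elim: j => [|j IH].
    rewrite q_in V1u q1 [inC 1]asboolT; last exact: clique_subgroup1.
    rewrite notC // (dihedral_act_word_a symE irrE uw Euw a1 b1 0); lia.
  rewrite q_in V1u [dihedral_word _ _ _ _]/= q_in (negbTE V1w) q_in V1u.
  rewrite q_in (negbTE V1w) IH !notC //.
  - by rewrite (dihedral_act_word_a symE irrE uw Euw a1 b1 j.+1); lia.
  - by rewrite (dihedral_act_word symE irrE uw Euw a1 b1 j.+1); lia.
  - by rewrite (dihedral_act_word_aba symE irrE uw Euw a1 b1); lia.
  - by rewrite (dihedral_act_word_ab symE irrE uw Euw a1 b1); lia.
rewrite /= q_in (negbTE V1w) q_in V1u q_in (negbTE V1w) h !notC //.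
- by rewrite (dihedral_act_word_aba symE irrE uw Euw a1 b1); lia.
- by rewrite (dihedral_act_word_ab symE irrE uw Euw a1 b1); lia.
Qed.

Let q_word' k : ~~ q (dihedral_word' E a b k).
Proof.
elim: k => [|k IH]; first by rewrite q1.
rewrite /= q_in V1u q_in (negbTE V1w) q_in V1u q_in (negbTE V1w) (negbTE IH) !notC //.
- by rewrite (dihedral_act_word' symE irrE uw Euw a1 b1 k.+1); lia.
- by rewrite (dihedral_act_word'_bab symE irrE uw Euw a1 b1); lia.
- by rewrite (dihedral_act_word'_ba symE irrE uw Euw a1 b1); lia.
- by rewrite (dihedral_act_word'_b symE irrE uw Euw a1 b1); lia.
Qed.

Lemma clique_splitting_not_one_ended : ~ one_ended GP.
Proof.
move=> [S [genS _]]; apply; apply: (@almost_invariant_ends _ _ genS [set x | q x]).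
- apply: (@infinite_range _ (fun k => dihedral_word E a b k.+1)).
    by move=> k l /(dihedral_word_inj symE irrE uw Euw a1 b1)[].
  exact: q_word.
- apply: (@infinite_range _ (dihedral_word' E a b)).
    by move=> k l /(dihedral_word'_inj symE irrE uw Euw a1 b1).
  by move=> k /=; apply/negP; exact: q_word'.
- exact: almost_invariant.
Qed.

End Splitting.

(** * Hyperbolic groups *)

Section WordMetric.
Variables (A : groupType) (S : seq A).
Hypothesis genS : generates S.
Implicit Types x y z : A.
Local Notation d := (word_dist S).

Lemma word_distP x y :
  (exists2 p, path (cayley S) x p /\ last x p = y & size p = d x y) /\
  forall p, path (cayley S) x p -> last x p = y -> (d x y <= size p)%N.
Proof.
pose P n := `[< exists2 p, path (cayley S) x p /\ last x p = y & size p = n >].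
have exP : exists n, P n.
  have [p xp py] := cayley_path genS x y; exists (size p).
  by apply/asboolP; exists p.
rewrite /word_dist; case: xgetP => [n _ //|no].
case: (ex_minnP exP) => n /asboolP Pn minn; exfalso; apply: (no n); split=> //.
by move=> p xp py; apply: minn; apply/asboolP; exists p.
Qed.

Lemma word_dist_path x p : path (cayley S) x p -> (d x (last x p) <= size p)%N.
Proof. by move=> xp; apply: (word_distP x _).2. Qed.

Lemma word_dist_triangle y x z : (d x z <= d x y + d y z)%N.
Proof.
have [[p [xp py] <-] _] := word_distP x y.
have [[q [yq qz] <-] _] := word_distP y z.
rewrite -size_cat -qz -py -last_cat; apply: word_dist_path.
by rewrite cat_path xp py.
Qed.

Lemma word_dist_sym x y : d x y = d y x.
Proof.
suff le u v : (d u v <= d v u)%N by apply/eqP; rewrite eqn_leq !le.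
have [[p [vp <-] <-] _] := word_distP v u.
have : path (cayley S) (last v p) (rev (belast v p)).
  by rewrite rev_path; apply: sub_path vp => y' z; rewrite cayley_sym.
move=> /word_dist_path; rewrite size_rev size_belast.
by case: p {vp} => //= z p; rewrite rev_cons last_rcons.
Qed.

Lemma word_dist_mul z x y : d (z * x) (z * y) = d x y.
Proof.
suff le u v w : (d (w * u) (w * v) <= d u v)%N.
  by apply/eqP; rewrite eqn_leq le /= -{1}[x](mulKg z) -{1}[y](mulKg z) le.
have [[p [up <-] <-] _] := word_distP u v.
rewrite -(size_map ( *%g w)) -last_map; apply: word_dist_path.
rewrite path_map; apply: sub_path up => a b.
by rewrite /cayley /= !invgM -!mulgA !mulKg.
Qed.

Lemma word_distxx x : d x x = 0%N.
Proof. by apply/eqP; rewrite -leqn0; exact: (@word_dist_path x [::]). Qed.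

Lemma word_dist_step x y : cayley S x y -> (d x y <= 1)%N.
Proof. by move=> xy; apply: (@word_dist_path x [:: y]); rewrite /= xy. Qed.

Lemma word_dist_geodesic x y : exists p : nat -> A,
  [/\ p 0%N = x, (forall j, (d x y <= j)%N -> p j = y),
      (forall j, (d (p j) (p j.+1) <= 1)%N), (forall j, (d x (p j) <= j)%N) &
      (forall j, (j <= d x y)%N -> (d x (p j) + d (p j) y <= d x y)%N)].
Proof.
have [[s [xs sy] sz] _] := word_distP x y.
pose p j := nth y (x :: s) j.
have py j : (d x y <= j)%N -> p j = y.
  rewrite -sz leq_eqVlt => /orP[/eqP <-|js]; last by rewrite /p nth_default.
  by rewrite /p nth_last.
have step j : (d (p j) (p j.+1) <= 1)%N.
  have [jd|jd] := leqP (d x y) j.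
    by rewrite !py ?word_distxx //; apply: leq_trans jd _.
  apply: word_dist_step; move/(pathP y): xs; apply; by rewrite sz.
have le i k : (d (p i) (p (i + k)%N) <= k)%N.
  elim: k => [|k IH]; first by rewrite addn0 word_distxx.
  rewrite addnS; apply: leq_trans (word_dist_triangle (p (i + k)%N) _ _) _.
  by rewrite -[leqRHS]addn1; apply: leq_add.
exists p; split=> // j; first exact: (le 0%N j).
move=> jn; have := le 0%N j; have := le j (d x y - j)%N.
by rewrite subnKC // add0n (py (d x y)) // -[p 0%N]/x; lia.
Qed.

Lemma ball_finite n : finite_set [set x | (d 1 x <= n)%N].
Proof.
elim: n => [|n IH].
  apply: sub_finite_set (finite_set1 1) => x /=; rewrite leqn0 => /eqP x0.
  have [[p [_ px] pz] _] := word_distP 1 x.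
  by move: px; move/eqP: pz; rewrite x0 size_eq0 => /eqP -> /=.
have finS : finite_set [set` 1 :: S ++ [seq s^-1 | s <- S]] by exact: finite_seq.
apply: sub_finite_set (finite_image2 (fun x s => x * s) IH finS) => x /= dx.
have [p [p0 py pstep pd _]] := word_dist_geodesic 1 x.
exists (p (d 1 x).-1) => /=.
  by have := pd (d 1 x).-1; move: dx; lia.
exists ((p (d 1 x).-1)^-1 * x); last by rewrite mulVKg.
have [[q [yq qx] qz] _] := word_distP (p (d 1 x).-1) x.
have : (size q <= 1)%N.
  rewrite qz; case dx0 : (d 1 x) => [|m]; first by rewrite /= py ?dx0 ?word_distxx.
  by rewrite -[X in d _ X](py m.+1) ?dx0 //; exact: pstep.
case: q yq qx {qz} => [|y [|//]] /=; first by move=> _ ->; rewrite mulVg mem_head.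
rewrite andbT => xy yx _; rewrite {}yx in xy; rewrite inE mem_cat.
case/orP: xy => [->|yx]; first by rewrite orbT.
apply/orP; right; apply/orP; right; apply/mapP.
by exists (x^-1 * p (d 1 x).-1); rewrite // invgM invgK.
Qed.

Lemma infinite_word_dist (D : set A) : infinite_set D ->
  forall n, exists2 x, D x & (n <= d 1 x)%N.
Proof.
move=> infD n; apply: contrapT => no; apply: infD.
apply: sub_finite_set (ball_finite n) => x Dx /=; rewrite leqNgt.
by apply/negP => lt; apply: no; exists x => //; exact: ltnW.
Qed.

Lemma morph_lipschitz (f : A -> A) : {morph f : x y / x * y} ->
  exists L, forall x y, (d (f x) (f y) <= L * d x y)%N.
Proof.
move=> fM; exists (\max_(s <- S) d 1 (f s))%N => x y.
set L := (\max_(_ <- _) _)%N.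
have step u v : cayley S u v -> (d (f u) (f v) <= L)%N.
  have h u' v' : u'^-1 * v' \in S -> (d (f u') (f v') <= L)%N.
    move=> uv; have -> : d (f u') (f v') = d 1 (f (u'^-1 * v')).
      by rewrite fM (morph_grpV fM) -(word_dist_mul (f u')^-1) mulVg.
    exact: (@leq_bigmax_seq _ S predT (fun s => d 1 (f s)) _ uv).
  by case/orP => /h //; rewrite word_dist_sym.
have [[p [xp <-] <-] _] := word_distP x y.
elim: p x xp => [|z p IH] x /=; first by rewrite word_distxx.
move=> /andP[xz zp]; apply: leq_trans (word_dist_triangle (f z) _ _) _.
by rewrite mulnS leq_add ?step ?IH.
Qed.

End WordMetric.

Lemma exp2_dominates_linear (a b : nat) : exists k, (a + b * k <= 2 ^ k)%N.
Proof.
pose k := (a + 2 * b).+1; exists (2 * k)%N.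
have h : (k ^ 2 <= (2 ^ k) ^ 2)%N by rewrite leq_sqr ltnW // ltn_expl.
by rewrite [X in (2 ^ X)%N]mulnC expnM; apply: leq_trans _ h; rewrite /k; nia.
Qed.

Section NonHyperbolic.
Variable A : groupType.
Variables (rA rB : A -> A).
Hypothesis rAM : {morph rA : x y / x * y}.
Hypothesis rBM : {morph rB : x y / x * y}.
Hypothesis rAK : forall x, rA (rA x) = rA x.
Hypothesis rBK : forall x, rB (rB x) = rB x.
Hypothesis rAB : forall x, rA (rB x) = 1.
Hypothesis rBA : forall x, rB (rA x) = 1.
Hypothesis rC : forall x y, rA x * rB y = rB y * rA x.
Hypothesis infA : infinite_set (range rA).
Hypothesis infB : infinite_set (range rB).

Section Metric.
Variable S : seq A.
Hypothesis genS : generates S.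
Local Notation d := (word_dist S).

(** Apply [r] to the vertices of a geodesic from 1 to a distant element of its image: the norms
    start at 0 and increase by at most [L] per step, so one of them falls in the window. *)
Let pick (r : A -> A) L : {morph r : x y / x * y} -> (forall x, r (r x) = r x) ->
  (forall x y, (d (r x) (r y) <= L * d x y)%N) -> infinite_set (range r) ->
  forall n, exists2 a, r a = a & (n <= d 1 a <= n + L)%N.
Proof.
move=> rM rK rL infr n.
have [_ [x _ <-] nx] := infinite_word_dist genS infr n.
have [p [p0 py pstep _ _]] := word_dist_geodesic genS 1 (r x).
have ex : exists j, (n <= d 1 (r (p j)))%N.
  by exists (d 1 (r x)); rewrite py // rK.
case: (ex_minnP ex) => -[|j] nj minj.
  exists 1; first exact: morph_grp1 rM.
  by move: nj; rewrite p0 (morph_grp1 rM) word_distxx //; lia.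
exists (r (p j.+1)); rewrite // nj /=.
have lt : (d 1 (r (p j)) < n)%N.
  by rewrite ltnNge; apply/negP => /minj; rewrite ltnn.
have := word_dist_triangle genS (r (p j)) 1 (r (p j.+1)).
have : (d (r (p j)) (r (p j.+1)) <= L)%N.
  apply: leq_trans (rL _ _) _; rewrite -[leqRHS]muln1 leq_mul2l pstep orbT //.
by lia.
Qed.

Local Open Scope ring_scope.

(** Bisecting a chain of [2 ^ k] steps costs one [delta] per halving, so the loss is logarithmic in
    the length. *)
Lemma gromov_product_chain (delta M : rat) (w : A) (x : nat -> A) :
  (forall w x y z, Num.min (gromov_product S w x y) (gromov_product S w y z) - delta
      <= gromov_product S w x z) ->
  (forall j, M <= gromov_product S w (x j) (x j.+1)) ->
  forall k i, M - k%:R * delta <= gromov_product S w (x i) (x (i + 2 ^ k)%N).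
Proof.
move=> hyp hM; elim=> [|k IH] i; first by rewrite mul0r subr0 addn1.
have := hyp w (x i) (x (i + 2 ^ k)%N) (x (i + 2 ^ k.+1)%N).
have h1 := IH i; have := IH (i + 2 ^ k)%N.
rewrite -addnA addnn -mul2n -expnS => h2; apply: le_trans.
rewrite -natr1 mulrDl mul1r opprD addrA lerD2r.
by rewrite le_min h1 h2.
Qed.

(* Take a in the image of rA and a much longer b in the image of rB.  The path from
   1 through b and ab = ba to a stays far from the point w of a geodesic from 1 to a
   at which the norm of rA w is about half that of a; but in a hyperbolic space the
   distance from w to a path from 1 to a is at most logarithmic in its length. *)
Lemma commuting_retracts_not_hyperbolic_for (delta : rat) :
  ~ forall w x y z, Num.min (gromov_product S w x y) (gromov_product S w y z) - delta
      <= gromov_product S w x z.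
Proof.
move=> hyp.
have [LA hLA] := morph_lipschitz genS rAM; have [LB hLB] := morph_lipschitz genS rBM.
pose L := (LA + LB).+1.
have rAL x y : (d (rA x) (rA y) <= L * d x y)%N.
  by apply: leq_trans (hLA x y) _; rewrite leq_mul2r /L; lia.
have rBL x y : (d (rB x) (rB y) <= L * d x y)%N.
  by apply: leq_trans (hLB x y) _; rewrite leq_mul2r /L; lia.
have [D hD] : exists D : nat, delta <= D%:R.
  have [|/ltW] := leP 0 delta; last by exists 0%N.
  by move=> /archi_boundP/ltW h; exists (Num.Def.archi_bound delta).
(* The end of the proof bounds [n] by [L * L + 2 * L * D * k + 2 * L], and [n] is chosen larger. The
   path of length [2 * m + n], which is at most [(2 * L + 3) * n + 2 * L], must also fit into
   [2 ^ k] steps. *)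
pose c1 := (4 * L + L * L)%N; pose c2 := (2 * L * D)%N.
have [k hk] := exp2_dominates_linear
  ((2 * L + 3) * (c1 + 1 + L) + 2 * L)%N ((2 * L + 3) * c2)%N.
have [a rAa /andP[na an]] := pick rAM rAK rAL infA (c1 + c2 * k + 1)%N.
set n := d 1 a in na an.
have [b rBb /andP[nb bn]] := pick rBM rBK rBL infB ((L + 1) * n)%N.
set m := d 1 b in nb bn.
have [p [p0 pn pstep _ pd]] := word_dist_geodesic genS 1 a.
have [q [q0 qm qstep _ _]] := word_dist_geodesic genS 1 b.
have rA1 : rA 1 = 1%g by exact: morph_grp1 rAM.
have rB1 : rB 1 = 1%g by exact: morph_grp1 rBM.
have rApstep j : (d (rA (p j)) (rA (p j.+1)) <= L)%N.
  by apply: leq_trans (rAL _ _) _; rewrite -[leqRHS]muln1 leq_mul2l pstep orbT.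
have rBqstep j : (d (rB (q j)) (rB (q j.+1)) <= L)%N.
  by apply: leq_trans (rBL _ _) _; rewrite -[leqRHS]muln1 leq_mul2l qstep orbT.
have [i0 [i0n hi1 hi2]] : exists i, [/\ (i <= n)%N, (n <= 2 * d 1 (rA (p i)))%N &
    (2 * d 1 (rA (p i)) <= n + 2 * L)%N].
  have ex : exists j, (n <= 2 * d 1%g (rA (p j)))%N.
    by exists n; rewrite pn // rAa -/n; lia.
  case: (ex_minnP ex) => -[|j] nj minj.
    by exists 0%N; split=> //; move: nj; rewrite p0 rA1 word_distxx //; lia.
  have lt : (2 * d 1%g (rA (p j)) < n)%N.
    by rewrite ltnNge; apply/negP => /minj; rewrite ltnn.
  exists j.+1; split=> //.
    by apply: minj; rewrite pn // rAa -/n; lia.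
  have := word_dist_triangle genS (rA (p j)) 1%g (rA (p j.+1)).
  by have := rApstep j; lia.
pose w := p i0.
have wn : (d 1%g w + d w a <= n)%N by exact: pd.
(* Three sides: from 1 to [b], on to [b * a = a * b], and back to [a]. Truncated subtraction keeps
   [x] at [a] past the end, which pads the path to [2 ^ k] steps. *)
pose x j := if (j <= m)%N then rB (q j) else
            if (j <= m + n)%N then (b * rA (p (j - m)%N))%g else
            (a * rB (q (m + m + n - j)%N))%g.
have ab : (a * b = b * a)%g by rewrite -rAa -rBb rC.
have xstep j : (d (x j) (x j.+1) <= L)%N.
  rewrite /x; have [jm|jm] := ltnP j m; first by rewrite (ltnW jm).
  have [jm'|jm'] := leqP j m.
    have -> : j = m by lia.
    rewrite qm // rBb; have [mn|mn] := ltnP m (m + n).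
      have e : b = (b * rA (p 0%N))%g by rewrite p0 rA1 mulg1.
      by rewrite {1}e word_dist_mul // subSnn rApstep.
    by move: na; lia.
  have [jmn|jmn] := ltnP j (m + n).
    by rewrite (ltnW jmn) subSn ?word_dist_mul // ltnW.
  have [jmn'|jmn'] := leqP j (m + n).
    have -> : j = (m + n)%N by lia.
    have -> : (m + n - m = n)%N by lia.
    rewrite pn // rAa -ab -{1}rBb -(qm m) // word_dist_mul //.
    have [|m0] := posnP m; first by move: na nb; nia.
    have -> : (m + m + n - (m + n).+1 = m.-1)%N by lia.
    by rewrite word_dist_sym // -{2}(prednK m0).
  rewrite word_dist_mul // word_dist_sym //.
  have [jl|jl] := ltnP j (m + m + n).
    have -> : (m + m + n - j = (m + m + n - j.+1).+1)%N by lia.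
    exact: rBqstep.
  have -> : (m + m + n - j = 0)%N by lia.
  have -> : (m + m + n - j.+1 = 0)%N by lia.
  by rewrite word_distxx.
(* On the outer sides [rA] takes the values 1 and [a], both at least [n / 2 - L] away from [rA w].
   On the middle side [rB] is [b], at distance at least [n] from [rB w] because [m >= (L + 1) * n].
   The Lipschitz bounds transfer this to [w]. *)
have far j : (n <= 2 * L * d w (x j) + 2 * L)%N.
  rewrite /x; case: ifP => jm.
    have := rAL w (rB (q j)); rewrite rAB.
    by rewrite word_dist_sym //; move: hi1; rewrite -/w; nia.
  case: ifP => jmn.
    have := rBL w (b * rA (p (j - m)%N))%g.
    rewrite rBM rBA mulg1 rBb.
    have := word_dist_triangle genS (rB w) 1%g b; rewrite -/m.
    have := rBL 1%g w; rewrite rB1; nia.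
  have := rAL w (a * rB (q (m + m + n - j)%N))%g.
  rewrite rAM rAB mulg1 rAa.
  have := word_dist_triangle genS (rA w) 1%g a; rewrite -/n.
  by move: hi2; rewrite -/w; nia.
have x0 : x 0%N = 1%g by rewrite /x q0 rB1.
have xend : x (2 ^ k)%N = a.
  have le : (m + m + n <= 2 ^ k)%N.
    apply: leq_trans hk; move: an bn nb; nia.
  rewrite /x; case: ifP => h1; first by move: na nb; nia.
  case: ifP => h2; first by move: na nb; nia.
  have -> : (m + m + n - 2 ^ k = 0)%N by lia.
  by rewrite q0 rB1 mulg1.
pose N : rat := (n%:R - 2 * L%:R) / (2 * L%:R).
have L0 : (0 : rat) < L%:R by rewrite ltr0n.
have farN j : N <= (d w (x j))%:R.
  rewrite /N ler_pdivrMr ?mulr_gt0 // lerBlDr.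
  have := far j; rewrite -(ler_nat rat) natrD !natrM.
  by move/le_trans; apply; lra.
have consec j : N - L%:R / 2 <= gromov_product S w (x j) (x j.+1).
  rewrite /gromov_product ![d (x _) w]word_dist_sym //.
  have := farN j; have := farN j.+1.
  have : (d (x j) (x j.+1))%:R <= L%:R :> rat by rewrite ler_nat.
  by lra.
have := gromov_product_chain hyp consec k 0%N.
rewrite add0n x0 xend.
have : gromov_product S w 1%g a <= 0.
  rewrite /gromov_product; move: wn; rewrite -(ler_nat rat) natrD [d a w]word_dist_sym //.
  by rewrite -/n; lra.
have kD : k%:R * delta <= k%:R * D%:R by apply: ler_wpM2l => //; exact: ler0n.
move=> h1 h2.
have : N <= L%:R / 2 + k%:R * D%:R by lra.
rewrite /N ler_pdivrMr ?mulr_gt0 //.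
rewrite lerBlDr => h3.
have : n%:R <= (L * L + 2 * L * D * k + 2 * L)%:R :> rat.
  rewrite !natrD !natrM; apply: le_trans h3 _; lra.
by rewrite ler_nat; move: na; rewrite /c1 /c2; lia.
Qed.

End Metric.

Lemma commuting_retracts_not_hyperbolic : ~ word_hyperbolic A.
Proof.
move=> [S [genS [delta hyp]]].
exact: (commuting_retracts_not_hyperbolic_for genS hyp).
Qed.

End NonHyperbolic.

Section HyperbolicQuotient.
Variables (A B : groupType) (f : A -> B).
Hypothesis fM : {morph f : x y / x * y}.
Hypothesis f_surj : forall y, exists x, f x = y.
Hypothesis fin_ker : finite_set [set x | f x = 1].

Lemma finite_kernel_word_dist S : generates S -> exists M, forall x y,
  (word_dist (map f S) (f x) (f y) <= word_dist S x y <=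
   word_dist (map f S) (f x) (f y) + M)%N.
Proof.
move=> genS; have genfS := morph_generates fM f_surj genS.
have [/= s sE] : exists s : seq A, [set x | f x = 1] = [set` s] by apply/finite_seqP.
exists (\max_(z <- s) word_dist S 1 z)%N => x y; apply/andP; split.
  have [[p [xp <-] <-] _] := word_distP genS x y.
  rewrite -(size_map f) -last_map; apply: word_dist_path genfS _ _ _.
  by rewrite path_map; apply: sub_path xp => u v; exact: cayley_map.
have [[p [xp py] <-] _] := word_distP genfS (f x) (f y).
have [y' fy' dy'] : exists2 y', f y' = f y & (word_dist S x y' <= size p)%N.
  rewrite -{}py; elim: p x xp => [|z p IH] x /=.
    by exists x; rewrite ?word_distxx.
  move=> /andP[xz zp].
  have [x' fx' xx'] : exists2 x', f x' = z & cayley S x x'.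
    case/orP: xz => /mapP[t tS e].
      exists (x * t); first by rewrite fM -e mulVKg.
      by rewrite /cayley mulKg tS.
    exists (x * t^-1); first by rewrite fM (morph_grpV fM) -e invgM invgK mulVKg.
    by rewrite /cayley invgM invgK mulgVK tS orbT.
  rewrite -fx' in zp *; have [y' fy' dy'] := IH _ zp.
  exists y' => //; apply: leq_trans (word_dist_triangle genS x' _ _) _.
  by rewrite -add1n leq_add ?word_dist_step.
apply: leq_trans (word_dist_triangle genS y' _ _) _; apply: leq_add => //.
rewrite -(word_dist_mul genS y'^-1) mulVg.
apply: (@leq_bigmax_seq _ s predT (word_dist S 1)) => //.
have : [set x | f x = 1] (y'^-1 * y) by rewrite /= fM (morph_grpV fM) fy' mulVg.
by rewrite sE.
Qed.

Lemma finite_kernel_word_hyperbolic : word_hyperbolic A -> word_hyperbolic B.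
Proof.
move=> [S [genS [delta hyp]]]; exists (map f S); split.
  exact: morph_generates.
have [M hM] := finite_kernel_word_dist genS.
exists (delta + 3 * M%:R)%R => w' x' y' z'.
have [w <-] := f_surj w'; have [x <-] := f_surj x'.
have [y <-] := f_surj y'; have [z <-] := f_surj z'.
have := hyp w x y z; rewrite /gromov_product.
have cmp u v : ((word_dist (map f S) (f u) (f v))%:R <= (word_dist S u v)%:R :> rat)%R /\
   ((word_dist S u v)%:R <= (word_dist (map f S) (f u) (f v))%:R + M%:R :> rat)%R.
  by have /andP[? ?] := hM u v; rewrite -natrD !ler_nat.
have := cmp x w; have := cmp y w; have := cmp z w.
have := cmp x y; have := cmp y z; have := cmp x z.
do 6![move=> [? ?]].
rewrite lerBlDr ge_min => /orP[] h; rewrite lerBlDr ge_min; apply/orP; [left|right]; lra.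
Qed.

End HyperbolicQuotient.

(** * Right-angled Coxeter groups *)

Definition group2 := bool.
HB.instance Definition _ := Choice.on group2.
Fact group2_mulVg : left_inverse (false : group2) (id : group2 -> group2) addb.
Proof. exact: addbb. Qed.
HB.instance Definition _ := isGroup.Build group2
  addbA addFb addbF group2_mulVg group2_mulVg.

Section RightAngledCoxeter.
Variables (I : choiceType) (F : rel I).

Definition racg : groupType := graph_product F (fun _ : I => group2 : groupType).
Local Notation W := racg.

Definition refl (i : I) : W := gp_in F (true : (fun _ : I => group2 : groupType) i).

Lemma reflK i : refl i * refl i = 1.
Proof. by rewrite /refl -gp_inM gp_in1. Qed.

Lemma reflV i : (refl i)^-1 = refl i.
Proof. by apply: (mulgI (refl i)); rewrite mulgV reflK. Qed.

Lemma racg_ind (P : W -> Prop) :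
  P 1 -> (forall x i, P x -> P (x * refl i)) -> forall x, P x.
Proof.
move=> P1 PM; elim/gp_ind => // x i [] Px; first exact: PM.
by rewrite (gp_in1 F) mulg1.
Qed.

Definition parity (i : I) : W -> group2 :=
  gp_hom (fun j (e : group2) => if j == i then e else 1).

Lemma parityM i : {morph parity i : x y / x * y}.
Proof.
apply: gp_homM => [j g h|j k g h _]; first by case: ifP.
by case: ifP; case: ifP; case: g; case: h.
Qed.

Lemma parity1 i : parity i 1 = 1. Proof. exact: morph_grp1 (parityM i). Qed.

Lemma parity_refl i j : parity i (refl j) = (j == i).
Proof.
rewrite /parity gp_hom_in /=.
- by case: ifP.
- by move=> k g h; case: ifP.
- by move=> k l g h _; case: ifP; case: ifP; case: g; case: h.
Qed.

Definition even : {pred W} := fun x => `[< forall i, parity i x = 1 >].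

Fact even_closed : group_closed even.
Proof.
split=> [|x y /asboolP x1 /asboolP y1]; apply/asboolP => i; first exact: parity1.
by rewrite parityM (morph_grpV (parityM i)) x1 y1.
Qed.

Definition even_subgroup := {x : W | even x}.
HB.instance Definition _ := SubChoice.on even_subgroup.
HB.instance Definition _ :=
  SubChoice_isSubGroup.Build W even even_subgroup even_closed.

End RightAngledCoxeter.

(** * Embedding even Coxeter elements into a graph product *)

Section CrossedEmbedding.
Variables (I : choiceType) (F : rel I).
Variables (V : choiceType) (E : rel V) (G : V -> groupType).
Hypothesis symF : symmetric F.
Hypothesis irrF : irreflexive F.
Hypothesis symE : symmetric E.
Hypothesis irrE : irreflexive E.
Local Notation GP := (graph_product E G).
Local Notation W := (racg F).
Variables (c : I -> V) (g : forall i, G (c i)).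
Hypothesis c_inj : injective c.
Hypothesis cE : forall i j, E (c i) (c j) = F i j.
Hypothesis g1 : forall i, g i != 1.

Let t i (e : bool) : GP := if e then gp_in E (g i) else 1.

Let tC i j e e' : F i j -> t i e * t j e' = t j e' * t i e.
Proof.
move=> ij; case: e; case: e'; rewrite /t ?mulg1 ?mul1g //.
by rewrite gp_in_commute // cE.
Qed.

(* Reading the i-th reflection toggles the i-th bit of the state and multiplies
   by g i or by its inverse, so that even words spell elements where the
   exponents of each g i alternate between 1 and -1. *)
Definition crossed_act i (sx : (I -> bool) * GP) (e : group2) : (I -> bool) * GP :=
  (fun j => if j == i then sx.1 j (+) e else sx.1 j,
   sx.2 * (t i (sx.1 i))^-1 * t i (sx.1 i (+) e)).

Let act1 i sx : crossed_act i sx 1 = sx.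
Proof.
case: sx => s x; rewrite /crossed_act /= addbF mulgVK; congr pair.
by apply/funext => j; rewrite addbF if_same.
Qed.

Let actM i sx (e e' : group2) :
  crossed_act i sx (e * e') = crossed_act i (crossed_act i sx e) e'.
Proof.
case: sx => s x; rewrite /crossed_act /= eqxx -[e * e']/(e (+) e') addbA mulgK.
by congr pair; apply/funext => j; case: ifP => //; rewrite addbA.
Qed.

Let actC i j sx (e e' : group2) : F i j ->
  crossed_act j (crossed_act i sx e) e' = crossed_act i (crossed_act j sx e') e.
Proof.
move=> ij; have neq : (i == j) = false by apply/eqP => e0; rewrite e0 irrF in ij.
case: sx => s x; rewrite /crossed_act /= [j == i]eq_sym neq; congr pair.
  by apply/funext => k; case: (eqVneq k i) => [->|ki]; rewrite ?neq //.
have cVV a b : t i a * (t j b)^-1 = (t j b)^-1 * t i a.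
  by apply: (mulgI (t j b)); rewrite mulVKg mulgA -(tC _ _ ij) mulgK.
have cVV' a b : t j a * (t i b)^-1 = (t i b)^-1 * t j a.
  by apply: (mulgI (t i b)); rewrite mulVKg mulgA (tC _ _ ij) mulgK.
have cV2 a b : (t i a)^-1 * (t j b)^-1 = (t j b)^-1 * (t i a)^-1.
  by rewrite -!invgM (tC _ _ ij).
rewrite -!mulgA; congr (_ * _); rewrite [t i _ * _]mulgA cVV -!mulgA (tC _ _ ij).
by rewrite mulgA cV2 -!mulgA; congr (_ * _); rewrite !mulgA cVV'.
Qed.

Definition crossed_state (x : W) := gp_act crossed_act (fun=> false, 1) x.
Definition crossed (x : W) : GP := (crossed_state x).2.

Lemma crossed_state_refl x i :
  crossed_state (x * refl F i) = crossed_act i (crossed_state x) true.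
Proof. by rewrite /crossed_state gp_actM // gp_act_in. Qed.

Lemma crossed_parity x i : (crossed_state x).1 i = parity i x.
Proof.
elim/racg_ind: x => [|x j IH]; first by rewrite /crossed_state gp_act1 // parity1.
rewrite crossed_state_refl /= IH parityM parity_refl [i == j]eq_sym.
by case: (j == i) => //=; rewrite -[RHS]/(_ (+) false) addbF.
Qed.

(** After an even [x] all bits are [false] again, so [y] is read as from the initial state. *)
Lemma crossed_mul x y : (forall i, parity i x = 1) ->
  crossed (x * y) = crossed x * crossed y.
Proof.
move=> x1; suff : crossed_state (x * y) = ((crossed_state y).1, crossed x * crossed y).
  by rewrite /crossed => ->.
elim/racg_ind: y => [|y i IH].
  rewrite mulg1 [crossed 1]/crossed {2 3}/crossed_state gp_act1 // mulg1 /crossed.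
  rewrite [LHS]surjective_pairing; congr pair; apply/funext => i.
  by rewrite crossed_parity x1.
by rewrite mulgA !crossed_state_refl IH /crossed_act /= /crossed crossed_state_refl /= !mulgA.
Qed.

Let tau v (w : W) : W := if pselect (exists i, c i = v) is left ex
  then w * refl F (sval (cid ex)) else w.

Let tau_c i w : tau (c i) w = w * refl F i.
Proof.
rewrite /tau; case: pselect => [ex|[]]; last by exists i.
by case: (cid ex) => j /= /c_inj ->.
Qed.

Let tauK v : involutive (tau v).
Proof.
move=> w; have [[i <-]|no] := pselect (exists i, c i = v).
  by rewrite !tau_c -mulgA reflK mulg1.
by rewrite /tau; case: pselect.
Qed.

Let tauC u v w : E u v -> tau u (tau v w) = tau v (tau u w).
Proof.
have [[i <-]|no] := pselect (exists i, c i = u); last first.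
  by rewrite {1 4}/tau; case: pselect.
have [[j <-]|no] := pselect (exists j, c j = v); last first.
  by rewrite {2 3}/tau; case: pselect.
by rewrite cE => ij; rewrite !tau_c -!mulgA /refl gp_in_commute // symF.
Qed.

(* The word is recovered from its image: the i-th letter occurs whenever the
   coordinate at c i changes between trivial and nontrivial. *)
Lemma crossed_inj : injective crossed.
Proof.
suff key x : gp_flip tau 1 (crossed x) =
    (fun v => if pselect (exists i, c i = v) is left ex
              then let i := sval (cid ex) in
                   if (crossed_state x).1 i then
                     eq_rect (c i) G (g i) v (svalP (cid ex)) else 1
              else 1, x).
  by move=> x y xy; have := key x; rewrite xy key => -[].
pose S s := (fun v => if pselect (exists i, c i = v) is left ex
              then let i := sval (cid ex) in
                   if s i then eq_rect (c i) G (g i) v (svalP (cid ex)) else 1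
              else 1) : forall v, G v.
have Sc s i : S s (c i) = if s i then g i else 1.
  rewrite /S; case: pselect => [ex|[]]; last by exists i.
  case: (cid ex) => j e; have ji := c_inj e; subst j.
  by move: (svalP _) => /= e'; rewrite (Prop_irrelevance e' erefl).
have Supd s i e : (fun v => dfwith (S s) (if e then g i else 1) v) =
    S (fun j => if j == i then e else s j).
  apply/functional_extensionality_dep => v.
  have [iv|iv] := eqVneq (c i) v.
    by case: v / iv; rewrite dfwith_in Sc eqxx.
  rewrite dfwith_out // /S; case: pselect => // ex; case: (cid ex) => j /= jv.
  by have -> : (j == i) = false by apply: contra_neqF iv => /eqP <-.
rewrite -/(S _); elim/racg_ind: x => [|x i IH].
  rewrite /gp_flip /crossed /crossed_state gp_act1 //= gp_act1; first last.
  - exact: flipC.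
  - exact: flipM.
  - exact: flip1.
  congr pair; apply/functional_extensionality_dep => v; rewrite /S.
  by case: pselect.
have [s [se ->]] : exists s, (crossed_state x).1 = s /\
   crossed (x * refl F i) = crossed x * gp_in E (if s i then (g i)^-1 else g i).
  exists (crossed_state x).1; split=> //.
  rewrite /crossed crossed_state_refl /= -mulgA; congr (_ * _).
  by rewrite /t; case: (_ i) => /=; rewrite ?mulg1 ?gp_inV ?invg1 ?mul1g.
rewrite /gp_flip gp_actM; [|exact: flip1|exact: flipM|exact: flipC].
rewrite -/(gp_flip _ _ _) IH se gp_act_in; [|exact: flip1|exact: flipM|exact: flipC].
rewrite crossed_state_refl /flip /= se Sc tau_c.
have gi : (g i == 1) = false by apply/negbTE/g1.
congr pair.
  have -> : (fun j => if j == i then s j (+) true else s j) =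
      (fun j => if j == i then ~~ s i else s j).
    by apply/funext => j; case: eqVneq => [->|] //; rewrite addbT.
  rewrite -[RHS]/(S _) -Supd; apply/functional_extensionality_dep => v.
  have -> // : (if s i then g i else 1) * (if s i then (g i)^-1 else g i) =
      if ~~ s i then g i else 1.
  by case: (s i); rewrite /= ?mulgV ?mul1g.
by case: (s i); rewrite /= ?mulgV ?mul1g ?eqxx; case: (@eqP _ (g i)) => // e;
   have := g1 i; rewrite e eqxx.
Qed.

Lemma crossed_embedding : exists f : even_subgroup F -> GP,
  injective f /\ {morph f : x y / x * y}.
Proof.
exists (fun x => crossed (val x)); split=> [x y /crossed_inj/val_inj //|x y].
by rewrite gmulfM crossed_mul //; apply/asboolP/(valP x).
Qed.

End CrossedEmbedding.

(** * Tilings by reflections *)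

Section RacgWords.
Variables (I : choiceType) (F : rel I).
Local Notation W := (racg F).

Definition rword (s : seq I) : W := foldl (fun x i => x * refl F i) 1 s.

Lemma rword_rcons s i : rword (rcons s i) = rword s * refl F i.
Proof. by rewrite /rword foldl_rcons. Qed.

Lemma rword_cat s t : rword (s ++ t) = rword s * rword t.
Proof.
elim/last_ind: t => [|t i IH]; first by rewrite cats0 [rword [::]]/= mulg1.
by rewrite -rcons_cat !rword_rcons IH mulgA.
Qed.

Lemma rword_cons i s : rword (i :: s) = refl F i * rword s.
Proof. by rewrite -cat1s rword_cat /rword /= mul1g. Qed.

Lemma rword_rev s : rword (rev s) = (rword s)^-1.
Proof.
elim: s => [|i s IH]; first by rewrite invg1.
by rewrite rev_cons rword_rcons IH rword_cons invgM reflV.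
Qed.

Lemma rword_surj x : exists s, rword s = x.
Proof.
elim/racg_ind: x => [|x i [s <-]]; first by exists [::].
by exists (rcons s i); rewrite rword_rcons.
Qed.

Lemma parity_rword i s : parity i (rword s) = odd (count_mem i s).
Proof.
elim: s => [|j s IH]; first exact: parity1.
by rewrite rword_cons parityM parity_refl IH /= oddD oddb.
Qed.

Lemma parity_rword_mem i s : parity i (rword s) = true -> i \in s.
Proof. by rewrite parity_rword => /odd_gt0; rewrite -has_count => /hasP[j js /eqP <-]. Qed.

Lemma parity_rword_uniq i s : uniq s -> parity i (rword s) = (i \in s).
Proof. by move=> us; rewrite parity_rword count_uniq_mem // oddb. Qed.

Lemma rword_commute i s : {in s, forall j, F i j || (i == j)} ->
  refl F i * rword s = rword s * refl F i.
Proof.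
elim: s => [|j s IH] h; first by rewrite mulg1 mul1g.
rewrite rword_cons -mulgA -IH; last by move=> k ks; apply: h; rewrite inE ks orbT.
rewrite !mulgA; congr (_ * _).
have /orP[ij|/eqP -> //] := h j (mem_head _ _).
by rewrite /refl gp_in_commute.
Qed.

(** The letters commute, and each occurs an even number of times, the unit of [group2] being
    [false]; the leading letter cancels against another occurrence. *)
Lemma even_clique_word s : {in s &, forall i j, i != j -> F i j} ->
  (forall i, parity i (rword s) = 1) -> rword s = 1.
Proof.
have [n] := ubnP (size s); elim: n s => // n IH [//|i s] /= sn cl ev.
have is_ : i \in s.
  apply: parity_rword_mem; have := ev i; rewrite rword_cons parityM parity_refl eqxx.
  by case: parity.
have [s1 [s2 sE]] : exists s1 s2, s = s1 ++ i :: s2.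
  by case/splitPr: is_ => s1 s2; exists s1, s2.
have e : rword (i :: s) = rword (s1 ++ s2).
  rewrite rword_cons sE !rword_cat rword_cons mulgA (rword_commute (s := s1)).
    by rewrite -mulgA [refl F i * (_ * _)]mulgA reflK mul1g.
  move=> j js1; have [<-|ij] := eqVneq i j; first by rewrite orbT.
  by rewrite cl ?mem_head // inE sE mem_cat js1 orbT.
rewrite e; apply: IH.
- by move: sn; rewrite sE !size_cat /=; lia.
- move=> j k js ks; apply: cl; rewrite inE sE mem_cat inE;
    [move: js|move: ks]; rewrite mem_cat => /orP[] ->; rewrite ?orbT //.
- by move=> j; rewrite -e.
Qed.

Definition rlen_ex x : exists n, `[< exists2 s, rword s = x & size s = n >].
Proof. by have [s sx] := rword_surj x; exists (size s); apply/asboolP; exists s. Qed.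

Definition rlen (x : W) : nat := ex_minn (rlen_ex x).

Lemma rlenP x : exists2 s, rword s = x & size s = rlen x.
Proof. by rewrite /rlen; case: ex_minnP => n /asboolP. Qed.

Lemma rlen_word s : (rlen (rword s) <= size s)%N.
Proof.
rewrite /rlen; case: ex_minnP => n _; apply.
by apply/asboolP; exists s.
Qed.

Lemma rlen_refl x i : (rlen (x * refl F i) <= (rlen x).+1)%N.
Proof.
have [s <- <-] := rlenP x; rewrite -rword_rcons.
by apply: leq_trans (rlen_word _) _; rewrite size_rcons.
Qed.

Lemma rlen_pred x : x != 1 -> exists y i, x = y * refl F i /\ (rlen y).+1 = rlen x.
Proof.
have [s sx sl] := rlenP x; elim/last_ind: s sx sl => [<-|s i _]; first by rewrite eqxx.
rewrite rword_rcons => sx sl _; exists (rword s), i; split=> //.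
apply/eqP; rewrite eqn_leq -{2}sx rlen_refl andbT -sl size_rcons ltnS.
exact: rlen_word.
Qed.

End RacgWords.

Section OrbitChart.
Variables (R : realType) (P : groupType) (A : free_action (hplane R) P).
Local Open Scope ring_scope.
Local Notation eps := (fa_radius A).

Lemma orbit_space_chart (p : orbit_space A) : exists2 r : R, 0 < r &
  exists f : orbit_space A -> R * R,
    [/\ hyp_plane (f p), f @` ball p r = hyp_ball (f p) r &
        forall q q', ball p r q -> ball p r q' -> mdist q q' = hyp_dist (f q) (f q')].
Proof.
have e0 := fa_radius_gt0 A; have [y yp] := orbit_proj_surj p.
(* With this radius two points of the ball have representatives less than [eps] apart, where
   [orbit_dist] is not truncated. *)
exists (eps / 2); first by lra.
pose g q := xget y [set z | orbit_proj A z = q /\ mdist y z < eps / 2].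
have gE z : mdist y z < eps / 2 -> g (orbit_proj A z) = z.
  move=> yz; rewrite /g; case: xgetP => [z' _ [z'z yz']|/(_ z)]; last by case.
  apply: (orbit_sep (A := A)) => //; have := metric_triangle z' y z.
  by rewrite [mdist z' y]metric_sym; lra.
have gl q : ball p (eps / 2) q -> exists z, [/\ q = orbit_proj A z, g q = z & mdist y z < eps / 2].
  rewrite ballEmdist /= mdist_orbit -yp => pq.
  have [|z zq yz] := @orbit_dist_lift _ _ _ A y q; first by lra.
  by rewrite -yz in pq; exists z; rewrite -zq gE.
have gp : g p = y by rewrite -yp gE // mdistxx; lra.
exists (fun q => val (g q)); rewrite gp; split.
- exact: (valP y).
- apply/seteqP; split=> [_ [q /gl[z [_ -> yz]] <-]|w [w0 yw]].
    by split; [exact: (valP z)|exact: yz].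
  pose z : hplane R := exist _ w w0; exists (orbit_proj A z); last by rewrite gE.
  have yz : mdist y z < eps / 2 := yw.
  by rewrite ballEmdist /= -yp; apply: le_lt_trans (orbit_proj_lipschitz _ _ _) yz.
- move=> q q' /gl[z [-> -> yz]] /gl[z' [-> -> yz']].
  rewrite mdist_orbit orbit_dist_proj //.
  have := metric_triangle z y z'; rewrite [mdist z y]metric_sym; lra.
Qed.

End OrbitChart.

Section Tiling.
Variables (R : realType) (I : finType) (F : rel I).
Hypothesis symF : symmetric F.
Variables (e : I -> wall R) (b m M : R).
Local Open Scope ring_scope.
Hypothesis e1 : forall i, wform (e i) (e i) = 1.
Hypothesis e_adj : forall i j, F i j -> wform (e i) (e j) = 0.
Hypothesis m0 : 0 < m.
Hypothesis e_opp : forall i j, i != j -> ~~ F i j ->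
  wform (e i) (e j) <= - 1 /\ 1 + m ^+ 2 <= wform (e i) (e j) ^+ 2.
Hypothesis b0 : 0 < b.
Hypothesis e_pos : forall i, wu (e i) + ws (e i) = 2 * b.

Definition polygon : set (hplane R) := [set z | forall i, hform z (e i) <= 0].

Hypothesis polygon_bounded : forall z, polygon z -> hu z + hs z <= M.

Local Notation W := (racg F).

Let a (i : I) (z : hplane R) (t : group2) : hplane R := if t then hrefl (e i) z else z.

Let a1 i z : a i z 1%g = z. Proof. by []. Qed.

Let aM i z (t t' : group2) : a i z (t * t')%g = a i (a i z t) t'.
Proof. by case: t; case: t'; rewrite /a /= ?hreflK. Qed.

Let aC i j z (t t' : group2) : F i j -> a j (a i z t) t' = a i (a j z t') t.
Proof.
by move=> ij; case: t; case: t'; rewrite /a //= hrefl_commute // e_adj // symF.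
Qed.

(** A right action: the last letter is applied last, as the reflection in a fixed wall of the base
    polygon. [even_free_action] inverts it into a left action. *)
Definition tile_act (z : hplane R) (x : W) : hplane R := gp_act a z x.
Local Notation ta := tile_act.

Lemma tile_act1 z : ta z 1%g = z. Proof. exact: gp_act1. Qed.

Lemma tile_actM z x y : ta z (x * y)%g = ta (ta z x) y. Proof. exact: gp_actM. Qed.

Lemma tile_act_refl z i : ta z (refl F i) = hrefl (e i) z.
Proof. by rewrite /ta gp_act_in. Qed.

Lemma tile_act_step z x i : ta z (x * refl F i)%g = hrefl (e i) (ta z x).
Proof. by rewrite tile_actM tile_act_refl. Qed.

Lemma tile_act_isom x z z' : mdist (ta z x) (ta z' x) = mdist z z'.
Proof.
elim/racg_ind: x => [|x i IH]; first by rewrite !tile_act1.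
by rewrite !tile_act_step mdist_refl.
Qed.

Let opp_gap z i j : i != j -> ~~ F i j -> 0 <= hform z (e i) -> hform z (e j) <= - m.
Proof.
move=> ij Fij; have [g1 g2] := e_opp ij Fij.
by apply: hform_opposite_gap; rewrite ?e1 ?e_pos ?mulr_gt0 //; exact: ltW.
Qed.

(* If the length does not drop at the wall i, then the tile stays on the side of
   the base polygon: half-planes of non-adjacent walls are disjoint, and those of
   adjacent walls are orthogonal. *)
Lemma tile_side x i z : (rlen x <= rlen (x * refl F i)%g)%N -> polygon z ->
  hform (ta z x) (e i) <= 0.
Proof.
have [n] := ubnP (rlen x); elim: n x i => // n IH x i xn xi Cz.
have [x1|x1] := eqVneq x 1%g; first by rewrite x1 tile_act1; exact: Cz.
have [y [j [xy yl]]] := rlen_pred x1; rewrite xy tile_act_step.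
have ij : i != j.
  by apply: contraTneq xi => ->; rewrite -ltnNge xy -mulgA reflK mulg1 -xy -yl.
have yn : (rlen y < n)%N by rewrite -ltnS yl.
have [Fij|Fij] := boolP (F i j).
  rewrite hform_refl // e_adj; last by rewrite symF.
  rewrite mulr0 subr0; apply: IH => //.
  rewrite -ltnS yl; apply: leq_trans xi _; rewrite xy -mulgA.
  have -> : (refl F j * refl F i = refl F i * refl F j)%g.
    by rewrite /refl gp_in_commute // symF.
  by rewrite mulgA; exact: rlen_refl.
have yj : hform (ta z y) (e j) <= 0 by apply: IH => //; rewrite -xy -yl.
have : 0 <= hform (hrefl (e j) (ta z y)) (e j) by rewrite hform_refl_id //; lra.
by move=> /(opp_gap (i := j) (j := i)); rewrite eq_sym ij symF => /(_ isT Fij) h;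
     apply: le_trans h _; rewrite oppr_le0 ltW.
Qed.

Lemma polygon_tile_meet z x : polygon z -> polygon (ta z x) ->
  ta z x = z /\ exists2 s, x = rword F s & {in s, forall i, hform z (e i) = 0}.
Proof.
have [n] := ubnP (rlen x); elim: n x => // n IH x xn Cz Cx.
have [x1|x1] := eqVneq x 1%g.
  by subst x; rewrite tile_act1; split=> //; exists [::].
have [y [j [xy yl]]] := rlen_pred x1.
have yj : hform (ta z y) (e j) <= 0 by apply: tile_side => //; rewrite -xy -yl.
have yj0 : hform (ta z y) (e j) = 0.
  have := Cx j; rewrite xy tile_act_step hform_refl_id // => h.
  by apply: le_anti; rewrite yj /= -oppr_le0.
have xyE : ta z x = ta z y by rewrite xy tile_act_step hrefl_fix.
have yn : (rlen y < n)%N by rewrite -ltnS yl.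
have Cy : polygon (ta z y) by rewrite -xyE.
have [yz [s ys hs]] := IH y yn Cz Cy.
split; first by rewrite xyE.
exists (rcons s j); first by rewrite rword_rcons -ys.
move=> i; rewrite mem_rcons inE => /orP[/eqP ->|]; last exact: hs.
by rewrite -[z in LHS]yz.
Qed.

Let walls_adjacent z (s : seq I) : {in s, forall i, hform z (e i) = 0} ->
  {in s &, forall i j, i != j -> F i j}.
Proof.
move=> h i j si sj ij; apply: contraT => Fij.
have := opp_gap (z := z) ij Fij; rewrite !h // => /(_ (lexx 0)).
by rewrite oppr_ge0 leNgt m0.
Qed.

Let bound_exists : exists2 g : R, 0 < g & forall i j, - g <= wform (e i) (e j).
Proof.
exists (1 + \sum_(i : I) \sum_(j : I) `|wform (e i) (e j)|).
  by rewrite ltr_wpDr // sumr_ge0 // => i _; rewrite sumr_ge0.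
move=> i j; rewrite lerNl; apply: le_trans (ler_norm _) _; rewrite normrN.
rewrite (bigD1 i) //= (bigD1 j) //=.
have h1 : 0 <= \sum_(k | k != j) `|wform (e i) (e k)| by rewrite sumr_ge0.
have h2 : 0 <= \sum_(k | k != i) \sum_(l : I) `|wform (e k) (e l)|.
  by rewrite sumr_ge0 // => k _; rewrite sumr_ge0.
by lra.
Qed.

(* When all violations are small, reflecting in a violated wall i creates no new one,
   as a wall nonadjacent to i is far from the point. *)
Let small_violation : exists2 d : R, 0 < d & forall z, (forall i, hform z (e i) <= d) ->
  exists2 s, uniq s & polygon (ta z (rword F s)).
Proof.
have [g g0 hg] := bound_exists.
(* Reflecting in a wall violated by at most [d] raises another form by at most [2 * d * g = m],
   which is absorbed because the form of a nonadjacent wall is at most [- m]. *)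
exists (m / (2 * g)); first by rewrite divr_gt0 // mulr_gt0.
set d := m / (2 * g) => z zd.
suff [s [us Cs _]] : exists s, [/\ uniq s, polygon (ta z (rword F s)) &
    {in s, forall i, 0 < hform z (e i)}] by exists s.
have [n] := ubnP #|[set i | 0 < hform z (e i)]%SET|.
elim: n z zd => // n IH z zd zn.
have [[i zi]|no] := pselect (exists i, 0 < hform z (e i)); last first.
  exists [::]; split=> //; rewrite [rword _ _]/= tile_act1 => i.
  by rewrite leNgt; apply/negP => zi; apply: no; exists i.
have step j : hform (hrefl (e i) z) (e j) <= Num.min d (Num.max (hform z (e j)) 0) /\
    (0 < hform (hrefl (e i) z) (e j) -> 0 < hform z (e j) /\ j != i).
  have dp : 0 < d by rewrite divr_gt0 // mulr_gt0.
  have [->|ji] := eqVneq j i.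
    rewrite hform_refl_id //; split; last by lra.
    by rewrite le_min le_max; apply/andP; split; [|apply/orP; right]; lra.
  have [Fij|Fij] := boolP (F i j).
    rewrite hform_refl // e_adj // mulr0 subr0; split=> //.
    by rewrite le_min zd le_max lexx.
  have zj : hform z (e j) <= - m by apply: (opp_gap (i := i)); rewrite ?ltW // eq_sym.
  have neg : hform (hrefl (e i) z) (e j) <= 0.
    rewrite hform_refl //.
    have h1 : - (2 * hform z (e i) * wform (e i) (e j)) <= 2 * hform z (e i) * g.
      rewrite -mulrN ler_wpM2l //; first by lra.
      by rewrite lerNl.
    have h2 : 2 * hform z (e i) * g <= 2 * d * g.
      by rewrite ler_wpM2r //; [exact: ltW|rewrite ler_wpM2l].
    have h3 : 2 * d * g = m by rewrite /d; field; rewrite gt_eqF.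
    by lra.
  split; last by lra.
  by rewrite le_min le_max; apply/andP; split; [|apply/orP; right]; lra.
have [||s [us Cs hs]] := IH (hrefl (e i) z).
- by move=> j; have [] := step j; rewrite le_min => /andP[].
- rewrite -ltnS; apply: leq_trans _ zn; rewrite ltnS; apply: proper_card.
  apply/properP; split.
    by apply/fintype.subsetP => j; rewrite !inE => /(step j).2[].
  exists i; rewrite !inE // hform_refl_id // -leNgt; lra.
exists (i :: s); split.
- by rewrite /= us andbT; apply/negP => /hs /(step i).2[_]; rewrite eqxx.
- by rewrite rword_cons tile_actM tile_act_refl.
- by move=> j; rewrite inE => /orP[/eqP -> //|/hs /(step j).2[]].
Qed.

(* Reflecting in a wall violated by more than d lowers hu + hs by a fixed amount. *)
Lemma polygon_tiles z : exists x, polygon (ta z x).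
Proof.
have [d d0 hd] := small_violation.
(* The drop is [2 * hform z (e i) * (wu (e i) + ws (e i))], more than [2 * d * (2 * b)]. *)
pose k : R := 4 * b * d; have k0 : 0 < k by rewrite !mulr_gt0.
have [n] : exists n : nat, hu z + hs z <= n%:R * k.
  have h0 : 0 <= (hu z + hs z) / k.
    by rewrite divr_ge0 ?ltW // addr_gt0 ?hu_gt0 ?hs_gt0.
  exists (Num.Def.archi_bound ((hu z + hs z) / k)).
  by rewrite -ler_pdivrMr // ltW // archi_boundP.
elim: n z => [|n IH] z hz.
  by move: hz; rewrite mul0r; have := hu_gt0 z; have := hs_gt0 z; lra.
have [[i zi]|no] := pselect (exists i, d < hform z (e i)); last first.
  have [|s _ Cs] := hd z; last by exists (rword F s).
  by move=> i; rewrite leNgt; apply/negP => zi; apply: no; exists i.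
have [|x Cx] := IH (hrefl (e i) z); last first.
  by exists (refl F i * x)%g; rewrite tile_actM tile_act_refl.
rewrite hu_refl // hs_refl //.
have -> : hu z - 2 * hform z (e i) * wu (e i) + (hs z - 2 * hform z (e i) * ws (e i)) =
  hu z + hs z - 2 * hform z (e i) * (wu (e i) + ws (e i)) by ring.
rewrite e_pos; move: hz; rewrite -natr1 mulrDl mul1r.
have : k <= 2 * hform z (e i) * (2 * b).
  have -> : k = 2 * d * (2 * b) by rewrite /k; ring.
  by rewrite ler_pM2r ?mulr_gt0 // ler_pM2l // ltW.
by lra.
Qed.

(** Move [z] to a point [y] of the polygon. The conjugate [h] of [g] moves [y] so little that
    distinct reflections [s] bring its image back into the polygon, so [h] times the word [s] is a
    word [t] in walls through [y]. As [h] is even and [s] has no repetition, the letters of [s]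
    occur in [t]; hence [h] is an even word over pairwise adjacent walls, and is trivial. *)
Let even_free : exists2 r : R, 0 < r & forall z (g : even_subgroup F),
  mdist z (ta z (val g)) < 4 * r -> g = 1%g.
Proof.
have [d d0 hd] := small_violation.
pose k := Num.sqrt (1 + d ^+ 2).
have d2 : 0 < d ^+ 2 by rewrite exprn_gt0.
have k1 : 1 < k.
  by rewrite /k -[ltLHS]sqrtr1 ltr_sqrt; lra.
have kk : k ^+ 2 = 1 + d ^+ 2 by rewrite sqr_sqrtr // addr_ge0 // sqr_ge0.
have [r r0 hr] := hcosh_lt_dist k1.
exists (r / 4); first by lra.
move=> z g; have -> : 4 * (r / 4) = r by lra.
move=> zg; have [x Cx] := polygon_tiles z.
have gev : forall i, parity i (val g) = 1%g by apply/asboolP; exact: (valP g).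
pose y := ta z x; pose h : W := (x^-1 * val g * x)%g.
have hev i : parity i h = 1%g.
  by rewrite /h !parityM gev mulg1 -parityM mulVg parity1.
have yh : mdist y (ta y h) < r.
  rewrite /y -tile_actM /h -mulgA mulVKg tile_actM tile_act_isom //.
have [|s us Cs] := hd (ta y h).
  move=> i; apply: hform_lipschitz (Cx i) => //.
  by rewrite -kk ler_sqr ?nnegrE; [exact: ltW (hr _ _ yh)| |];
    [have := hcosh_ge1 y (ta y h)|]; lra.
rewrite -tile_actM in Cs; have [_ [t ht tw]] := polygon_tile_meet Cx Cs.
have hE : h = rword F (t ++ rev s) by rewrite rword_cat rword_rev -ht mulgK.
have st i : i \in s -> i \in t.
  move=> si; apply: (@parity_rword_mem _ F).
  by rewrite -ht parityM hev mul1g parity_rword_uniq.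
have h1 : h = 1%g.
  rewrite hE; apply: even_clique_word; last by move=> i; rewrite -hE.
  have sub i : i \in t ++ rev s -> i \in t.
    by rewrite mem_cat mem_rev => /orP[//|/st].
  by move=> i j /sub it /sub jt; exact: (walls_adjacent tw).
have vg : val g = 1%g.
  have -> : val g = (x * h / x)%g by rewrite /h !mulgA mulgV mul1g mulgK.
  by rewrite h1 mulg1 mulgV.
by apply: val_inj; rewrite vg; exact/esym/val1.
Qed.

Lemma even_free_action : exists A : free_action (hplane R) (even_subgroup F),
  forall g z, fa_act A g z = ta z (val g)^-1%g.
Proof.
have [r r0 hr] := even_free.
pose act (g : even_subgroup F) z := ta z (val g)^-1%g.
have act1 z : act 1%g z = z by rewrite /act gmulf1 invg1 tile_act1.
have actM g h z : act (g * h)%g z = act g (act h z).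
  by rewrite /act gmulfM invgM tile_actM.
have isom g x y : mdist (act g x) (act g y) = mdist x y by exact: tile_act_isom.
have sep g z : mdist z (act g z) < 4 * r -> g = 1%g.
  rewrite /act -gmulfV => /hr /(congr1 (fun h : even_subgroup F => h^-1%g)).
  by rewrite invgK invg1.
by exists (FreeAction act1 actM isom r0 sep).
Qed.

Section Quotient.
Variable A : free_action (hplane R) (even_subgroup F).
Hypothesis AE : forall g z, fa_act A g z = ta z (val g)^-1%g.

Let rep (p : {ffun I -> bool}) : W := xget 1%g [set x | forall i, parity i x = p i].

Let tile_act_continuous x : continuous (fun z => ta z x).
Proof.
move=> z B; rewrite -nbhs_ballE => -[r /= r0 rB].
exists r => // z'; rewrite ballEmdist /= => zz'; apply: rB.
by rewrite ballEmdist /= tile_act_isom.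
Qed.

(** Every orbit meets one of finitely many images of the polygon, one for each vector of parities,
    and the polygon lies in a compact box. *)
Lemma even_quotient_compact : compact [set: orbit_space A].
Proof.
have [z0 C0] : exists z, polygon z.
  by have [x Cx] := polygon_tiles (mkh 0 1); exists (ta (mkh 0 1) x).
have M0 : 0 < M.
  by apply: lt_le_trans (polygon_bounded C0); rewrite addr_gt0 ?hu_gt0 ?hs_gt0.
(* As [hu] and [hs] are at most [M] on the polygon, the height lies between [M^-1] and [M], and
   [hx z ^+ 2 <= hs z * hy z <= M ^+ 2]. *)
pose B := (fun z : R * R => mkh z.1 z.2) @` ([set` `[- M, M]] `*` [set` `[M^-1, M]]).
have cB : compact B by apply: hbox_compact; rewrite invr_gt0.
have CB z : polygon z -> B z.
  move=> /polygon_bounded zM; have y0 := hy_gt0 z; have u0 := hu_gt0 z; have s0 := hs_gt0 z.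
  have uM : hu z <= M by lra.
  have sM : hs z <= M by lra.
  have yM : hy z <= M.
    apply: le_trans sM; rewrite /hs ler_pdivlMr //.
    by rewrite -expr2; have := sqr_ge0 (hx z); lra.
  exists (hx z, hy z); last by apply: hplane_eq; rewrite ?hx_mk ?hy_mk.
  split; rewrite /= in_itv /=; last first.
    by rewrite yM andbT -[leRHS]invrK lef_pV2 ?posrE ?invr_gt0.
  have : hx z ^+ 2 <= M ^+ 2.
    have -> : hx z ^+ 2 = hs z * hy z - hy z ^+ 2.
      by rewrite /hs divfK ?gt_eqF //; ring.
    have : hs z * hy z <= M * M by rewrite ler_pM // ltW.
    by have := sqr_ge0 (hy z); rewrite expr2 [M ^+ 2]expr2; lra.
  by rewrite -[hx z ^+ 2]real_normK ?num_real // ler_sqr ?nnegrE ?(ltW M0) // ler_norml.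
have -> : [set: orbit_space A] =
    \big[setU/set0]_(p : {ffun I -> bool}) ((fun z => orbit_proj A (ta z (rep p))) @` B).
  apply/seteqP; split=> // q _; have [z <-] := orbit_proj_surj q.
  have [x Cx] := polygon_tiles z.
  pose p := [ffun i => parity i x^-1%g : bool].
  have rp i : parity i (rep p) = p i.
    have : [set y | forall i, parity i y = p i] (rep p).
       by apply: xgetPex; exists x^-1%g => j; rewrite ffunE.
    exact.
  have ev : even (x * rep p)%g.
    apply/asboolP => i; rewrite parityM rp /p ffunE -parityM mulgV; exact: parity1.
  pose g : even_subgroup F := Sub (x * rep p)%g ev.
  rewrite (bigD1 p) //=; left; exists (ta z x); first exact: CB.
  rewrite -tile_actM -[RHS](orbit_proj_act A g^-1%g) AE; congr (orbit_proj A _).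
  by rewrite -gmulfV invgK.
apply: bigsetU_compact => p _; apply: continuous_compact => //.
apply: continuous_subspaceT => z.
apply: (@continuous_comp _ _ _ (fun z => ta z (rep p)) (orbit_proj A)).
  exact: tile_act_continuous.
exact: orbit_proj_continuous.
Qed.

Lemma even_quotient_surface : closed_hyperbolic_surface (orbit_space A).
Proof.
split.
- by exists (orbit_proj A (mkh 0 1)).
- exact: even_quotient_compact.
- have -> : [set: orbit_space A] = orbit_proj A @` [set: hplane R].
    by apply/seteqP; split=> // q _; have [z <-] := orbit_proj_surj q; exists z.
  apply: connected_continuous_connected; first exact: hplane_connected.
  by apply: continuous_subspaceT; exact: orbit_proj_continuous.
- exact: orbit_space_chart.
Qed.

End Quotient.

Lemma even_subgroup_is_surface_group : exists (X : metricType R) (p : X),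
  closed_hyperbolic_surface X /\ is_fundamental_group R p (even_subgroup F).
Proof.
have [A AE] := even_free_action.
exists (orbit_space A), (orbit_proj A (mkh 0 1)); split.
  exact: even_quotient_surface AE.
exact (@orbit_space_fundamental_group _ _ _ A (mkh 0 1) (@hpath R) (@hpath0 R)
  (@hpath1 R) (@hpathxx R) (@hpath_continuous R)).
Qed.

End Tiling.

(** * Regular right-angled polygons *)

Local Close Scope group_scope.
Local Open Scope ring_scope.

Definition cycle_rel (n : nat) : rel 'I_n :=
  fun i j => (i.+1 == j :> nat) || (j.+1 == i :> nat) ||
             ((i.+1 == n) && (j == 0 :> nat)) || ((j.+1 == n) && (i == 0 :> nat)).

Section Cycle.
Variable n : nat.
Implicit Types i j : 'I_n.

Lemma cycle_rel_sym : symmetric (@cycle_rel n).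
Proof. by move=> i j; rewrite /cycle_rel; lia. Qed.

Lemma cycle_rel_irr : (1 < n)%N -> irreflexive (@cycle_rel n).
Proof. by move=> n1 i; rewrite /cycle_rel; lia. Qed.

Lemma cycle_rel_sub i j : (j <= i)%N -> cycle_rel i j ->
  (i - j = 1)%N \/ (i - j = n - 1)%N.
Proof. by have := ltn_ord i; rewrite /cycle_rel; lia. Qed.

Lemma cycle_relN_sub i j : (j <= i)%N -> i != j -> ~~ cycle_rel i j ->
  (2 <= i - j)%N /\ (i - j + 2 <= n)%N.
Proof.
move=> ji ij; have ne : (i != j :> nat) by apply: contra ij => /eqP/val_inj ->.
by have := ltn_ord i; rewrite /cycle_rel; lia.
Qed.

End Cycle.

Section RegularPolygon.
Variables (R : realType) (n : nat).
Hypothesis n5 : (5 <= n)%N.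
Local Notation I := 'I_n.

Let t : R := pi * 2 / n%:R.
Let c : R := cos t.

Let n0 : (0 : R) < n%:R. Proof. by rewrite ltr0n; lia. Qed.
Let pi0 : (0 : R) < pi. Proof. exact: pi_gt0. Qed.

Let nt : n%:R * t = pi * 2. Proof. by rewrite /t mulrC divfK // gt_eqF. Qed.

Let t0 : 0 < t. Proof. by rewrite /t divr_gt0 // mulr_gt0. Qed.

Let t_small : 5 * t <= pi * 2.
Proof. by rewrite -nt ler_wpM2r ?(ltW t0) // (ler_nat R 5 n). Qed.

Lemma cos_decreasing (x y : R) : 0 <= x -> x <= y -> y <= pi -> cos y <= cos x.
Proof.
move=> x0; rewrite le_eqVlt => /orP[/eqP -> //|xy] ypi.
have xI : x \in `[0, pi] by rewrite in_itv /= x0 (le_trans _ ypi) // ltW.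
have yI : y \in `[0, pi] by rewrite in_itv /= ypi (le_trans x0) // ltW.
by rewrite ltW // ltr_cos.
Qed.

Lemma cosB2pi (x : R) : cos (pi * 2 - x) = cos x.
Proof. by have := cosD2pi (- x); rewrite addrC mulr_natr cosN. Qed.

Let c0 : 0 < c.
Proof.
by move: t_small t0 pi0 => *; apply: cos_gt0_pihalf; apply/andP; split; lra.
Qed.

Let c1 : c < 1.
Proof.
have tI : t \in `[0, pi].
  by move: t_small t0 pi0 => *; rewrite in_itv /=; apply/andP; split; lra.
have oI : (0 : R) \in `[0, pi] by rewrite in_itv /= lexx ltW.
by rewrite -(cos0 R) ltr_cos.
Qed.

Let cos_far k : (2 <= k)%N -> (k + 2 <= n)%N -> cos (k%:R * t) <= 2 * c ^+ 2 - 1.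
Proof.
have c2 : cos (2 * t) = 2 * c ^+ 2 - 1.
  by rewrite mulr_natl cos_mulr2n -/c mulr_natl.
have half l : (2 <= l)%N -> l%:R * t <= pi -> cos (l%:R * t) <= 2 * c ^+ 2 - 1.
  move=> l2 lpi; rewrite -c2; apply: cos_decreasing => //; first by rewrite mulr_ge0 // ltW.
  by rewrite ler_wpM2r ?(ltW t0) // (ler_nat R 2 l).
move=> k2 kn; have [|lt] := leP (k%:R * t) pi; first exact: half.
rewrite -cosB2pi -nt -mulrBl -natrB; last by lia.
apply: half; first by lia.
by rewrite natrB; [rewrite mulrBl nt; move: pi0; lra|lia].
Qed.

(** The walls have time component [b] and a space component of length [a] at a multiple of the angle
    [t]. Unit normals require [a ^+ 2 - b ^+ 2 = 1] and orthogonal neighbours require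
    [a ^+ 2 * c = b ^+ 2]; these equations give [a] and [b], with [b > 0] because [c > 0]. *)
Let a2 : R := (1 - c)^-1.
Let a : R := Num.sqrt a2.
Let b : R := Num.sqrt (c * a2).

Let a20 : 0 < a2. Proof. by move: c1; rewrite invr_gt0; lra. Qed.
Let aa : a * a = a2. Proof. by rewrite -expr2 sqr_sqrtr // ltW. Qed.
Let bb : b * b = c * a2. Proof. by rewrite -expr2 sqr_sqrtr // mulr_ge0 // ltW. Qed.
Let a0 : 0 < a. Proof. by rewrite sqrtr_gt0. Qed.
Let b0 : 0 < b. Proof. by rewrite sqrtr_gt0 mulr_gt0. Qed.
Let a2c : a2 * (1 - c) = 1. Proof. by rewrite mulVf // gt_eqF // subr_gt0. Qed.

Definition regular_wall (i : I) : wall R :=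
  Wall (b - a * cos (i%:R * t)) (b + a * cos (i%:R * t)) (a * sin (i%:R * t)).
Local Notation e := regular_wall.

Let wform_regular (i j : I) :
  wform (e i) (e j) = a2 * cos (i%:R * t - j%:R * t) - c * a2.
Proof. by rewrite /wform /= cosB -bb -aa; field. Qed.

Let wform_dist (i j : I) : (j <= i)%N ->
  wform (e i) (e j) = a2 * cos ((i - j)%:R * t) - c * a2.
Proof. by move=> ji; rewrite wform_regular natrB // mulrBl. Qed.

Let wform_sym i j : wform (e i) (e j) = wform (e j) (e i).
Proof. by rewrite /wform; field. Qed.

Let wform1 i : wform (e i) (e i) = 1.
Proof. by rewrite wform_dist // subnn mul0r cos0 -[RHS]a2c; ring. Qed.

Let wform_adj i j : cycle_rel i j -> wform (e i) (e j) = 0.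
Proof.
have near i' j' : cycle_rel i' j' -> (j' <= i')%N -> wform (e i') (e j') = 0.
  move=> ij ji; rewrite wform_dist //.
  suff -> : cos ((i' - j')%:R * t) = c by rewrite /c; ring.
  have [->|->] := cycle_rel_sub ji ij; first by rewrite mul1r.
  by rewrite natrB ?(leq_trans _ n5) // mulrBl nt mul1r cosB2pi.
move=> ij; have [ji|ji] := leqP j i; first exact: near.
by rewrite wform_sym; apply: near; rewrite 1?cycle_rel_sym // ltnW.
Qed.

Let wform_opp i j : i != j -> ~~ cycle_rel i j ->
  wform (e i) (e j) <= - 1 /\ 1 + (2 * c) ^+ 2 <= wform (e i) (e j) ^+ 2.
Proof.
have far i' j' : i' != j' -> ~~ cycle_rel i' j' -> (j' <= i')%N ->
    wform (e i') (e j') <= - (1 + 2 * c).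
  move=> ij Fij ji; rewrite wform_dist //.
  have [h2 hn] := cycle_relN_sub ji ij Fij; have := cos_far h2 hn => h.
  (* This factorization of [2 * c ^+ 2 - c - 1], with [a2 * (1 - c) = 1], is the source of the gap
     [m = 2 * c]: the square of [1 + 2 * c] exceeds [1 + (2 * c) ^+ 2]. *)
  have -> : - (1 + 2 * c) = a2 * (2 * c ^+ 2 - 1) - c * a2.
    have -> : a2 * (2 * c ^+ 2 - 1) - c * a2 = - (1 + 2 * c) * (a2 * (1 - c)) by ring.
    by rewrite a2c mulr1.
  by rewrite lerD2r ler_pM2l.
move=> ij Fij; have h : wform (e i) (e j) <= - (1 + 2 * c).
  have [ji|ji] := leqP j i; first exact: far.
  rewrite wform_sym; apply: far (ltnW ji); rewrite 1?eq_sym //.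
  by rewrite cycle_rel_sym.
have := c0; split; first by lra.
by nra.
Qed.

Let nearest (x : R) : 0 <= x -> x <= pi -> exists2 k : nat, (k < n)%N &
  `|x - k%:R * t| <= t / 2.
Proof.
move=> x0 xpi; pose y := x / t + 1 / 2.
have y0 : 0 <= y by rewrite addr_ge0 // divr_ge0 // ltW.
have xt : x / t * t = x by rewrite divfK // gt_eqF.
have /andP[h1 h2] := truncn_itv y0.
have h1' : (Num.truncn y)%:R * t <= y * t by rewrite ler_wpM2r // ltW.
have h2' : y * t < (Num.truncn y).+1%:R * t by rewrite ltr_pM2r.
have yt : y * t = x + t / 2 by rewrite /y mulrDl xt; field.
exists (Num.truncn y); last first.
  by rewrite ler_norml; move: h2'; rewrite -natr1 mulrDl mul1r; lra.
rewrite -(ltr_nat R) -(ltr_pM2r t0) nt.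
by move: t0 t_small pi0; lra.
Qed.

(** Some wall direction is within the angle [t / 2] of the direction of [(x, y)]. The angle is
    measured by [acos] when [0 <= y]; the other half-plane is reached by the symmetry from [k] to
    [n - k]. *)
Let polar (x y : R) : exists i : I,
  Num.sqrt (x ^+ 2 + y ^+ 2) * cos (t / 2) <= x * cos (i%:R * t) + y * sin (i%:R * t).
Proof.
pose r := Num.sqrt (x ^+ 2 + y ^+ 2).
have rr : r ^+ 2 = x ^+ 2 + y ^+ 2 by rewrite sqr_sqrtr // addr_ge0 // sqr_ge0.
have [r0|r0] := leP r 0.
  have r00 : r = 0 by apply: le_anti; rewrite r0 sqrtr_ge0.
  have := rr; rewrite r00 expr0n /= => /esym/eqP.
  rewrite paddr_eq0 ?sqr_ge0 // !sqrf_eq0 => /andP[/eqP -> /eqP ->].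
  by exists (Ordinal (leq_trans (isT : (0 < 5)%N) n5));
    rewrite expr0n /= addr0 sqrtr0 !mul0r addr0.
have xr : -1 <= x / r <= 1.
  rewrite -ler_norml normrM normfV (gtr0_norm r0) ler_pdivrMr // mul1r.
  by rewrite -ler_sqr ?nnegrE ?(ltW r0) // rr real_normK ?num_real // lerDl sqr_ge0.
pose f := acos (x / r).
have f0 : 0 <= f by exact: acos_ge0.
have fpi : f <= pi by exact: acos_lepi.
have xE : x = r * cos f.
  by rewrite /f acosK ?in_itv //= mulrC divfK // gt_eqF.
have yE : `|y| = r * sin f.
  have s0 : 0 <= sin f by apply: sin_ge0_pi; rewrite f0.
  apply: (pexpIrn (n := 2)); rewrite ?nnegrE ?normr_ge0 ?mulr_ge0 ?(ltW r0) //.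
  rewrite real_normK ?num_real // exprMn sin2cos2 mulrBr mulr1 -exprMn -xE rr.
  by rewrite addrAC subrr add0r.
have [k kn fk] := nearest f0 fpi.
have cosk : cos (t / 2) <= cos (f - k%:R * t).
  by rewrite -[leRHS]cos_norm; apply: cos_decreasing => //; move: t0 t_small pi0; lra.
have key z : z = f - k%:R * t -> r * cos (t / 2) <= r * cos z.
  by move=> ->; rewrite ler_pM2l.
have [y0|y0] := leP 0 y.
  exists (Ordinal kn) => /=; rewrite -/r; move: yE; rewrite ger0_norm // => ->.
  have -> : x * cos (k%:R * t) + r * sin f * sin (k%:R * t) = r * cos (f - k%:R * t).
    by rewrite cosB {1}xE; ring.
  exact: key.
have yE' : y = - (r * sin f) by rewrite -yE ltr0_norm // opprK.
(* For [k = 0] the index [n - k] would be out of range, but that direction is its own mirror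
   image. *)
have [k0|k0] := posnP k.
  exists (Ordinal kn) => /=; rewrite -/r k0 mul0r cos0 sin0 mulr0 addr0 mulr1 xE.
  by apply: key; rewrite k0; ring.
have nk : (n - k < n)%N by rewrite ltn_subrL k0 (leq_trans _ n5).
exists (Ordinal nk) => /=; rewrite -/r yE' natrB ?(ltnW kn) // mulrBl nt.
have -> : sin (pi * 2 - k%:R * t) = - sin (k%:R * t).
  by have := sinD2pi (- (k%:R * t)); rewrite addrC mulr_natr sinN.
rewrite cosB2pi.
have -> : x * cos (k%:R * t) + - (r * sin f) * - sin (k%:R * t) = r * cos (f - k%:R * t).
  by rewrite cosB {1}xE; ring.
exact: key.
Qed.

(** [x3] and [r] are the hyperbolic cosine and sine of the distance to the centre. The wall nearest
    in direction gives [a * (r * cos (t / 2)) <= b * x3]; with [x3 ^+ 2 = 1 + r ^+ 2] and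
    [cos (t / 2) ^+ 2 = (1 + c) / 2] this becomes [x3 ^+ 2 <= (1 + c) * a2], with equality at the
    vertices. *)
Let polygon_bounded z : polygon e z -> hu z + hs z <= 2 * ((1 + c) * a2).
Proof.
move=> Cz; pose x1 := (hs z - hu z) / 2; pose x3 := (hu z + hs z) / 2.
have [i hi] := polar x1 (hw z).
have hC : a * (x1 * cos (i%:R * t) + hw z * sin (i%:R * t)) <= b * x3.
  rewrite -subr_le0.
  have -> : a * (x1 * cos (i%:R * t) + hw z * sin (i%:R * t)) - b * x3 = hform z (e i).
    by rewrite /hform /x1 /x3 /=; field.
  exact: Cz.
have x30 : 0 < x3 by rewrite divr_gt0 // addr_gt0 ?hu_gt0 ?hs_gt0.
have x3E : x3 ^+ 2 = 1 + (x1 ^+ 2 + hw z ^+ 2).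
  have -> : x3 ^+ 2 = x1 ^+ 2 + hu z * hs z by rewrite /x3 /x1; field.
  by rewrite hquad; ring.
pose r := Num.sqrt (x1 ^+ 2 + hw z ^+ 2).
have rr : r ^+ 2 = x1 ^+ 2 + hw z ^+ 2 by rewrite sqr_sqrtr // addr_ge0 // sqr_ge0.
have r0 : 0 <= r by exact: sqrtr_ge0.
have ch0 : 0 <= cos (t / 2) 
  by apply/ltW/cos_gt0_pihalf; move: t0 t_small pi0 => *; apply/andP; split; lra.
have ch : cos (t / 2) ^+ 2 = (1 + c) / 2.
  have : c = 2 * cos (t / 2) ^+ 2 - 1.
    have -> : c = cos ((t / 2) *+ 2) by rewrite /c; congr cos; rewrite -mulr_natr; field.
    by rewrite cos_mulr2n mulr_natl.
  by move=> {1}->; field.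
have h1 : a * (r * cos (t / 2)) <= b * x3.
  by apply: le_trans hC; rewrite ler_pM2l.
have h2 : (a * (r * cos (t / 2))) ^+ 2 <= (b * x3) ^+ 2.
  by rewrite ler_sqr ?nnegrE ?(mulr_ge0 (ltW a0) (mulr_ge0 r0 ch0)) //
     (mulr_ge0 (ltW b0) (ltW x30)).
have h3 : a2 * (r ^+ 2 * ((1 + c) / 2)) <= c * a2 * (1 + r ^+ 2).
  have a22 : a ^+ 2 = a2 by rewrite expr2 aa.
  have b22 : b ^+ 2 = c * a2 by rewrite expr2 bb.
  have l2 : (a * (r * cos (t / 2))) ^+ 2 = a2 * (r ^+ 2 * ((1 + c) / 2)).
    by rewrite -a22 -ch; ring.
  have r2 : (b * x3) ^+ 2 = c * a2 * (1 + r ^+ 2) by rewrite -b22 rr -x3E; ring.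
  by rewrite -l2 -r2.
have h4 : r ^+ 2 * ((1 + c) / 2) <= c * (1 + r ^+ 2).
  by rewrite -(ler_pM2l a20) [leRHS]mulrA (mulrC a2 c).
have h5 : r ^+ 2 * (1 - c) <= 2 * c by lra.
have h6 : r ^+ 2 <= 2 * c * a2 by rewrite -[a2]/((1 - c)^-1) ler_pdivlMr ?subr_gt0.
have h7 : x3 ^+ 2 <= (1 + c) * a2.
  rewrite x3E -rr; have -> : (1 + c) * a2 = a2 * (1 - c) + 2 * c * a2 by ring.
  by rewrite a2c lerD2l.
have h8 : 1 <= x3 ^+ 2 by rewrite x3E lerDl addr_ge0 ?sqr_ge0.
have h9 : 1 <= x3 by rewrite leNgt; apply/negP => lt; move: h8; rewrite expr2; nra.
have h10 : x3 <= x3 ^+ 2 by rewrite expr2 ler_peMr // ltW.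
have -> : hu z + hs z = 2 * x3 by rewrite /x3; field.
by lra.
Qed.

Lemma cycle_surface_group : exists (X : metricType R) (p : X),
  closed_hyperbolic_surface X /\ is_fundamental_group R p (even_subgroup (@cycle_rel n)).
Proof.
have m0 : 0 < 2 * c by rewrite mulr_gt0.
have epos i : wu (e i) + ws (e i) = 2 * b by rewrite /=; ring.
exact: (even_subgroup_is_surface_group (@cycle_rel_sym n)
  wform1 wform_adj m0 wform_opp b0 epos polygon_bounded).
Qed.

End RegularPolygon.

(** * The defining graph *)

Local Close Scope ring_scope.
Local Open Scope group_scope.

Section Geodesic.
Variables (V : finType) (r : rel V).
Hypothesis symr : symmetric r.

(** Along a shortest path the distance to [x] equals the index, and it changes by at most one along
    any edge; hence the vertices are distinct and there are no chords. *)
Lemma connect_geodesic x y : connect r x y -> exists (k : nat) (s : nat -> V),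
  [/\ s 0%N = x, s k = y, (forall i, (i < k)%N -> r (s i) (s i.+1)) &
    forall i j, (i <= k)%N -> (j <= k)%N ->
      (s i = s j -> i = j) /\ (r (s i) (s j) -> (i <= j.+1)%N)].
Proof.
move=> xy.
pose P v n := `[< exists2 p, path r x p /\ last x p = v & size p = n >].
have exP v : connect r x v -> exists n, P v n.
  by move=> /connectP[p xp ->]; exists (size p); apply/asboolP; exists p.
pose d v := if pselect (exists n, P v n) is left ex then ex_minn ex else 0%N.
have dP v : connect r x v -> P v (d v).
  by move=> /exP ex; rewrite /d; case: pselect => // ex'; case: ex_minnP.
have d_min v n : P v n -> (d v <= n)%N.
  by move=> Pn; rewrite /d; case: pselect => // ex; case: ex_minnP => m _; exact.
have d_step u v : connect r x u -> r u v -> (d v <= (d u).+1)%N.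
  move=> /dP/asboolP[p [xp pu] <-] uv; apply: d_min; apply/asboolP.
  exists (rcons p v); last by rewrite size_rcons.
  by rewrite rcons_path xp pu last_rcons.
have /asboolP[p [xp py] pk] := dP y xy.
pose s i := nth y (x :: p) i.
have sk : s (d y) = y by rewrite -pk /s nth_last.
have step i : (i < d y)%N -> r (s i) (s i.+1).
  by move=> ik; move/(pathP y): xp; apply; rewrite pk.
have xs i : (i <= d y)%N -> connect r x (s i).
  elim: i => [|i IH] ik; first exact: connect0.
  by apply: connect_trans (IH (ltnW ik)) _; apply/connect1/step.
have upper i : (i <= d y)%N -> (d (s i) <= i)%N.
  elim: i => [|i IH] ik.
    by apply: d_min; apply/asboolP; exists [::].
  apply: leq_trans (d_step _ _ (xs _ (ltnW ik)) (step _ ik)) _.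
  by rewrite ltnS IH // ltnW.
have lower i l : (i + l <= d y)%N -> (d (s (i + l)%N) <= d (s i) + l)%N.
  elim: l => [|l IH] il; first by rewrite !addn0.
  rewrite addnS in il *; apply: leq_trans (d_step _ _ (xs _ (ltnW il)) (step _ il)) _.
  by rewrite addnS ltnS IH // ltnW.
have ds i : (i <= d y)%N -> d (s i) = i.
  move=> ik; apply/eqP; rewrite eqn_leq upper //=.
  by have := lower i (d y - i)%N; rewrite subnKC // sk => /(_ (leqnn _)); lia.
exists (d y), s; split=> // i j ik jk; split=> [e|rij].
  by rewrite -(ds i ik) e ds.
by have := d_step _ _ (xs j jk) (etrans (symr _ _) rij); rewrite !ds.
Qed.

End Geodesic.

Section CycleOfArcs.
Variables (V : finType) (E : rel V) (k l : nat) (s t : nat -> V).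
Hypothesis symE : symmetric E.
Hypothesis k2 : (2 <= k)%N.
Hypothesis l2 : (2 <= l)%N.
Hypothesis t0 : t 0%N = s 0%N.
Hypothesis tl : t l = s k.
Hypothesis s_inj : forall i j, (i <= k)%N -> (j <= k)%N -> (s i == s j) = (i == j).
Hypothesis t_inj : forall i j, (i <= l)%N -> (j <= l)%N -> (t i == t j) = (i == j).
Hypothesis sE : forall i j, (i <= k)%N -> (j <= k)%N ->
  E (s i) (s j) = (i.+1 == j) || (j.+1 == i).
Hypothesis tE : forall i j, (i <= l)%N -> (j <= l)%N ->
  E (t i) (t j) = (i.+1 == j) || (j.+1 == i).
Hypothesis stN : forall i j, (0 < i < k)%N -> (0 < j < l)%N -> s i != t j.
Hypothesis stE : forall i j, (0 < i < k)%N -> (0 < j < l)%N -> ~~ E (s i) (t j).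

Let mid i : (i <= k)%N -> i != 0%N -> i != k -> (0 < i < k)%N.
Proof. by clear; lia. Qed.

Lemma arcs_cross_eq i j : (i <= k)%N -> (0 < j < l)%N -> (s i == t j) = false.
Proof.
move=> ik /andP[j0 jl]; have jl' := ltnW jl.
have [->|i0] := eqVneq i 0%N; first by rewrite -t0 t_inj // eq_sym gtn_eqF.
have [->|ik'] := eqVneq i k; first by rewrite -tl t_inj // gtn_eqF.
by apply: negbTE; apply: stN; rewrite ?j0 // mid.
Qed.

Lemma arcs_cross_adj i j : (i <= k)%N -> (0 < j < l)%N ->
  E (s i) (t j) = ((i == 0%N) && (j == 1%N)) || ((i == k) && (j.+1 == l)).
Proof.
move=> ik /andP[j0 jl]; have jl' := ltnW jl.
have [->|i0] := eqVneq i 0%N.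
  by rewrite -t0 tE //; clear -j0 k2; lia.
have [->|ik'] := eqVneq i k.
  by rewrite -tl tE //; clear -jl; lia.
by apply: negbTE; apply: stE; rewrite ?j0 // mid.
Qed.

(** The second arc is run backwards and without its ends, which belong to the first. *)
Definition arcs_cycle (i : 'I_(k + l)) : V :=
  if (i <= k)%N then s i else t (k + l - i)%N.

Let range (i : 'I_(k + l)) : (k < i)%N -> (0 < k + l - i < l)%N.
Proof. by have := ltn_ord i; clear; lia. Qed.

Lemma arcs_cycle_inj : injective arcs_cycle.
Proof.
move=> i j /eqP; rewrite /arcs_cycle; case: leqP => ik; case: leqP => jk ij.
- by apply/val_inj/eqP; rewrite -s_inj.
- by rewrite arcs_cross_eq // range in ij.
- by rewrite eq_sym arcs_cross_eq // range in ij.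
- apply/val_inj; have /andP[_ /ltnW hi] := range ik; have /andP[_ /ltnW hj] := range jk.
  have := ltn_ord i; have := ltn_ord j; move: ij; rewrite t_inj //=; clear; lia.
Qed.

Lemma arcs_cycle_adj i j : E (arcs_cycle i) (arcs_cycle j) = cycle_rel i j.
Proof.
have iN := ltn_ord i; have jN := ltn_ord j.
rewrite /arcs_cycle /cycle_rel; case: (leqP i k) => ik; case: (leqP j k) => jk.
- by rewrite sE //; clear -k2 l2 ik jk; lia.
- by rewrite arcs_cross_adj ?range //; clear -k2 l2 ik jk iN jN; lia.
- by rewrite symE arcs_cross_adj ?range //; clear -k2 l2 ik jk iN jN; lia.
- have /andP[_ /ltnW hi] := range ik; have /andP[_ /ltnW hj] := range jk.
  by rewrite tE //; clear -k2 l2 ik jk iN jN; lia.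
Qed.

End CycleOfArcs.

(** * Vertex groups and obstructions to hyperbolicity *)

Section Vertices.
Variables (V : finType) (E : rel V) (G : V -> groupType).
Hypothesis symE : symmetric E.
Hypothesis irrE : irreflexive E.
Local Notation GP := (graph_product E G).

Definition nontrivial (v : V) : bool := `[< exists g : G v, g != 1 >].

Lemma trivialP v : ~~ nontrivial v -> forall g : G v, g = 1.
Proof.
move=> /asboolP no g; apply: contrapT => g1; apply: no.
by exists g; apply/eqP.
Qed.

Lemma infinite_nontrivial v : infinite_set [set: G v] -> nontrivial v.
Proof.
move=> inf; apply: contrapT => /negP /trivialP tr; apply: inf.
by apply: sub_finite_set (finite_set1 1) => g _; exact: tr.
Qed.

(** With a one-point [Z] the flip action keeps only the coordinates, whence projections with values
    in [G v] itself. *)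
Let tau (v : V) (z : unit) := z.

Let pr_state (x : GP) := gp_act (flip tau) (fun=> 1, tt) x.

Definition gp_pr v (x : GP) : G v := (pr_state x).1 v.

Let pr_state_in x w (g : G w) :
  pr_state (x * gp_in E g) = flip tau (pr_state x) g.
Proof.
by rewrite /pr_state gp_actM ?gp_act_in //;
   [exact: flip1|exact: flipM|exact: flipC|exact: flip1|exact: flipM|exact: flipC].
Qed.

Let pr_state1 : pr_state 1 = (fun=> 1, tt).
Proof. by apply: gp_act1; [exact: flip1|exact: flipM|exact: flipC]. Qed.

Lemma gp_pr_in v x (g : G v) : gp_pr v (x * gp_in E g) = gp_pr v x * g.
Proof. by rewrite /gp_pr pr_state_in /flip /= dfwith_in. Qed.

Lemma gp_pr_out v w x (g : G w) : w != v -> gp_pr v (x * gp_in E g) = gp_pr v x.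
Proof. by move=> wv; rewrite /gp_pr pr_state_in /flip /= dfwith_out. Qed.

Lemma gp_pr1 v : gp_pr v 1 = 1. Proof. by rewrite /gp_pr pr_state1. Qed.

Lemma gp_prM v : {morph gp_pr v : x y / x * y}.
Proof.
move=> x; elim/gp_ind => [|y w g IH]; first by rewrite gp_pr1 !mulg1.
rewrite mulgA; have [wv|wv] := eqVneq w v; last by rewrite !gp_pr_out.
by case: v / wv IH => IH; rewrite !gp_pr_in IH mulgA.
Qed.

Lemma gp_prK v (g : G v) : gp_pr v (gp_in E g) = g.
Proof. by rewrite -[gp_in E g]mul1g gp_pr_in gp_pr1 mul1g. Qed.

Lemma gp_in_inj v : injective (@gp_in V E G v).
Proof. exact: can_inj (@gp_prK v). Qed.

Lemma gp_retract_infinite_vertex (D : pred V) v : D v -> infinite_set [set: G v] ->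
  infinite_set (range (gp_retract (E := E) (G := G) D)).
Proof.
move=> Dv inf fin; apply: inf.
apply: sub_finite_set (finite_preimage (f := @gp_in V E G v) _ fin).
  by move=> g _; exists (gp_in E g) => //; rewrite gp_retract_in Dv.
by move=> g h _ _; exact: gp_in_inj.
Qed.

Lemma gp_retract_infinite_pair (D : pred V) u w : D u -> D w ->
  u != w -> ~~ E u w -> nontrivial u -> nontrivial w ->
  infinite_set (range (gp_retract (E := E) (G := G) D)).
Proof.
move=> Du Dw uw Euw /asboolP[a a1] /asboolP[b b1].
apply: (@infinite_range _ (dihedral_word E a b)).
  by move=> k l /(dihedral_word_inj symE irrE uw Euw a1 b1).
by move=> k; exists (dihedral_word E a b k); rewrite // dihedral_retract.
Qed.

Lemma join_not_hyperbolic (D D' : pred V) : (forall u v, D u -> D' v -> E u v) ->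
  infinite_set (range (gp_retract (E := E) (G := G) D)) ->
  infinite_set (range (gp_retract (E := E) (G := G) D')) ->
  ~ word_hyperbolic GP.
Proof.
move=> DD' inf inf'.
have dis v : D v -> D' v -> False.
  by move=> Dv D'v; have := DD' v v Dv D'v; rewrite irrE.
apply: (commuting_retracts_not_hyperbolic (rA := gp_retract D) (rB := gp_retract D')) => //.
- exact: gp_retractM.
- exact: gp_retractM.
- exact: gp_retract_id.
- exact: gp_retract_id.
- move=> x; rewrite gp_retractI; apply: gp_retract_pred0 => v.
  by apply/negP => /andP[Dv D'v]; exact: dis Dv D'v.
- move=> x; rewrite gp_retractI; apply: gp_retract_pred0 => v.
  by apply/negP => /andP[Dv D'v]; exact: dis D'v Dv.
- by move=> x y; exact: gp_retract_commute.
Qed.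

Lemma square_not_hyperbolic p q r s : E p q -> E q r -> E r s -> E s p ->
  ~~ E p r -> ~~ E q s -> p != r -> q != s ->
  nontrivial p -> nontrivial q -> nontrivial r -> nontrivial s ->
  ~ word_hyperbolic GP.
Proof.
move=> pq qr rs sp Epr Eqs pr qs np nq nr ns.
apply: (join_not_hyperbolic (D := pred2 p r) (D' := pred2 q s)).
- move=> u v /pred2P[->|->] /pred2P[->|->] //; by rewrite symE.
- by apply: (@gp_retract_infinite_pair _ p r); rewrite //= eqxx ?orbT.
- by apply: (@gp_retract_infinite_pair _ q s); rewrite //= eqxx ?orbT.
Qed.

Lemma infinite_vertex_not_hyperbolic v p q : infinite_set [set: G v] ->
  E v p -> E v q -> p != q -> ~~ E p q -> nontrivial p -> nontrivial q ->
  ~ word_hyperbolic GP.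
Proof.
move=> inf vp vq pq Epq np nq.
apply: (join_not_hyperbolic (D := pred1 v) (D' := pred2 p q)).
- by move=> u w /eqP -> /pred2P[->|->].
- by apply: gp_retract_infinite_vertex inf; rewrite /= eqxx.
- by apply: (@gp_retract_infinite_pair _ p q); rewrite //= eqxx ?orbT.
Qed.

Lemma infinite_edge_not_hyperbolic u v : E u v ->
  infinite_set [set: G u] -> infinite_set [set: G v] -> ~ word_hyperbolic GP.
Proof.
move=> uv infu infv; apply: (join_not_hyperbolic (D := pred1 u) (D' := pred1 v)).
- by move=> u' v' /eqP -> /eqP ->.
- by apply: gp_retract_infinite_vertex infu; rewrite /= eqxx.
- by apply: gp_retract_infinite_vertex infv; rewrite /= eqxx.
Qed.

Lemma clique_subgroup_full (L : seq V) :
  {in L &, forall u v, u != v -> E u v} -> (forall v, nontrivial v -> v \in L) ->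
  forall x : GP, clique_subgroup L x.
Proof.
move=> cl full; elim/gp_ind => [|x v g IH]; first exact: clique_subgroup1.
have [vL|vL] := boolP (v \in L); first exact: clique_subgroupM.
by rewrite (trivialP (contraNN (full v) vL) g) gp_in1 mulg1.
Qed.

Hypothesis clique : forall u v, nontrivial u -> nontrivial v -> u != v -> E u v.

Lemma clique_gp_finite : (forall v, finite_set [set: G v]) -> finite_set [set: GP].
Proof.
move=> fin; have finL : finite_set
    (clique_subgroup (E := E) (G := G) [seq v <- enum V | nontrivial v]).
  by apply: clique_subgroup_finite.
apply: sub_finite_set finL => x _; apply: clique_subgroup_full => [u v|v nv].
  by rewrite !mem_filter => /andP[nu _] /andP[nv _]; exact: clique.
by rewrite mem_filter nv mem_enum.
Qed.

(** With [v] put first in the list, every element is a letter over [v] times an element of the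
    finite subgroup of the other vertices, and the projection returns that letter. *)
Lemma clique_gp_pr_finite_kernel v : nontrivial v ->
  (forall w, w != v -> finite_set [set: G w]) ->
  finite_set [set x : GP | gp_pr v x = 1].
Proof.
move=> nv fin; pose L := [seq w <- enum V | nontrivial w & w != v].
have finL : finite_set (clique_subgroup (E := E) (G := G) L).
  by apply: clique_subgroup_finite => w; rewrite mem_filter => /andP[/andP[_ /fin]].
have memL w : (w \in v :: L) = nontrivial w.
  rewrite inE mem_filter mem_enum inE andbT; have [->|wv] /= := eqVneq w v.
    by rewrite nv.
  by rewrite andbT.
apply: sub_finite_set finL => x /= x1.
have [|w nw|g [y [Ly xy]]] := clique_subgroup_full (L := v :: L) _ _ x.
- by move=> u w; rewrite !memL; exact: clique.
- by rewrite memL.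
have y1 : gp_pr v y = 1.
  have : v \notin L by rewrite mem_filter eqxx andbF.
  elim: (L) y Ly {xy} => [|w L' IH] y /= => [-> _|]; first exact: gp_pr1.
  move=> [h [z [Lz ->]]]; rewrite inE negb_or => /andP[vw vL'].
  rewrite gp_prM (IH z) // mulg1 -[gp_in E h]mul1g gp_pr_out ?gp_pr1 //.
  by rewrite eq_sym.
move: x1; rewrite xy gp_prM gp_prK y1 mulg1 => ->.
by rewrite gp_in1 mul1g.
Qed.

End Vertices.

(** * Minimal separators and induced cycles *)

Section SurfaceSubgroups.
Variables (R : realType) (V : finType) (E : rel V) (G : V -> groupType).
Hypothesis symE : symmetric E.
Hypothesis irrE : irreflexive E.
Local Notation GP := (graph_product E G).
Local Notation nt := (nontrivial G).

Lemma induced_cycle_surface n (c : 'I_n -> V) : (5 <= n)%N -> injective c ->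
  (forall i j, E (c i) (c j) = cycle_rel i j) -> (forall i, nt (c i)) ->
  contains_hyperbolic_surface_group R GP.
Proof.
move=> n5 cinj cE cnt.
have [X [p [hX hp]]] := cycle_surface_group R n5.
have [g g1] : exists g : forall i, G (c i), forall i, g i != 1.
  exists (fun i => sval (cid (asboolW (cnt i)))) => i.
  exact: svalP (cid (asboolW (cnt i))).
have n1 : (1 < n)%N by apply: leq_trans n5.
have [f [finj fM]] := crossed_embedding (@cycle_rel_sym n) (cycle_rel_irr n1)
  symE irrE cinj cE g1.
by exists X, p, (even_subgroup (@cycle_rel n)), f.
Qed.

Lemma vertex_surface v : contains_hyperbolic_surface_group R (G v) ->
  contains_hyperbolic_surface_group R GP.
Proof.
move=> [X [p [P [f [hX hp finj fM]]]]]; exists X, p, P, (fun x => gp_in E (f x)).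
split=> // [x y /(gp_in_inj symE irrE)/finj //|x y].
by rewrite fM gp_inM.
Qed.

Variables a b : V.
Hypothesis nta : nt a.
Hypothesis ntb : nt b.
Hypothesis ab : a != b.
Hypothesis Eab : ~~ E a b.

(** Vertices with a trivial group are discarded: they do not affect the product but could connect
    two sides of the graph. *)
Let e : rel V := fun x y => [&& nt x, nt y & E x y].
Let eK (K : {set V}) : rel V := fun x y => [&& e x y, x \notin K & y \notin K].

Let symeK K : symmetric (eK K).
Proof. move=> x y; rewrite /eK /e symE.
by case: (nt x); case: (nt y); case: (x \in K); case: (y \in K); rewrite /= ?andbF. Qed.

Let sep (K : {set V}) : bool := [&& a \notin K, b \notin K & ~~ connect (eK K) a b].

(** The first edge of a path avoiding this set would join [a] to itself or to [b]. So separators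
    exist, and a minimal one can be chosen. *)
Let sep_exists : sep (~: [set a; b])%SET.
Proof.
rewrite /sep !inE !eqxx orbT /=; apply/negP => /connectP[p].
have sub x y : eK (~: [set a; b])%SET x y -> x = a -> False.
  rewrite /eK /e !inE !negbK => /andP[/and3P[_ _ xy] /andP[_ yab]] xa.
  by move: yab; rewrite xa in xy; case/orP => /eqP ya; rewrite ya ?irrE ?(negbTE Eab) in xy.
case: p => [|y p] /=; first by move=> _ e0; move: ab; rewrite e0 eqxx.
by move=> /andP[/sub ay _]; case: ay.
Qed.

Section Separator.
Variable K : {set V}.
Hypothesis sepK : sep K.
Hypothesis minK : forall k, k \in K -> ~~ sep (K :\ k).

Let side (x : V) : pred V := connect (eK K) x.

Let side_good z x : nt z -> z \notin K -> side z x -> nt x && (x \notin K).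
Proof.
move=> nz zK /connectP[p zp ->] {x}; elim: p z nz zK zp => [|y p IH] z nz zK /=.
  by rewrite nz.
by move=> /andP[/andP[/and3P[_ ny _] /andP[_ yK]]]; exact: IH.
Qed.

Let aK : a \notin K. Proof. by case/and3P: sepK. Qed.
Let bK : b \notin K. Proof. by case/and3P: sepK. Qed.
Let ab_sep : ~~ side a b. Proof. by case/and3P: sepK. Qed.

Let side_disj x : side a x -> side b x -> False.
Proof.
move=> ax bx; move/negP: ab_sep; apply; apply: connect_trans ax _.
by rewrite (sym_connect_sym (symeK _)).
Qed.

Let side_nonadj x y : side a x -> side b y -> ~~ E x y.
Proof.
move=> ax by_; apply/negP => xy.
have /andP[nx xK] := side_good nta aK ax; have /andP[ny yK] := side_good ntb bK by_.
apply: (side_disj (x := y)) => //; apply: connect_trans ax (connect1 _).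
by rewrite /eK /e nx ny xy xK yK.
Qed.

(** This is how minimality enters: once [k] is restored, a path joins [z] to the other side, and it
    can leave the side of [z] only by stepping onto [k]. *)
Let nbr z z' k : nt z -> z \notin K -> ~~ side z z' -> k \in K ->
  connect (eK (K :\ k)) z z' -> exists2 x, side z x & e x k.
Proof.
move=> nz zK zz' kK /connectP[p zp z'E]; apply: contrapT => no.
move/negP: zz'; apply; rewrite {}z'E.
suff H x : side z x -> path (eK (K :\ k)) x p -> side z (last x p).
  by apply: H zp; exact: connect0.
elim: p x {zp} => [//|y p IH] x zx /= /andP[xy yp].
apply: IH yp; have /andP[nx xK] := side_good nz zK zx.
have zx0 := zx; apply: connect_trans zx (connect1 _).
move: xy; rewrite /eK => /and3P[xy _]; rewrite xy xK /= !inE negb_and negbK.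
by case/orP => // /eqP yk; case: no; exists x; [exact: zx0|rewrite -yk; exact: xy].
Qed.

Let nbr_a k : k \in K -> exists2 x, side a x & e x k.
Proof.
move=> kK; apply: (nbr (z' := b)) => //; have := minK kK.
by rewrite /sep !inE negb_and negbK (negbTE aK) (negbTE bK) !andbF /= negbK.
Qed.

Let nbr_b k : k \in K -> exists2 x, side b x & e x k.
Proof.
move=> kK; apply: (nbr (z' := a)) => //.
  apply/negP => ba; move/negP: ab_sep; apply.
  by rewrite /side (sym_connect_sym (e := eK K)) // => u v; rewrite symeK.
have := minK kK.
rewrite /sep !inE negb_and negbK (negbTE aK) (negbTE bK) !andbF /= negbK.
by rewrite (sym_connect_sym (symeK _)).
Qed.

Lemma clique_separator : {in K &, forall u v, u != v -> E u v} ->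
  word_hyperbolic GP -> ~ one_ended GP.
Proof.
move=> clK hyp.
have [ga ga1] : exists g : G a, g != 1 by exact/asboolP.
have [gb gb1] : exists g : G b, g != 1 by exact/asboolP.
apply: (@clique_splitting_not_one_ended _ E G symE irrE (side a) (enum K) a b ga gb) => //.
- by move=> v /(side_good nta aK)/andP[_]; rewrite mem_enum.
- move=> v v' av vv'; have /andP[nv vK] := side_good nta aK av.
  have [nv'|/trivialP tr] := boolP (nt v'); last by apply: Or33.
  have [v'K|v'K] := boolP (v' \in K); first by apply: Or32; rewrite mem_enum.
  apply: Or31; apply: connect_trans av (connect1 _).
  by rewrite /eK /e nv nv' vv' vK v'K.
- by move=> u v; rewrite !mem_enum; exact: clK.
- move=> v; rewrite mem_enum => vK; apply: contrapT => inf.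
  have [p ap /and3P[np _ pv]] := nbr_a vK; have [q bq /and3P[nq _ qv]] := nbr_b vK.
  apply: (infinite_vertex_not_hyperbolic symE irrE (v := v) (p := p) (q := q)) hyp => //.
  + by rewrite symE.
  + by rewrite symE.
  + by apply/eqP => pq; apply: (side_disj ap); rewrite pq.
  + exact: side_nonadj.
- exact: connect0.
- by rewrite mem_enum.
Qed.

Variables x y : V.
Hypothesis xK : x \in K.
Hypothesis yK : y \in K.
Hypothesis xy : x != y.
Hypothesis Exy : ~~ E x y.

Let ntx : nt x. Proof. by have [z _ /and3P[]] := nbr_a xK. Qed.
Let nty : nt y. Proof. by have [z _ /and3P[]] := nbr_a yK. Qed.

(** Take a shortest path from [x] to [y] in the graph on [x], [y] and the side of [z]. It is
    induced, its interior lies in that side because it repeats no vertex, and it has length at least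
    2 because [x] and [y] are not adjacent. *)
Let arc z : nt z -> z \notin K -> (forall k, k \in K -> exists2 u, side z u & e u k) ->
  exists (k : nat) (s : nat -> V), [/\ s 0%N = x, s k = y, (2 <= k)%N,
    (forall i, (0 < i < k)%N -> side z (s i)) &
    forall i j, (i <= k)%N -> (j <= k)%N -> [/\ nt (s i), (s i == s j) = (i == j) &
      E (s i) (s j) = (i.+1 == j) || (j.+1 == i)]].
Proof.
move=> nz zK nbrz.
pose S v := [|| v == x, v == y | side z v].
pose r : rel V := fun u v => [&& e u v, S u & S v].
have symr : symmetric r.
  move=> u v; rewrite /r /e symE.
  by case: (nt u); case: (nt v); case: (S u); case: (S v); rewrite /= ?andbF.
have Snt v : S v -> nt v.
  by case/or3P => [/eqP ->|/eqP ->|/(side_good nz zK)/andP[]].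
have [u zu ux] := nbrz x xK; have [v zv vy] := nbrz y yK.
have Su : S u by rewrite /S zu !orbT.
have Sv : S v by rewrite /S zv !orbT.
have Sx : S x by rewrite /S eqxx.
have Sy : S y by rewrite /S eqxx orbT.
have zr w : side z w -> connect r z w.
  move=> /connectP[p zp wE]; suff H u' : side z u' -> path (eK K) u' p ->
      w = last u' p -> connect r u' w by apply: H zp wE; exact: connect0.
  elim: p u' {zp wE} => [|w' p IH] t zt /=; first by move=> _ ->; exact: connect0.
  move=> /andP[tw w'p] wE; have zw' : side z w' by apply: connect_trans zt (connect1 tw).
  apply: connect_trans (IH w' zw' w'p wE); apply: connect1.
  by rewrite /r /S zt zw' !orbT; case/and3P: tw => ->.
have conn : connect r x y.
  have xu : connect r x u by apply: connect1; rewrite symr /r ux Su Sx.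
  apply: connect_trans xu _; have vy' : connect r v y by apply: connect1; rewrite /r vy Sv Sy.
  apply: connect_trans vy'; apply: connect_trans (zr v zv).
  by rewrite (sym_connect_sym symr) zr.
have [k [s [s0 sk step geo]]] := connect_geodesic symr conn.
have k1 : (0 < k)%N.
  by rewrite lt0n; apply/eqP => k0; move: sk; rewrite k0 s0 => e0; move: xy; rewrite e0 eqxx.
have SS i : (i <= k)%N -> S (s i).
  case: i => [|i] ik; first by rewrite s0.
  by have := step i ik; case/and3P.
have rE i j : (i <= k)%N -> (j <= k)%N -> r (s i) (s j) = E (s i) (s j).
  by move=> ik jk; rewrite /r /e !SS // !Snt ?SS // !andbT.
exists k, s; split=> //.
- rewrite ltn_neqAle k1 andbT; apply/eqP => k_1.
  have s1 : s 1%N = y by rewrite k_1 sk.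
  have := step 0%N k1; rewrite /r /e s0 s1 => /and3P[/and3P[_ _ xy']].
  by have := Exy; rewrite xy'.
- move=> i /andP[i0 ik]; have /or3P[/eqP sx|/eqP sy|//] := SS i (ltnW ik).
  + have := (geo i 0%N (ltnW ik) (leq0n _)).1; rewrite s0 => /(_ sx) i00.
    by rewrite i00 in i0.
  + have := (geo i k (ltnW ik) (leqnn _)).1; rewrite sk => /(_ sy) i00.
    by rewrite i00 ltnn in ik.
- move=> i j ik jk; split; first exact/Snt/SS.
  + by apply/eqP/eqP => [/(geo i j ik jk).1|->].
  + apply/idP/idP => [Eij|/orP[/eqP ij|/eqP ji]].
    * have h1 : (i <= j.+1)%N by apply: (geo i j ik jk).2; rewrite rE.
      have h2 : (j <= i.+1)%N by apply: (geo j i jk ik).2; rewrite rE // symE.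
      have ne : i != j by apply: contraTneq Eij => ->; rewrite irrE.
      by clear -h1 h2 ne; lia.
    * by subst j; rewrite -rE //; exact: step.
    * by subst i; rewrite symE -rE //; exact: step.
Qed.

Lemma nonclique_separator :
  word_hyperbolic GP -> contains_hyperbolic_surface_group R GP.
Proof.
move=> hyp.
have [k [s [s0 sk k2 sA sP]]] := arc nta aK nbr_a.
have [l [t [t0 tl l2 tB tP]]] := arc ntb bK nbr_b.
have s_inj i j (ik : (i <= k)%N) (jk : (j <= k)%N) : (s i == s j) = (i == j).
  by have [] := sP i j ik jk.
have t_inj i j (il : (i <= l)%N) (jl : (j <= l)%N) : (t i == t j) = (i == j).
  by have [] := tP i j il jl.
have sE i j (ik : (i <= k)%N) (jk : (j <= k)%N) :
    E (s i) (s j) = (i.+1 == j) || (j.+1 == i).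
  by have [] := sP i j ik jk.
have tE i j (il : (i <= l)%N) (jl : (j <= l)%N) :
    E (t i) (t j) = (i.+1 == j) || (j.+1 == i).
  by have [] := tP i j il jl.
have stN i j : (0 < i < k)%N -> (0 < j < l)%N -> s i != t j.
  move=> /sA si /tB tj; apply/eqP => e0.
  by apply: (side_disj si); rewrite e0.
have stE i j : (0 < i < k)%N -> (0 < j < l)%N -> ~~ E (s i) (t j).
  by move=> /sA si /tB; exact: side_nonadj.
have ts0 : t 0%N = s 0%N by rewrite t0 s0.
have tsl : t l = s k by rewrite tl sk.
have crossE := arcs_cross_adj k2 ts0 tsl tE stE.
have crossN := arcs_cross_eq ts0 tsl t_inj stN.
have [n5|n4] := leqP 5 (k + l).
  apply: (induced_cycle_surface (c := arcs_cycle (k := k) (l := l) s t)) => //.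
  - exact: arcs_cycle_inj ts0 tsl s_inj t_inj stN.
  - exact: arcs_cycle_adj symE k2 l2 ts0 tsl sE tE stE.
  - move=> i; rewrite /arcs_cycle; case: leqP => ik; first by have [] := sP i i ik ik.
    have il : (k + l - i <= l)%N by rewrite leq_subLR leq_add2r ltnW.
    by have [] := tP _ _ il il.
have kE : k = 2%N by clear -n4 k2 l2; lia.
have lE : l = 2%N by clear -n4 k2 l2; lia.
subst k l; exfalso.
have [nt0 _ E01] := sP 0%N 1%N isT isT; have [nt1 _ E12] := sP 1%N 2%N isT isT.
have [nt2 _ _] := sP 2%N 0%N isT isT; have [nt1' _ _] := tP 1%N 0%N isT isT.
apply: (square_not_hyperbolic symE irrE (p := s 0%N) (q := s 1%N) (r := s 2%N)
  (s := t 1%N)) hyp => //.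
- by rewrite crossE.
- by rewrite symE crossE.
- by rewrite s0 sk.
- by rewrite crossE.
- by rewrite s0 sk.
- by rewrite crossN.
Qed.

End Separator.

Lemma nonadjacent_pair : word_hyperbolic GP -> one_ended GP ->
  contains_hyperbolic_surface_group R GP.
Proof.
move=> hyp ends.
have [K /minsetP[sepK minK] _] := minset_exists sep_exists.
have {}minK k : k \in K -> ~~ sep (K :\ k).
  move=> kK; apply/negP => /minK /(_ (subsetDl _ _)) e0.
  by move: kK; rewrite -e0 !inE eqxx.
have [cl|ncl] := pselect {in K &, forall u v, u != v -> E u v}.
  by have := clique_separator sepK minK cl hyp.
have [x [y [xK yK xy Exy]]] : exists x y, [/\ x \in K, y \in K, x != y & ~~ E x y].
  apply: contrapT => no; apply: ncl => x y xK yK xy; apply: contrapT => /negP Exy.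
  by apply: no; exists x, y.
exact: (nonclique_separator sepK minK xK yK xy Exy hyp).
Qed.

End SurfaceSubgroups.

Theorem theorem33 (R : realType) (V : finType) (E : rel V)
    (symE : symmetric E) (irrE : irreflexive E)
    (G : V -> groupType) (GX : forall v : V, class_X R (G v)) :
  class_X R (graph_product E G).
Proof.
split; first by apply: gp_finitely_generated => v; have [] := GX v.
have [ends|] := pselect (one_ended (graph_product E G)); last exact: Or31.
have [hyp|] := pselect (word_hyperbolic (graph_product E G)); last exact: Or32.
apply: Or33.
have [clique|ncl] := pselect (forall u v, nontrivial G u -> nontrivial G v -> u != v -> E u v);
    last first.
  have [a [b [na nb ab Eab]]] : exists a b,
      [/\ nontrivial G a, nontrivial G b, a != b & ~~ E a b].
    apply: contrapT => no; apply: ncl => a b na nb ab; apply: contrapT => /negP Eab.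
    by apply: no; exists a, b.
  exact: nonadjacent_pair ab Eab hyp ends.
have [[v inf]|fin] := pselect (exists v, infinite_set [set: G v]); last first.
  have finG v : finite_set [set: G v].
    by apply: contrapT => inf; apply: fin; exists v.
  by have := finite_not_one_ended (clique_gp_finite symE clique finG) ends.
have nv := infinite_nontrivial inf.
have fin w : w != v -> finite_set [set: G w].
  move=> wv; apply: contrapT => infw.
  have vw : E v w by apply: clique => //; [exact: infinite_nontrivial|rewrite eq_sym].
  exact: (infinite_edge_not_hyperbolic symE irrE vw inf infw hyp).
have kerf := clique_gp_pr_finite_kernel symE irrE clique nv fin.
have prM : {morph gp_pr (E := E) (G := G) v : x y / x * y} by exact: gp_prM.
have prS (g : G v) : exists x : graph_product E G, gp_pr v x = g.
  by exists (gp_in E g); exact: gp_prK.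
apply: (vertex_surface symE irrE (v := v)).
have [_ []] := GX v => //.
- by have := finite_kernel_one_ended prM prS kerf ends.
- by have := finite_kernel_word_hyperbolic prM prS kerf hyp.
Qed.
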